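(* Suppose $R=1$, $L=t\in(0,1)$ are given, fix $K_1,K_2\in\mathbb{N}$, $T>0$ and set $\Sigma=\{1,\dots,K_1\}$. Then there exists a probability space on which a $\Sigma\times\llbracket-K_2,K_2\rrbracket$-indexed discrete line ensemble $(L_1,L_2,\dots,L_{K_1})$ is defined such that: (1) the law of $(L_1,\dots,L_{K_1})$ satisfies the Hall-Littlewood Gibbs property with parameter $t$ for the set $S=\llbracket-K_2+1,K_2\rrbracket$; (2) the law of $(L_1(-K_2),\dots,L_1(K_2))$ is the same as that of $(-\mathfrak{h}(-K_2+1),\dots,-\mathfrak{h}(K_2+1))$, viewed as random vectors in $\mathbb{R}^{2K_2+1}$, where $\mathfrak{h}$ is the height function at time $T$ of the ASEP with right jump rate $R$ and left jump rate $L$ started from the step initial condition.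
   Context: ASEP from step initial condition: at time $0$ there is a particle at every site of $\mathbb{Z}_{\le0}$ and none on $\mathbb{Z}_{\ge1}$. Each particle has two independent exponential clocks of rates $L$ and $R$; when the left (right) clock rings the particle attempts to jump one site left (right), the jump being performed if and only if the target site is vacant. For $x\in\mathbb{Z}$ the height function $\mathfrak{h}(x)$ is the number of particles at or to the right of $x$. For integers $T_0<T_1$, $\llbracket T_0,T_1\rrbracket=\{T_0,\dots,T_1\}$. An up-right path on $\llbracket T_0,T_1\rrbracket$ is $\ell:\llbracket T_0,T_1\rrbracket\to\mathbb{Z}$ with $\ell(i+1)-\ell(i)\in\{0,1\}$. A $\{1,\dots,N\}\times\llbracket T_0,T_1\rrbracket$-indexed discrete line ensemble is a random $N$-tuple $(L_1,\dots,L_N)$ of up-right paths on $\llbracket T_0,T_1\rrbracket$. Weight: for paths $\ell,f,g$ on $\llbracket T_0,T_1\rrbracket$ ($f=\infty$ allowed) and $S\subset\llbracket T_0+1,T_1\rrbracket$, with $\Delta^+=f-\ell$, $\Delta^-=\ell-g$, $$W_t(T_0,T_1,\ell,f,g;S)=\prod_{i\in S}\left(1-\mathbf{1}_{\{\Delta^+(i-1)-\Delta^+(i)=1\}}t^{\Delta^+(i-1)}\right)\prod_{i\in S}\left(1-\mathbf{1}_{\{\Delta^-(i-1)-\Delta^-(i)=1\}}t^{\Delta^-(i-1)}\right)$$ if $f(i)\ge\ell(i)\ge g(i)$ for all $i\in S$, and $0$ otherwise; if $f=\infty$ the first product is $1$. Hall-Littlewood Gibbs property with parameter $t$ for $S$: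 with the convention $L_0=\infty$, for every $i\in\{1,\dots,N-1\}$ and all paths $\ell_{i-1},\ell_{i+1}$ ($\ell_0=\infty$ if $i=1$) and integers $a,b$ for which the conditioning event below has positive probability, and every up-right path $\ell$ with $\ell(T_0)=a$, $\ell(T_1)=b$, $$\mathbb{P}(L_i=\ell\mid L_i(T_0)=a,L_i(T_1)=b,L_{i-1}=\ell_{i-1},L_{i+1}=\ell_{i+1})=\frac{W_t(T_0,T_1,\ell,\ell_{i-1},\ell_{i+1};S)}{Z},$$ where $Z$ is the normalization constant (depending on $T_0,T_1,a,b,\ell_{i-1},\ell_{i+1},S$ but not on $\ell$) making the right side a probability distribution in $\ell$. (For $N=1$ the property is vacuous.) *)

(* Defs.v *)
From HB Require Import structures.
From mathcomp Require Import all_boot all_order all_algebra finmap.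
From mathcomp Require Import all_classical all_reals all_analysis.

Set Implicit Arguments.
Unset Strict Implicit.
Unset Printing Implicit Defensive.

Import Order.TTheory GRing.Theory Num.Theory.
Import numFieldNormedType.Exports.

Local Open Scope classical_set_scope.
Local Open Scope ring_scope.

Section Probability.
Context d (Om : measurableType d) (R : realType) (P : probability Om R).

Definition mutually_independent (I : eqType) (X : I -> {RV P >-> R}) : Prop :=
  forall (J : seq I) (A : I -> set R),
    uniq J -> (forall j, j \in J -> measurable (A j)) ->
    P (\bigcap_(j in [set` J]) (X j @^-1` A j))
      = (\prod_(j <- J) P (X j @^-1` A j))%E.

Definition cond_prob (A B : set Om) : R := fine (P (A `&` B)) / fine (P B).

End Probability.

Definition same_law (R : realType) d1 (Om1 : measurableType d1)
    (P1 : probability Om1 R) d2 (Om2 : measurableType d2)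
    (P2 : probability Om2 R) (n : nat)
    (X1 : Om1 -> n.-tuple R) (X2 : Om2 -> n.-tuple R) : Prop :=
  forall A : set (n.-tuple R), measurable A ->
    pushforward P1 X1 A = pushforward P2 X2 A.

Section ASEP.
Context {R : realType}.

(* Particles are labelled by [p : nat] from right to left, particle [p]
   starting at site [- p]; directions are booleans, [true] meaning "right".
   [xi (p, dir, k)] is the waiting time between the [k]-th ring (time 0 if
   [k = 0]) and the next ring of the clock [dir] of particle [p]. *)

Definition rings_at (xi : nat * bool * nat -> R) (p : nat) (dir : bool) (s : R)
  : Prop := exists k : nat, s = \sum_(j < k.+1) xi (p, dir, j : nat).

Definition dir_step (dir : bool) : int := if dir then 1 else -1.

Definition vacant (x : nat -> int) (z : int) : Prop := forall q : nat, x q <> z.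

(* In the second clause, the state just before the ring at time [s] is read
   off as the state at all times [u < s] close enough to [s]. *)
Definition asep_trajectory (xi : nat * bool * nat -> R) (x : nat -> R -> int)
  : Prop :=
  [/\ forall p : nat, x p 0 = - p%:Z,
      forall (p : nat) (dir : bool) (s : R), 0 < s -> rings_at xi p dir s ->
        \forall u \near s^'-,
          x p s = if `[< vacant (x ^~ u) (x p u + dir_step dir) >]
                  then x p u + dir_step dir else x p u
    & forall (p : nat) (s s' : R), 0 <= s -> s <= s' ->
        (forall (dir : bool) (u : R), s < u -> u <= s' -> ~ rings_at xi p dir u) ->
        x p s' = x p s].

(* [X p s] is the position of particle [p] at time [s >= 0]. *)
Definition is_step_asep d (Om : measurableType d) (P : probability Om R)
    (rateL rateR : R) (xi : nat * bool * nat -> {RV P >-> R})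
    (X : nat -> R -> Om -> int) : Prop :=
  [/\ mutually_independent xi,
      forall (p : nat) (dir : bool) (k : nat) (A : set R), measurable A ->
        P (xi (p, dir, k) @^-1` A)
          = exponential_prob (if dir then rateR else rateL) A,
      forall (p : nat) (s : R) (z : int), 0 <= s ->
        measurable [set w | X p s w = z]
    & {ae P, forall w, asep_trajectory (fun c => xi c w) (fun p s => X p s w)}].

(* Almost surely only finitely many particles are at or to the right of [z];
   [fset_set] is empty on infinite sets. *)
Definition height (x : nat -> int) (z : int) : int :=
  #|` fset_set [set p : nat | z <= x p] |%:Z.

End ASEP.

Definition zint (T0 T1 : int) : set int := [set i | T0 <= i <= T1].

(* Functions on the integer interval [zint T0 T1], for [T0 < T1]: the entry of
   index [k] is the value at [T0 + k]. *)
Definition zfun (T0 T1 : int) : Type := {ffun 'I_(`|T1 - T0|%N.+1) -> int}.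

(* Only meant for [i] in [zint T0 T1]. *)
Definition val_at (T0 T1 : int) (l : zfun T0 T1) (i : int) : int :=
  l (inord `|i - T0|%N).

Definition up_right (T0 T1 : int) (l : zfun T0 T1) : Prop :=
  forall i : int, T0 <= i -> i < T1 ->
    val_at l (i + 1) - val_at l i = 0 \/ val_at l (i + 1) - val_at l i = 1.

Section HallLittlewood.
Context {R : realType} (T0 T1 : int).
Implicit Types (l g : zfun T0 T1) (f : option (zfun T0 T1)) (S : set int).

Definition HL_factor (t : R) (Delta : int -> int) (i : int) : R :=
  1 - (Delta (i - 1) - Delta i == 1)%:R * t ^ Delta (i - 1).

(* [f = None] stands for the upper boundary [f = +oo]. *)
Definition HL_weight (t : R) l f g S : R :=
  if `[< forall i, S i ->
           (if f is Some f' then val_at l i <= val_at f' i else true) /\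
           val_at g i <= val_at l i >]
  then (if f is Some f'
        then \big[*%R/1]_(i \in S)
               HL_factor t (fun j => val_at f' j - val_at l j) i
        else 1) *
       \big[*%R/1]_(i \in S) HL_factor t (fun j => val_at l j - val_at g j) i
  else 0.

Definition up_right_bridges (a b : int) : set (zfun T0 T1) :=
  [set l | [/\ up_right l, val_at l T0 = a & val_at l T1 = b]].

Definition is_line_ensemble d (Om : measurableType d) (N : nat)
    (L : 'I_N -> Om -> zfun T0 T1) : Prop :=
  (forall i l, measurable [set w | L i w = l]) /\
  (forall i w, up_right (L i w)).

(* The curve [L_(i-1)] above [L_i], with the convention [L_0 = +oo]; the curves
   [L_1, ..., L_N] are indexed here by the ordinals [0, ..., N - 1]. *)
Definition curve_above (Om : Type) (N : nat) (L : 'I_N -> Om -> zfun T0 T1)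
    (i : 'I_N) (w : Om) : option (zfun T0 T1) :=
  if (i : nat) == 0%N then None else Some (L (ord_pred i) w).

Definition HL_Gibbs d (Om : measurableType d) (P : probability Om R) (N : nat)
    (t : R) (S : set int) (L : 'I_N -> Om -> zfun T0 T1) : Prop :=
  forall i : 'I_N, (i.+1 < N)%N -> forall f g (a b : int),
    let E := [set w | [/\ val_at (L i w) T0 = a, val_at (L i w) T1 = b,
                          curve_above L i w = f & L (ordS i) w = g]] in
    (0 < P E)%E -> forall l, up_right_bridges a b l ->
      cond_prob P [set w | L i w = l] E
        = HL_weight t l f g S
          / \sum_(l' \in up_right_bridges a b) HL_weight t l' f g S.

End HallLittlewood.

(* Main.v *)
(* Encode a state of ASEP by the up-right path [l i = - h (i + 1)]: particle
   jumps become flips of local maxima (rate 1) and local minima (rate t).  Let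
   [W l g] be the product over all of Z of the Hall-Littlewood factors of the
   pair [(l, g)].  Flipping [l] or [g] at one site changes only two factors, and
   a finite computation shows that the generator acting on [g] and a positive
   generator acting on [l] agree on [W] up to a discrete second derivative of
   [l], which telescopes.  Hence the law [p] of the ASEP path at time [T]
   satisfies [sum_g W l g * p g = e^((1 - t) T) * p l].  The weight
   [e^(-(1 - t) T k) * W c_0 c_1 * ... * W c_(k-1) c_k * p c_k] is therefore a
   probability on sequences of curves whose first curve has law [p], and it is
   Gibbs by construction since the conditional weight of a curve given its
   neighbours is a product of two factors [W].

   The eigenvector relation is obtained without a generator on the infinite
   system: the clocks of the particles [p < N] ring in a given chronological
   order [w] with an explicit probability, [w] determines the path as soon as
   some particle [q < N] never rings, and summing over [w] reduces the relation
   to a recursion on the length of [w].  That recursion only gives two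
   inequalities, but they match in the limit [N -> oo]. *)

Require Import Defs.
From HB Require Import structures.
From mathcomp Require Import all_boot all_order all_algebra finmap.
From mathcomp Require Import all_classical all_reals all_analysis.
From mathcomp Require Import zify ring lra.

Set Implicit Arguments.
Unset Strict Implicit.
Unset Printing Implicit Defensive.

Import Order.TTheory GRing.Theory Num.Theory.
Import numFieldNormedType.Exports.

Local Open Scope classical_set_scope.
Local Open Scope ring_scope.

(** * Flips of up-right paths *)

(** The operator acting on [l] is the transpose of the ASEP generator, that is, the operator of the
    forward equation. So the mean of [W l] over the ASEP path and the law of that path obey the same
    evolution up to a source term, and they start equal: the step path is the highest path with its
    tails, hence [W l step] is the indicator of [l = step]. The telescoped source is [1 - t] times
    the first minus the last increment of [l] in a window, namely 1 - 0 when both tails are at rest;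
    this is where the exponent [(1 - t) T] comes from. With only [N] particles the last of them may
    leave its site; then the source can be smaller and the path also depends on particles outside
    the system. So one comparison is an upper bound for all words, and the other keeps the words in
    which some particle is silent. For probabilities of events only lower bounds are proved, through
    explicit disjoint subevents. These have total mass tending to 1, which yields the upper bounds
    by passing to complements. *)

Definition up_rightZ (l : int -> int) : Prop :=
  forall i, l i = l (i - 1) \/ l i = l (i - 1) + 1.

Definition flip (l : int -> int) (i a : int) : int -> int :=
  fun j => if j == i then l j + a else l j.

Definition is_max (l : int -> int) (i : int) : bool :=
  (l i == l (i - 1) + 1) && (l (i + 1) == l i).

Definition is_min (l : int -> int) (i : int) : bool :=
  (l i == l (i - 1)) && (l (i + 1) == l i + 1).

Section FlipGenerator.
Context {R : realType} (t : R).

(** Gain minus loss of the forward equation: [flip l i 1] has a maximum at [i], which drops to [l]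
    at rate 1, while the minimum of [l] is left at rate [t]; symmetrically at a maximum. It is the
    transpose of [flip_bw], as [ind_flip] checks. *)
Definition flip_fw (u : (int -> int) -> R) (l : int -> int) (i : int) : R :=
  (is_min l i)%:R * (u (flip l i 1) - t * u l) +
  (is_max l i)%:R * (t * u (flip l i (-1)) - u l).

Definition flip_bw (u : (int -> int) -> R) (g : int -> int) (i : int) : R :=
  (is_max g i)%:R * (u (flip g i (-1)) - u g) +
  (is_min g i)%:R * (t * (u (flip g i 1) - u g)).

Definition gap (l g : int -> int) : int -> int := fun k => l k - g k.

Definition HL_prod (A : int) (n : nat) (l g : int -> int) : R :=
  \prod_(0 <= j < n) HL_factor t (gap l g) (A + j%:Z).

(* The two factors of [HL_prod] that a flip at a site can change, in terms of
   the increments [a, b] of [l] and [c, e] of [g] on both sides of the site. *)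
Let pr (x : int) (a b c e : bool) : R :=
  (1 - (x - (x + a%:Z - c%:Z) == 1)%:R * t ^ x) *
  (1 - ((x + a%:Z - c%:Z) - (x + a%:Z + b%:Z - c%:Z - e%:Z) == 1)%:R
     * t ^ (x + a%:Z - c%:Z)).

(** Every power of [t] involved is [t ^ x] times 1, [t] or [t^-1], so each of the 16 cases is an
    identity of rational functions in [t] and an independent unknown [t ^ x]. *)
Let pr_local (t0 : t != 0) x a b c e :
  (~~ a && b)%:R * (pr x true false c e - t * pr x false true c e) +
  (a && ~~ b)%:R * (t * pr x false true c e - pr x true false c e) -
  ((c && ~~ e)%:R * (pr x a b false true - pr x a b true false) +
   (~~ c && e)%:R * (t * (pr x a b true false - pr x a b false true))) =
  (1 - t) * (b%:R - a%:R) * pr x a b c e.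
Proof.
have X1 (y : int) (u v : bool) : (y - (y + u%:Z - v%:Z) == 1) = ~~ u && v.
  by case: u; case: v => /=; lia.
have X2 (y z : int) (u v : bool) :
  ((y - z) - (y + u%:Z - z - v%:Z) == 1) = ~~ u && v.
  by case: u; case: v => /=; lia.
have E (u v : bool) : t ^ (x + u%:Z - v%:Z) =
    t ^ x * (if u then if v then 1 else t else if v then t^-1 else 1).
  case: u; case: v; rewrite ?addr0 ?subr0 ?addrK ?mulr1//.
    by rewrite expfzDr// expr1z.
  by rewrite expfzDr// exprN1.
by rewrite /pr !X1 !X2 !E; case: a; case: b; case: c; case: e => /=; field.
Qed.

Lemma flip_at l i a : flip l i a i = l i + a.
Proof. by rewrite /flip eqxx. Qed.

Lemma flip_out l i a j : j != i -> flip l i a j = l j.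
Proof. by rewrite /flip => /negbTE->. Qed.

(** A flip at [A + j] alters the gap at that site only, which enters the factors [j] and [j.+1]; the
    others are collected here. This is why flips at [n] sites go with [n.+1] factors. *)
Let rest (A : int) (n j : nat) (l g : int -> int) : R :=
  \prod_(0 <= k < n.+1 | (k != j) && (k != j.+1))
    HL_factor t (gap l g) (A + k%:Z).

Let HL_prod_split A n j l g : (j < n)%N ->
  HL_prod A n.+1 l g = rest A n j l g *
    (HL_factor t (gap l g) (A + j%:Z) * HL_factor t (gap l g) (A + j%:Z + 1)).
Proof.
move=> jn; rewrite /HL_prod.
rewrite (bigD1_seq j) ?mem_index_iota ?iota_uniq//; last by lia.
rewrite -big_filter (bigD1_seq j.+1) ?mem_filter ?mem_index_iota
  ?filter_uniq ?iota_uniq//; last by lia.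
rewrite big_filter_cond /rest -[A + j%:Z + 1]addrA.
have -> : j%:Z + 1 = j.+1%:Z by lia.
by rewrite [RHS]mulrC -[RHS]mulrA.
Qed.

Let rest_eq A n j l g l' g' :
  (forall k, k != A + j%:Z -> gap l g k = gap l' g' k) ->
  rest A n j l g = rest A n j l' g'.
Proof.
move=> H; apply: eq_bigr => k /andP[k1 k2].
by rewrite /HL_factor !H//; lia.
Qed.

Lemma HL_prod_flip (t0 : t != 0) A n j l g : (j < n)%N ->
  up_rightZ l -> up_rightZ g ->
  let i := A + j%:Z in
  flip_fw (fun l' => HL_prod A n.+1 l' g) l i -
  flip_bw (fun g' => HL_prod A n.+1 l g') g i =
  (1 - t) * (l (i + 1) - l i - (l i - l (i - 1)))%:~R * HL_prod A n.+1 l g.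
Proof.
move=> jn ul ug i.
have bit (h : int -> int) k : up_rightZ h -> exists b : bool,
    h k = h (k - 1) + b%:Z.
  by move=> uh; case: (uh k) => ->; [exists false|exists true]; rewrite ?addr0.
have [a la] := bit l i ul; have [b lb] := bit l (i + 1) ul.
have [c gc] := bit g i ug; have [e ge] := bit g (i + 1) ug.
rewrite !addrK in lb ge.
have Hl s : HL_prod A n.+1 (flip l i s) g = rest A n j l g *
    (HL_factor t (gap (flip l i s) g) i *
     HL_factor t (gap (flip l i s) g) (i + 1)).
  rewrite (@HL_prod_split A n j)//; congr (_ * _); apply: rest_eq => k ki.
  by rewrite /gap flip_out.
have Hg s : HL_prod A n.+1 l (flip g i s) = rest A n j l g *
    (HL_factor t (gap l (flip g i s)) i *
     HL_factor t (gap l (flip g i s)) (i + 1)).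
  rewrite (@HL_prod_split A n j)//; congr (_ * _); apply: rest_eq => k ki.
  by rewrite /gap flip_out.
set x := l (i - 1) - g (i - 1).
have prE l' g' (a' b' c' e' : bool) : l' (i - 1) = l (i - 1) ->
    g' (i - 1) = g (i - 1) -> l' i = l (i - 1) + a'%:Z ->
    l' (i + 1) = l (i - 1) + a'%:Z + b'%:Z -> g' i = g (i - 1) + c'%:Z ->
    g' (i + 1) = g (i - 1) + c'%:Z + e'%:Z ->
    HL_factor t (gap l' g') i * HL_factor t (gap l' g') (i + 1) =
    pr x a' b' c' e'.
  move=> h1 h2 h3 h4 h5 h6; rewrite /HL_factor /gap addrK h1 h2 h3 h4 h5 h6 -/x.
  rewrite /pr.
  have -> : l (i - 1) + a'%:Z - (g (i - 1) + c'%:Z) = x + a'%:Z - c'%:Z.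
    by rewrite /x; lia.
  have -> // : l (i - 1) + a'%:Z + b'%:Z - (g (i - 1) + c'%:Z + e'%:Z) =
    x + a'%:Z + b'%:Z - c'%:Z - e'%:Z by rewrite /x; lia.
have HL : HL_prod A n.+1 l g = rest A n j l g * pr x a b c e.
  by rewrite (@HL_prod_split A n j)// (prE l g a b c e)// (lb, ge) (la, gc).
have ni : i + 1 != i by lia.
have ni' : i - 1 != i by lia.
have minl : is_min l i = ~~ a && b.
  by rewrite /is_min lb la; case: (a); case: (b); lia.
have maxl : is_max l i = a && ~~ b.
  by rewrite /is_max lb la; case: (a); case: (b); lia.
have ming : is_min g i = ~~ c && e.
  by rewrite /is_min ge gc; case: (c); case: (e); lia.
have maxg : is_max g i = c && ~~ e.
  by rewrite /is_max ge gc; case: (c); case: (e); lia.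
(* The indicator fixes the two increments next to [i], so the flipped product is [pr] at explicit
   arguments; where the indicator vanishes there is nothing to compare. *)
have F1 : (is_min l i)%:R * HL_prod A n.+1 (flip l i 1) g =
    (~~ a && b)%:R * (rest A n j l g * pr x true false c e).
  rewrite minl; case: (boolP (~~ a && b)) => [/andP[/negbTE a0 b1]|];
    last by rewrite !mul0r.
  by rewrite Hl (prE _ _ true false c e) ?flip_at ?flip_out ?la ?lb ?ge ?gc//;
    rewrite ?la ?a0 ?b1 ?gc //=; lia.
have F2 : (is_max l i)%:R * HL_prod A n.+1 (flip l i (-1)) g =
    (a && ~~ b)%:R * (rest A n j l g * pr x false true c e).
  rewrite maxl; case: (boolP (a && ~~ b)) => [/andP[a1 /negbTE b0]|];
    last by rewrite !mul0r.
  by rewrite Hl (prE _ _ false true c e) ?flip_at ?flip_out ?la ?lb ?ge ?gc//;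
    rewrite ?la ?a1 ?b0 ?gc //=; lia.
have F3 : (is_max g i)%:R * HL_prod A n.+1 l (flip g i (-1)) =
    (c && ~~ e)%:R * (rest A n j l g * pr x a b false true).
  rewrite maxg; case: (boolP (c && ~~ e)) => [/andP[c1 /negbTE e0]|];
    last by rewrite !mul0r.
  by rewrite Hg (prE _ _ a b false true) ?flip_at ?flip_out ?la ?lb ?ge ?gc//;
    rewrite ?la ?c1 ?e0 ?gc //=; lia.
have F4 : (is_min g i)%:R * HL_prod A n.+1 l (flip g i 1) =
    (~~ c && e)%:R * (rest A n j l g * pr x a b true false).
  rewrite ming; case: (boolP (~~ c && e)) => [/andP[/negbTE c0 e1]|];
    last by rewrite !mul0r.
  by rewrite Hg (prE _ _ a b true false) ?flip_at ?flip_out ?la ?lb ?ge ?gc//;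
    rewrite ?la ?c0 ?e1 ?gc //=; lia.
have -> : l (i + 1) - l i - (l i - l (i - 1)) = b%:Z - a%:Z.
  by rewrite lb la; lia.
rewrite /flip_fw /flip_bw.
have -> u v w : w * (u - t * v) = w * u - t * (w * v) :> R by ring.
have -> u v w : w * (t * u - v) = t * (w * u) - w * v :> R by ring.
have -> u v w : w * (u - v) = w * u - w * v :> R by ring.
have -> u v w : w * (t * (u - v)) = t * (w * u) - t * (w * v) :> R by ring.
rewrite F1 F2 F3 F4 HL minl maxl ming maxg.
have := pr_local t0 x a b c e; set p := pr x a b c e.
rewrite rmorphB /= -!pmulrn => H.
rewrite (_ : (1 - t) * _ * (_ * p) =
  rest A n j l g * ((1 - t) * (b%:R - a%:R) * p)); last by ring.
rewrite -H /p; clear; case: a; case: b; case: c; case: e => /=; ring.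
Qed.

End FlipGenerator.

(** Both tails are those of the step initial condition; flips are considered at the [n] sites in
    between. *)
Definition conf (A : int) (n : nat) (l : int -> int) : Prop :=
  [/\ up_rightZ l, forall i : int, i < A -> l i = i &
      forall i : int, A + n%:Z <= i -> l i = 0].

Section Configurations.
Context {R : realType} (t : R).
Hypotheses (t_gt0 : 0 < t) (t_lt1 : t < 1).
Variables (A : int) (n : nat).

Lemma flip_min_up_right l i : up_rightZ l -> is_min l i -> up_rightZ (flip l i 1).
Proof.
move=> ul /andP[/eqP h1 /eqP h2] j; rewrite /flip.
have := ul j; case: (eqVneq j i) => [->|ji].
  by case: eqVneq => [|_ _]; [lia|right; lia].
case: (eqVneq (j - 1) i) => [ji'|_] //.
by have -> : j = i + 1; [lia|rewrite h2 addrK; lia].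
Qed.

Lemma flip_max_up_right l i :
  up_rightZ l -> is_max l i -> up_rightZ (flip l i (-1)).
Proof.
move=> ul /andP[/eqP h1 /eqP h2] j; rewrite /flip.
have := ul j; case: (eqVneq j i) => [->|ji].
  by case: eqVneq => [|_ _]; [lia|left; lia].
case: (eqVneq (j - 1) i) => [ji'|_] //.
by have -> : j = i + 1; [lia|rewrite h2 addrK; lia].
Qed.

Lemma conf_flip_min l (j : nat) : (j < n)%N -> conf A n l ->
  is_min l (A + j%:Z) -> conf A n (flip l (A + j%:Z) 1).
Proof.
move=> jn [ul lA lB] m; split; first exact: flip_min_up_right.
  by move=> i iA; rewrite flip_out ?lA//; lia.
by move=> i iA; rewrite flip_out ?lB//; lia.
Qed.

Lemma conf_flip_max l (j : nat) : (j < n)%N -> conf A n l ->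
  is_max l (A + j%:Z) -> conf A n (flip l (A + j%:Z) (-1)).
Proof.
move=> jn [ul lA lB] m; split; first exact: flip_max_up_right.
  by move=> i iA; rewrite flip_out ?lA//; lia.
by move=> i iA; rewrite flip_out ?lB//; lia.
Qed.

Definition fw_sum (u : (int -> int) -> R) l : R :=
  \sum_(0 <= j < n) flip_fw t u l (A + j%:Z).

Definition bw_sum (u : (int -> int) -> R) g : R :=
  \sum_(0 <= j < n) flip_bw t u g (A + j%:Z).

(** The second differences in [HL_prod_flip] telescope to the two boundary increments of [l]. *)
Lemma HL_prod_sum l g : up_rightZ l -> up_rightZ g ->
  bw_sum (fun g' => HL_prod t A n.+1 l g') g =
  fw_sum (fun l' => HL_prod t A n.+1 l' g) l +
  (1 - t) * ((l A - l (A - 1)) - (l (A + n%:Z) - l (A + n%:Z - 1)))%:~R *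
    HL_prod t A n.+1 l g.
Proof.
move=> ul ug; apply/eqP; rewrite addrC -subr_eq -opprB eqr_oppLR; apply/eqP.
rewrite /fw_sum /bw_sum -sumrB -mulrN1 -!mulrA [X in _ * X]mulrC !mulrA.
rewrite mulrN1 -mulrN -rmorphN opprB.
transitivity (\sum_(0 <= j < n) (1 - t) * HL_prod t A n.+1 l g *
   ((l (A + j.+1%:Z) - l (A + j.+1%:Z - 1))%:~R -
    (l (A + j%:Z) - l (A + j%:Z - 1))%:~R)).
  apply: eq_big_nat => j /= jn; rewrite HL_prod_flip//; last by rewrite gt_eqF.
  rewrite mulrAC -rmorphB /=; congr (_ * _%:~R).
  have -> : A + j.+1%:Z = A + j%:Z + 1 by lia.
  by rewrite addrK.
rewrite -mulr_sumr telescope_sumr// addr0.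
by rewrite -rmorphB mulrAC.
Qed.

(** Uniformization: with [r] the total rate of the clocks, one application of this operator accounts
    for one ring, whether the jump is performed or blocked. *)
Definition fw_gen (r : R) (u : (int -> int) -> R) l : R := r * u l + fw_sum u l.

Lemma fw_genE r u l : fw_gen r u l =
  (r - \sum_(0 <= j < n) ((is_min l (A + j%:Z))%:R * t + (is_max l (A + j%:Z))%:R)) * u l
  + \sum_(0 <= j < n) ((is_min l (A + j%:Z))%:R * u (flip l (A + j%:Z) 1) +
                       (is_max l (A + j%:Z))%:R * (t * u (flip l (A + j%:Z) (-1)))).
Proof.
rewrite mulrBl -addrA; congr (_ + _); rewrite mulr_suml addrC -sumrB.
by apply: eq_bigr => j _; rewrite /flip_fw; ring.
Qed.

Lemma fw_gen_sum r (I : Type) (s : seq I) (a : I -> R)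
    (u : I -> (int -> int) -> R) l :
  fw_gen r (fun l' => \sum_(i <- s) a i * u i l') l =
  \sum_(i <- s) a i * fw_gen r (u i) l.
Proof.
elim: s => [|i s IH].
  rewrite big_nil fw_genE big_nil mulr0 add0r big1// => j _.
  by rewrite !big_nil !mulr0 addr0.
rewrite big_cons -IH !fw_genE big_cons mulrDr !addrA mulr_sumr.
rewrite mulrDr.
have E (a' b c d e f : R) : a' = b + d -> e = c + f ->
   a' + e = b + c + d + f.
  by move=> -> ->; rewrite addrACA addrA.
apply: E; first by rewrite mulrCA.
rewrite mulr_sumr -big_split; apply: eq_bigr => j _; rewrite !big_cons /=; ring.
Qed.

(** In [fw_genE] only the diagonal coefficient could be negative. Each maximum uses an up-step
    ending there and each minimum an up-step leaving it, and a path of height [A - 1] at [A - 1]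
    that stays nonpositive has at most [1 - A] up-steps; hence the bound on [r]. *)
Lemma fw_gen_le r u v l : conf A n l -> - A%:~R * (1 + t) + (1 + t) <= r :> R ->
  (forall l', conf A n l' -> u l' <= v l') -> fw_gen r u l <= fw_gen r v l.
Proof.
move=> cl rA uv; have [ul lA lB] := cl.
rewrite !fw_genE lerD//; last first.
  rewrite big_nat [leRHS]big_nat; apply: ler_sum => j /= jn; rewrite lerD//.
    case: (boolP (is_min _ _)) => m; rewrite /= ?mul0r// ?mul1r.
    by apply: uv; apply: conf_flip_min.
  case: (boolP (is_max _ _)) => m; rewrite /= ?mul0r// ?mul1r ler_wpM2l ?(ltW t_gt0)//.
  by apply: uv; apply: conf_flip_max.
apply: ler_wpM2l; last exact: uv.
(* [k = 0] counts the up-steps into the sites, for the maxima; [k = 1] those out of them, for the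
   minima. *)
have tel k : \sum_(0 <= j < n) (l (A + j%:Z + k) - l (A + j%:Z + k - 1)) =
    l (A + n%:Z + k - 1) - l (A + k - 1).
  rewrite (eq_bigr (fun j : nat => l (A + j.+1%:Z + k - 1) - l (A + j%:Z + k - 1))).
    by rewrite telescope_sumr// addr0.
  by move=> j _; congr (l _ - _); lia.
have l_le0 i : l i <= 0.
  have mono (m : nat) : l i <= l (i + m%:Z).
    elim: m => [|m]; first by rewrite addr0.
    move=> /le_trans; apply; have := ul (i + m.+1%:Z).
    have -> : i + m.+1%:Z - 1 = i + m%:Z by lia.
    by case=> ->; lia.
  have := mono `|(A + n%:Z - i)%R|%N; rewrite (lB (i + _))//; lia.
have mmax : \sum_(0 <= j < n) (is_max l (A + j%:Z))%:R <= - A%:~R + 1 :> R.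
  apply: (@le_trans _ _ (\sum_(0 <= j < n) (l (A + j%:Z + 0) - l (A + j%:Z + 0 - 1)))%:~R).
    rewrite rmorph_sum /=; apply: ler_sum => j _; rewrite !addr0 /is_max.
    have [->|->] := ul (A + j%:Z); last first.
      rewrite eqxx [X in X%:~R](_ : _ = 1); last by lia.
      by case: (_ == _ :> int).
    rewrite (_ : (_ == _ + 1) = false) /= ?subrr//; lia.
  rewrite tel !addr0; have := l_le0 (A + n%:Z - 1).
  rewrite (lA (A - 1)); last by lia.
  have -> : - A%:~R + 1 = (1 - A)%:~R :> R by rewrite rmorphB /= addrC.
  by rewrite ler_int; lia.
have mmin : \sum_(0 <= j < n) (is_min l (A + j%:Z))%:R <= - A%:~R + 1 :> R.
  apply: (@le_trans _ _ (\sum_(0 <= j < n) (l (A + j%:Z + 1) - l (A + j%:Z + 1 - 1)))%:~R).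
    rewrite rmorph_sum /=; apply: ler_sum => j _; rewrite !addrK /is_min.
    have [->|->] := ul (A + j%:Z + 1); rewrite addrK.
      rewrite (_ : (_ == _ + 1) = false) ?andbF /= ?subrr//; lia.
    rewrite eqxx andbT [X in X%:~R](_ : _ = 1); last by lia.
    by case: (_ == _ :> int).
  rewrite tel !addrK; have := l_le0 (A + n%:Z).
  have := ul A; rewrite (lA (A - 1)); last by lia.
  have -> : - A%:~R + 1 = (1 - A)%:~R :> R by rewrite rmorphB /= addrC.
  by rewrite ler_int; lia.
rewrite subr_ge0 (le_trans _ rA)// big_split /= -mulr_suml.
have -> : - A%:~R * (1 + t) + (1 + t) = (- A%:~R + 1) * t + (- A%:~R + 1) :> R by ring.
by rewrite lerD// ler_wpM2r// ltW.
Qed.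

End Configurations.

(** * Comparison of two recursions that differ by a scalar *)

Section BinomialComparison.
Context {R : realType} (t : R).
Hypotheses (t_gt0 : 0 < t) (t_lt1 : t < 1).
Variables (A : int) (n : nat) (r s : R).
Hypotheses (s_ge0 : 0 <= s) (rA : - A%:~R * (1 + t) + (1 + t) <= r :> R).

(** The binomial theorem for [(G + s) ^ k] with a scalar [s]: [v j] stands for the value of [G ^ j]
    applied to the initial function. *)
Definition binconv (v : nat -> R) (k : nat) : R :=
  \sum_(j < k.+1) 'C(k, j)%:R * s ^+ (k - j) * v j.

Lemma binconvS v k :
  binconv v k.+1 = binconv (fun j => v j.+1) k + s * binconv v k.
Proof.
rewrite /binconv big_ord_recl /= bin0 subn0 mul1r.
under eq_bigr do rewrite /bump /= add1n binS natrD subSS mulrDl mulrDl.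
rewrite big_split /= addrA addrC; congr (_ + _).
  rewrite mulr_sumr [RHS]big_ord_recl /= bin0 subn0 mul1r mulrA -exprS; congr (_ + _).
  rewrite big_ord_recr /= bin_small// !mul0r addr0.
  apply: eq_bigr => j _; rewrite /bump /= add1n !mulrA [s * _]mulrC -[_ * s * _]mulrA.
  by rewrite -exprS -subSn// subSS.
Qed.

(** With equalities throughout this would be the binomial theorem; monotonicity of [fw_gen] carries
    inequalities through the same induction. The cap [K] is there because the recursions hold only
    while the particles stay inside the window. *)
Lemma fw_gen_upper (f V : nat -> (int -> int) -> R) K :
  (forall l, conf A n l -> f 0%N l <= V 0%N l) ->
  (forall k l, (k < K)%N -> conf A n l ->
     f k.+1 l <= fw_gen t A n r (f k) l + s * f k l) ->
  (forall k l, (k < K)%N -> conf A n l ->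
     fw_gen t A n r (V k) l <= V k.+1 l) ->
  forall k l, (k <= K)%N -> conf A n l -> f k l <= binconv (V ^~ l) k.
Proof.
move=> f0 fS VS; elim=> [|k IH] l kK cl.
  by rewrite /binconv big_ord1 bin0 expr0 !mul1r; exact: f0.
rewrite binconvS (le_trans (fS _ _ _ _))// lerD//; last first.
  by rewrite ler_wpM2l// IH// ltnW.
apply: (@le_trans _ _ (fw_gen t A n r (fun l => binconv (V ^~ l) k) l)).
  by apply: fw_gen_le => // l' cl'; apply: IH => //; exact: ltnW.
rewrite fw_gen_sum; apply: ler_sum => j _.
rewrite ler_wpM2l ?mulr_ge0 ?exprn_ge0//; apply: VS => //.
by rewrite (leq_ltn_trans _ kK)// -ltnS.
Qed.

(** The recursion for [f] is available on [good] paths only. On the others every [V j] is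
    nonpositive, and the bound follows from [0 <= f k l]. *)
Lemma fw_gen_lower (f V : nat -> (int -> int) -> R) (good : (int -> int) -> Prop) K :
  (forall l, conf A n l -> V 0%N l <= f 0%N l) ->
  (forall k l, (k < K)%N -> conf A n l -> good l ->
     fw_gen t A n r (f k) l + s * f k l <= f k.+1 l) ->
  (forall k l, (k < K)%N -> conf A n l ->
     V k.+1 l <= fw_gen t A n r (V k) l) ->
  (forall k l, (k <= K)%N -> conf A n l -> 0 <= f k l) ->
  (forall k l, (k <= K)%N -> conf A n l -> ~ good l -> V k l <= 0) ->
  forall k l, (k <= K)%N -> conf A n l -> binconv (V ^~ l) k <= f k l.
Proof.
move=> f0 fS VS f_ge0 V_le0; elim=> [|k IH] l kK cl.
  by rewrite /binconv big_ord1 bin0 expr0 !mul1r; exact: f0.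
have [gl|ngl] := pselect (good l); last first.
  rewrite (le_trans _ (f_ge0 _ _ _ _))// /binconv sumr_le0// => j _.
  rewrite mulr_ge0_le0 ?mulr_ge0 ?exprn_ge0// V_le0//.
  by rewrite (leq_trans _ kK)// -ltnS.
rewrite binconvS (le_trans _ (fS _ _ _ _ _))// lerD//; last first.
  by rewrite ler_wpM2l// IH// ltnW.
apply: (@le_trans _ _ (fw_gen t A n r (fun l => binconv (V ^~ l) k) l)); last first.
  by apply: fw_gen_le => // l' cl'; apply: IH => //; exact: ltnW.
rewrite fw_gen_sum; apply: ler_sum => j _.
rewrite ler_wpM2l ?mulr_ge0 ?exprn_ge0//; apply: VS => //.
by rewrite (leq_ltn_trans _ kK)// -ltnS.
Qed.

End BinomialComparison.

Section HLProdBounds.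
Context {R : realType} (t : R).
Hypotheses (t_gt0 : 0 < t) (t_lt1 : t < 1).

(** The gap drops by at most 1 per step, so it can become negative only by a drop from 0, where the
    factor is [1 - t ^ 0 = 0]. Drops from a positive gap give factors strictly between 0 and 1. *)
Lemma HL_prod_bounds (A : int) (n : nat) l g : up_rightZ l -> up_rightZ g ->
  0 <= gap l g (A - 1) ->
  HL_prod t A n l g = 0 \/
  [/\ 0 < HL_prod t A n l g, HL_prod t A n l g <= 1 &
      forall j, (j <= n)%N -> 0 <= gap l g (A - 1 + j%:Z)].
Proof.
move=> ul ug g0; elim: n => [|n [IH|[IH1 IH2 IH3]]].
- by right; rewrite /HL_prod big_nil; split=> // j; rewrite leqn0 => /eqP->; rewrite addr0.
- by left; rewrite /HL_prod big_nat_recr//= -/(HL_prod t A n l g) IH mul0r.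
have E : A + n%:Z - 1 = A - 1 + n%:Z by lia.
have := IH3 n (leqnn n); rewrite -E => d0.
have st : gap l g (A + n%:Z - 1) - 1 <= gap l g (A + n%:Z).
  by rewrite /gap; have := ul (A + n%:Z); have := ug (A + n%:Z); lia.
have IH3' : 0 <= gap l g (A + n%:Z) ->
    forall j : nat, (j <= n.+1)%N -> 0 <= gap l g (A - 1 + j%:Z).
  move=> h j; rewrite leq_eqVlt => /orP[/eqP->|]; last exact: IH3.
  by have -> : A - 1 + n.+1%:Z = A + n%:Z by lia.
rewrite /HL_prod big_nat_recr//= -/(HL_prod t A n l g) {1 2 3}/HL_factor.
case: eqP => [dr|ndr] /=; last first.
  right; rewrite mul0r subr0 mulr1; split=> //.
  by apply: IH3'; lia.
have [d1|d1] := eqVneq (gap l g (A + n%:Z - 1)) 0.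
  by left; rewrite d1 expr0z mul1r subrr mulr0.
right; rewrite mul1r.
have tp : 0 < t ^ gap l g (A + n%:Z - 1) by rewrite exprz_gt0.
have tl : t ^ gap l g (A + n%:Z - 1) < 1.
  move: d1 d0; case: (gap _ _ _) => // m m0 _; rewrite -exprnP.
  by rewrite exprn_ilt1 ?(ltW t_gt0).
split.
- by rewrite mulr_gt0// subr_gt0.
- by rewrite mulr_ile1 ?subr_ge0 ?(ltW tl) ?(ltW IH1)// gerBl ltW.
- by apply: IH3'; lia.
Qed.

End HLProdBounds.

(** * ASEP as a dynamics on paths *)

Definition path_of (y : nat -> int) : int -> int := fun i => - height y (i + 1).

(* The particles [p >= N] have not moved. *)
Definition packed (N : nat) (y : nat -> int) : Prop :=
  (forall p, y p.+1 < y p) /\ (forall p, (N <= p)%N -> y p = - p%:Z).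

Definition move (c : nat * bool) (y : nat -> int) : nat -> int :=
  if `[< vacant y (y c.1 + dir_step c.2) >]
  then fun q => if q == c.1 then y q + dir_step c.2 else y q
  else y.

Section Packed.
Variables (N : nat) (y : nat -> int).
Hypothesis py : packed N y.

Lemma packed_lt p q : (p < q)%N -> y q < y p.
Proof.
have [dy _] := py; elim: q => // q IH; rewrite ltnS leq_eqVlt => /orP[/eqP->//|].
by move=> /IH; apply: lt_trans.
Qed.

Lemma packed_inj : injective y.
Proof.
by move=> p q; case: (ltngtP p q) => // /packed_lt; lia.
Qed.

Lemma packed_ge p : - p%:Z <= y p.
Proof.
have [dy yN] := py.
have H k : - (p + k)%N%:Z <= y (p + k)%N -> - p%:Z <= y p.
  elim: k => [|k IH]; first by rewrite addn0.
  by move=> h; apply: IH; have := dy (p + k)%N; rewrite -addnS; lia.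
by apply: (H N); rewrite yN// leq_addl.
Qed.

Lemma packed_le p : y p <= y 0%N.
Proof. by case: p => // p; rewrite ltW// packed_lt. Qed.

Lemma height_packed z B : (N <= B)%N -> - B%:Z < z ->
  height y z = \sum_(0 <= p < B) (z <= y p)%R%:Z.
Proof.
move=> NB Bz; rewrite /height.
have -> : [set p : nat | z <= y p] = [set` [fset p in [seq p <- iota 0 B | z <= y p]]%fset].
  apply/seteqP; split => p /=; rewrite !inE mem_filter mem_iota /=; last by case/andP.
  move=> zp; rewrite zp /= add0n ltnNge; apply/negP => Bp.
  by have [_ /(_ p)] := py; rewrite (leq_trans NB Bp) => /(_ isT); lia.
rewrite set_fsetK card_fseq undup_id ?filter_uniq ?iota_uniq// size_filter.
rewrite /index_iota subn0; elim: (iota 0 B) => [|p s IH]; first by rewrite big_nil.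
by rewrite big_cons -IH /= PoszD.
Qed.

Lemma path_of_packed i B : (N <= B)%N -> - B%:Z <= i ->
  path_of y i = - \sum_(0 <= p < B) (i + 1 <= y p)%R%:Z.
Proof. by move=> NB Bi; rewrite /path_of (@height_packed _ B)//; lia. Qed.

Lemma path_of_occ i :
  path_of y i = path_of y (i - 1) + `[< exists p, y p = i >]%:Z.
Proof.
pose B := (N + `|i| + 1)%N.
rewrite !(@path_of_packed _ B) ?subrK; [|lia..].
have -> : \sum_(0 <= p < B) (i <= y p)%R%:Z =
   \sum_(0 <= p < B) (i + 1 <= y p)%R%:Z + \sum_(0 <= p < B) (y p == i)%:Z.
  by rewrite -big_split; apply: eq_bigr => p _ /=; case: eqP; lia.
rewrite opprD -[LHS]addr0 -addrA; congr (_ + _).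
apply/eqP; rewrite eq_sym addrC subr_eq0; apply/eqP.
case: asboolP => [[p pi]|np] /=; last first.
  by rewrite big1// => p _; case: eqP => // pi; case: np; exists p.
rewrite (bigD1_seq p) ?iota_uniq//=; last first.
  rewrite mem_index_iota /= ltnNge; apply/negP => Bp.
  by have [_ /(_ p)] := py; lia.
rewrite pi eqxx big1//= => q qp; case: eqP => // qi.
by move: qp; rewrite (@packed_inj q p) ?eqxx// qi.
Qed.

Lemma path_of_up_right : up_rightZ (path_of y).
Proof.
move=> i; rewrite path_of_occ; case: asboolP => _ /=; first by right.
by left; rewrite addr0.
Qed.

Lemma path_of_max i : is_max (path_of y) i =
  `[< exists p, y p = i >] && ~~ `[< exists p, y p = i + 1 >].
Proof.
rewrite /is_max (path_of_occ i) (path_of_occ (i + 1)) addrK.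
by rewrite (path_of_occ i); case: asboolP; case: asboolP => _ _ /=; lia.
Qed.

Lemma path_of_min i : is_min (path_of y) i =
  ~~ `[< exists p, y p = i >] && `[< exists p, y p = i + 1 >].
Proof.
rewrite /is_min (path_of_occ i) (path_of_occ (i + 1)) addrK.
by rewrite (path_of_occ i); case: asboolP; case: asboolP => _ _ /=; lia.
Qed.

Lemma path_of_low i : i <= - N%:Z -> path_of y i = i.
Proof.
move=> iN; rewrite (@path_of_packed _ `|i|); [|lia..].
rewrite (eq_big_nat _ _ (F2 := fun=> 1%:Z)).
  by rewrite sumr_const_nat subn0; lia.
move=> p /= pi; have := packed_ge p; lia.
Qed.

Lemma path_of_high i : y 0%N <= i -> path_of y i = 0.
Proof.
move=> yi; rewrite (@path_of_packed _ (N + `|i|)); [|lia..].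
by rewrite big1 ?oppr0// => p _; have := packed_le p; lia.
Qed.

Lemma conf_path_of n : y 0%N <= 1 - N%:Z + n%:Z -> conf (1 - N%:Z) n (path_of y).
Proof.
move=> yn; split; first exact: path_of_up_right.
  by move=> i iN; apply: path_of_low; lia.
by move=> i iN; apply: path_of_high; exact: le_trans iN.
Qed.

Lemma move_packed p dir : (p < N)%N -> packed N (move (p, dir) y).
Proof.
move=> pN; rewrite /move; case: asboolP => //= v.
have [dy yN] := py; split => q; last first.
  by move=> Nq; rewrite ifN ?yN//; lia.
case: eqP => [qp|_]; case: eqP => [qp'|_] //; first by lia.
  have := v q; have := dy q; rewrite -qp; case: (dir) => /=; rewrite /dir_step; lia.
have := v q.+1; have := dy q; rewrite -qp'; case: (dir) => /=; rewrite /dir_step; lia.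
Qed.

End Packed.

(** A right jump from [y p] changes the height at [y p + 1] only, a left jump the one at [y p] only;
    the shift by one in [path_of] places the flips at [y p] and [y p - 1]. *)
Lemma path_of_move N y p dir : packed N y -> (p < N)%N ->
  vacant y (y p + dir_step dir) ->
  path_of (move (p, dir) y) =
  if dir then flip (path_of y) (y p) (-1) else flip (path_of y) (y p - 1) 1.
Proof.
move=> py pN v; apply/funext => i.
have py' := move_packed py dir pN.
pose B := (N + `|i| + 1)%N.
have pB : (p < B)%N by lia.
have -> : path_of (move (p, dir) y) i = path_of y i +
   ((i + 1 <= y p)%R%:Z - (i + 1 <= y p + dir_step dir)%R%:Z).
  rewrite (@path_of_packed _ _ py' _ B) ?(@path_of_packed _ _ py _ B); [|lia..].
  rewrite (bigD1_seq p) ?mem_index_iota ?iota_uniq//.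
  rewrite [in RHS](bigD1_seq p) ?mem_index_iota ?iota_uniq//=.
  rewrite {1}/move asboolT//= eqxx.
  rewrite [X in - (_ + X) = _](_ : _ = \sum_(0 <= q < B | q != p) (i + 1 <= y q)%R%:Z).
    by ring.
  by apply: eq_bigr => q qp; rewrite /move asboolT//= ifN.
by rewrite /flip /dir_step; case: dir {v py'} => /=; case: eqP; lia.
Qed.

Lemma vacantP y z : vacant y z <-> ~ exists p, y p = z.
Proof. by split=> [v [p /v]|v p pz] //; apply: v; exists p. Qed.

Lemma sum_occupied (R : realType) N y n (F : int -> R) : packed N y ->
  y 0%N <= 1 - N%:Z + n%:Z - 1 ->
  (forall i, ~ (exists p, y p = i) -> F i = 0) ->
  \sum_(0 <= p < N) F (y p) = \sum_(0 <= j < n) F (1 - N%:Z + j%:Z).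
Proof.
move=> py yn F0.
transitivity (\sum_(0 <= p < N) \sum_(0 <= j < n)
    (y p == 1 - N%:Z + j%:Z)%:R * F (1 - N%:Z + j%:Z)).
  apply: eq_big_nat => p /= pN; have := packed_ge py p; have := packed_le py p.
  move=> h1 h2; pose j := `|(y p + N%:Z - 1)%R|%N.
  have ej : y p = 1 - N%:Z + j%:Z by rewrite /j; lia.
  rewrite (bigD1_seq j) ?mem_index_iota ?iota_uniq//=; last by lia.
  rewrite -ej eqxx mul1r big1_seq ?addr0// => k /andP[kj _].
  by rewrite ej; case: eqP; [lia|rewrite mul0r].
rewrite exchange_big_nat /=; apply: eq_big_nat => j /= jn.
rewrite -mulr_suml; have [[p pj]|/F0->] := pselect (exists p, y p = 1 - N%:Z + j%:Z);
  last by rewrite mulr0.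
have pN : (p < N)%N.
  rewrite ltnNge; apply/negP => Np; have [_ /(_ _ Np)] := py; lia.
rewrite (bigD1_seq p) ?mem_index_iota ?iota_uniq//= pj eqxx big1 ?addr0 ?mul1r//.
move=> q qp; rewrite -pj; case: eqP => // /(packed_inj py) qp'.
by move: qp; rewrite qp' eqxx.
Qed.

Section ParticleGenerator.
Context {R : realType} (t : R).

Definition clocks (N : nat) : seq (nat * bool) :=
  [seq (p, b) | p <- iota 0 N, b <- [:: true; false]].

Definition rate (c : nat * bool) : R := if c.2 then 1 else t.

Lemma sum_clocks N (F : nat * bool -> R) :
  \sum_(c <- clocks N) F c = \sum_(0 <= p < N) (F (p, true) + F (p, false)).
Proof.
rewrite /clocks big_allpairs_dep /= /index_iota subn0; apply: eq_bigr => p _.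
by rewrite !big_cons big_nil addr0.
Qed.

(** All rings, blocked ones included, have total rate [N%:R * (1 + t)]; the performed jumps add the
    generator. Exclusion lets the sum over particles be read as a sum over sites. *)
Lemma move_generator N n y (phi : (int -> int) -> R) : packed N y ->
  y 0%N <= 1 - N%:Z + n%:Z - 1 ->
  \sum_(c <- clocks N) rate c * phi (path_of (move c y)) =
  N%:R * (1 + t) * phi (path_of y) + bw_sum t (1 - N%:Z) n phi (path_of y).
Proof.
move=> py yn; rewrite sum_clocks /rate /=.
set g := path_of y.
pose F i : R := (is_max g i)%:R * (phi (flip g i (-1)) - phi g).
pose G i : R := (is_min g i)%:R * (t * (phi (flip g i 1) - phi g)).
transitivity (\sum_(0 <= p < N) ((1 + t) * phi g + (F (y p) + G (y p - 1)))).
  apply: eq_big_nat => p /= pN.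
  have -> : 1 * phi (path_of (move (p, true) y)) = phi g + F (y p).
    rewrite mul1r /F (path_of_max py) asboolT /=; last by exists p.
    have [v|v] := pselect (vacant y (y p + 1)).
      rewrite (path_of_move py) //= asboolF; last exact/vacantP.
      by rewrite /= mul1r [RHS]addrC subrK.
    rewrite asboolT; last by apply: contrapT => /vacantP.
    by rewrite /= mul0r addr0 /move asboolF.
  have -> : t * phi (path_of (move (p, false) y)) = t * phi g + G (y p - 1).
    rewrite /G (path_of_min py) subrK [X in _ && X]asboolT /= ?andbT; last by exists p.
    have [v|v] := pselect (vacant y (y p - 1)).
      rewrite (path_of_move py) //= asboolF; last exact/vacantP.
      by rewrite /= mul1r mulrBr [RHS]addrC subrK.
    rewrite asboolT; last by apply: contrapT => /vacantP.
    by rewrite /= mul0r addr0 /move asboolF.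
  by ring.
rewrite big_split /= sumr_const_nat subn0 big_split /=; congr (_ + _).
  by rewrite -mulrA mulr_natl.
have -> : bw_sum t (1 - N%:Z) n phi g =
   \sum_(0 <= j < n) F (1 - N%:Z + j%:Z) + \sum_(0 <= j < n) G (1 - N%:Z + j%:Z).
  by rewrite -big_split.
congr (_ + _).
  rewrite (@sum_occupied _ N y n)// => i np.
  by rewrite /F (path_of_max py) asboolF ?mul0r.
rewrite (@sum_occupied _ N y n (fun i => G (i - 1)))//; last first.
  by move=> i np; rewrite /G (path_of_min py) subrK [X in _ && X]asboolF ?andbF ?mul0r.
(* A left jump flips the site to the left of the particle, so this sum is shifted by one. Both end
   terms vanish: there is no particle beyond the front, and particle [N] occupies [- N]. *)
have E : \sum_(0 <= j < n) G (1 - N%:Z + j%:Z - 1) + G (1 - N%:Z + n%:Z - 1) =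
    G (1 - N%:Z - 1) + \sum_(0 <= j < n) G (1 - N%:Z + j%:Z).
  rewrite -(big_nat_recr n 0 (fun j => G (1 - N%:Z + j%:Z - 1)))//= big_nat_recl//=.
  rewrite addr0; congr (_ + _); apply: eq_bigr => j _; congr G; lia.
have G1 : G (1 - N%:Z + n%:Z - 1) = 0.
  rewrite /G (path_of_min py) subrK [X in _ && X]asboolF ?andbF ?mul0r//.
  by move=> [p]; have := packed_le py p; lia.
have G2 : G (1 - N%:Z - 1) = 0.
  rewrite /G (path_of_min py) asboolT ?mul0r//.
  by exists N; have [_ ->] := py; lia.
by move: E; rewrite G1 G2 addr0 add0r.
Qed.

End ParticleGenerator.

(** * Words of clock rings *)

Definition step_config : nat -> int := fun p => - p%:Z.

Definition run (w : seq (nat * bool)) : nat -> int :=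
  foldl (fun y c => move c y) step_config w.

Fixpoint words (N k : nat) : seq (seq (nat * bool)) :=
  if k is k'.+1 then [seq rcons w c | w <- words N k', c <- clocks N]
  else [:: [::]].

(** A silent particle [q < N] shields the particles to its right from all those behind it; for such
    words the path is also that of the infinite system ([asep_path_run]). *)
Definition miss (N : nat) (w : seq (nat * bool)) : bool :=
  has (fun q => all (fun c => c.1 != q) w) (iota 0 N).

Lemma mem_clocks N c : (c \in clocks N) = (c.1 < N)%N.
Proof.
case: c => p b; apply/allpairsP/idP => /= [[[p' b'] /= [+ _ [-> _]]]|pN].
  by rewrite mem_iota.
by exists (p, b); rewrite mem_iota; split=> //; case: (b).
Qed.

Lemma clocks_uniq N : uniq (clocks N).
Proof.
by apply: allpairs_uniq => //=; [exact: iota_uniq|move=> [a b] [c d] _ _ /= []-> ->].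
Qed.

Lemma mem_words N k w :
  (w \in words N k) = (size w == k) && all (fun c => (c.1 < N)%N) w.
Proof.
elim: k w => [|k IH] w /=; first by rewrite inE; case: w.
apply/allpairsP/idP => [[[w' c] /= [+ + ->]]|].
  rewrite IH size_rcons eqSS all_rcons mem_clocks => /andP[-> ->].
  by rewrite andbT.
case/lastP: w => [|w c]; first by rewrite andFb.
rewrite size_rcons eqSS all_rcons => /and3P[sw cN aw].
by exists (w, c); rewrite IH sw mem_clocks.
Qed.

Lemma words_uniq N k : uniq (words N k).
Proof.
elim: k => //= k IH; apply: allpairs_uniq => //; first exact: clocks_uniq.
by move=> [a b] [c d] _ _ /= /rcons_inj [] -> ->.
Qed.

Lemma run_rcons w c : run (rcons w c) = move c (run w).
Proof. by rewrite /run foldl_rcons. Qed.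

Lemma step_packed N : packed N step_config.
Proof. by split=> p; rewrite /step_config; lia. Qed.

Lemma run_packed N w : all (fun c => (c.1 < N)%N) w -> packed N (run w).
Proof.
elim/last_ind: w => [_|w [p b] IH]; first exact: step_packed.
by rewrite all_rcons run_rcons => /andP[pN /IH]; move/move_packed; exact.
Qed.

Lemma run_front w : run w 0%N <= (size w)%:Z.
Proof.
elim/last_ind: w => [|w [p b] IH] //; rewrite size_rcons run_rcons /move.
case: asboolP => _ /=; last by lia.
by case: ifP => _; rewrite /dir_step; [case: b|]; lia.
Qed.

(** Particle [q] stays at [- q], and behind it everything is jammed: a ring of [p > q] finds the
    target site occupied by [p - 1] or by [p + 1], neither of which has moved. Letters with labels
    above [q] can therefore be deleted. *)
Lemma run_miss w q : all (fun c => c.1 != q) w ->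
  run w = run [seq c <- w | (c.1 < q)%N] /\ forall p, (q <= p)%N -> run w p = - p%:Z.
Proof.
elim/last_ind: w => [//|w [p b] IH].
rewrite all_rcons filter_rcons => /andP[/= pq /IH[E Q]].
case: ifPn => [pq'|pq'].
  rewrite !run_rcons -E; split=> // p' qp'; rewrite /move; case: asboolP => _ //=.
    by rewrite ifN ?Q//; lia.
  exact: Q.
rewrite run_rcons -E; suff -> : move (p, b) (run w) = run w by [].
rewrite /move asboolF //= => v.
rewrite Q in v; last by lia.
case: b v => v.
  by apply: (v p.-1); rewrite Q /=; [rewrite /dir_step|]; lia.
by apply: (v p.+1); rewrite Q /=; [rewrite /dir_step|]; lia.
Qed.

Section WordSums.
Context {R : realType} (t : R).
Hypotheses (t_gt0 : 0 < t) (t_lt1 : t < 1).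

Definition wt (w : seq (nat * bool)) : R := \prod_(c <- w) rate t c.

Definition wsum N k (phi : seq (nat * bool) -> R) : R :=
  \sum_(w <- words N k) wt w * phi w.

Lemma wt_ge0 w : 0 <= wt w.
Proof.
by apply: prodr_ge0 => -[p []] _; rewrite /rate/= ?ltW.
Qed.

Lemma wsumS N k phi : wsum N k.+1 phi =
  \sum_(w <- words N k) wt w * \sum_(c <- clocks N) rate t c * phi (rcons w c).
Proof.
rewrite /wsum /= big_allpairs_dep /=; apply: eq_bigr => w _.
rewrite mulr_sumr; apply: eq_bigr => c _.
by rewrite /wt -cats1 big_cat big_seq1 /= mulrA.
Qed.

Lemma wsum1 N k : wsum N k (fun=> 1) = (N%:R * (1 + t)) ^+ k.
Proof.
elim: k => [|k IH]; first by rewrite /wsum /= big_seq1 mulr1 /wt big_nil.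
rewrite wsumS exprSr -IH /wsum mulr_suml; apply: eq_bigr => w _.
rewrite mulr1; congr (_ * _); rewrite sum_clocks /rate /= !mulr1.
by rewrite sumr_const_nat subn0 mulr_natl.
Qed.

Let g w := path_of (run w).

Section Recursion.
Variables (N n : nat).
Hypotheses (N_gt0 : (0 < N)%N).
Let A : int := 1 - N%:Z.
Let r : R := N%:R * (1 + t).

(** Appending a letter applies the generator to the second argument of [Phi]; the hypothesis moves
    it to the first one, where it commutes with the sum over words. The front is at most at [k]
    after [k] rings, so [k + N <= n] keeps it inside the window. *)
Lemma wsum_kernel (Phi : (int -> int) -> (int -> int) -> R) (c : (int -> int) -> R)
    k l :
  (forall l g, conf A n l -> up_rightZ g ->
    bw_sum t A n (Phi l) g = fw_sum t A n (Phi ^~ g) l + c l * Phi l g) ->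
  (k + N <= n)%N -> conf A n l ->
  wsum N k.+1 (fun w => Phi l (g w)) =
  fw_gen t A n r (fun l' => wsum N k (fun w => Phi l' (g w))) l +
  c l * wsum N k (fun w => Phi l (g w)).
Proof.
move=> HP kN cl; rewrite wsumS fw_gen_sum [in RHS]/wsum mulr_sumr -big_split.
rewrite big_seq [RHS]big_seq; apply: eq_bigr => w /=.
rewrite mem_words => /andP[/eqP sw aw].
have pw := run_packed aw.
under eq_bigr do rewrite /g run_rcons.
rewrite (@move_generator _ _ _ n) //; last first.
  by have := run_front w; rewrite sw; lia.
rewrite HP//; last exact: path_of_up_right pw.
by rewrite /fw_gen -/A -/r -/(g w) mulrCA -mulrDr addrA.
Qed.

Let ind (l g : int -> int) : R := `[< g = l >]%:R.

Lemma flip_flip (l : int -> int) i a : flip (flip l i a) i (- a) = l.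
Proof. by apply/funext => j; rewrite /flip; case: eqP => _ //; rewrite addrK. Qed.

(** Raising a minimum and lowering a maximum are inverse to each other, so the flips from [h] into
    [l] are the flips of [l] into [h] read backwards; the loss terms matter only for [h = l]. *)
Lemma ind_flip l h i : up_rightZ l -> up_rightZ h ->
  flip_bw t (ind l) h i = flip_fw t (ind ^~ h) l i.
Proof.
move=> ul uh; rewrite /flip_bw /flip_fw /ind.
have maxF g' : is_max (flip g' i 1) i = is_min g' i.
  by rewrite /is_max /is_min flip_at !flip_out; lia.
have minF g' : is_min (flip g' i (-1)) i = is_max g' i.
  by rewrite /is_max /is_min flip_at !flip_out; lia.
have E1 : (is_max h i)%:R * `[< flip h i (-1) = l >]%:R =
          (is_min l i)%:R * `[< h = flip l i 1 >]%:R :> R.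
  rewrite -!natrM !mulnb; congr (nat_of_bool _)%:R; apply/andP/andP => -[m /asboolP e].
    rewrite -e minF m; split=> //; apply/asboolP.
    by rewrite -{2}(opprK 1) flip_flip.
  by rewrite e maxF m; split=> //; apply/asboolP; rewrite flip_flip.
have E2 : (is_min h i)%:R * `[< flip h i 1 = l >]%:R =
          (is_max l i)%:R * `[< h = flip l i (-1) >]%:R :> R.
  rewrite -!natrM !mulnb; congr (nat_of_bool _)%:R; apply/andP/andP => -[m /asboolP e].
    by rewrite -e maxF m; split=> //; apply/asboolP; rewrite flip_flip.
  rewrite e minF m; split=> //; apply/asboolP.
  by rewrite -{2}(opprK 1) flip_flip.
have E3 : (is_max h i)%:R * `[< h = l >]%:R = (is_max l i)%:R * `[< h = l >]%:R :> R.
  by case: asboolP => [->//|_]; rewrite !mulr0.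
have E4 : (is_min h i)%:R * `[< h = l >]%:R = (is_min l i)%:R * `[< h = l >]%:R :> R.
  by case: asboolP => [->//|_]; rewrite !mulr0.
rewrite mulrBr E1 E3 mulrCA mulrBr E2 E4; ring.
Qed.

(** A nonzero product forces [l] to lie above the step path, whereas these tails force [l i <= i]
    and [l i <= 0] inside the window, and the step path is the minimum of the two. So the recursions
    for the weight and for the indicator have the same initial values. *)
Lemma HL_step l : (N <= n)%N -> conf A n l -> HL_prod t A n.+1 l (path_of step_config) =
  ind l (path_of step_config).
Proof.
move=> Nn cl; have [ul lA lB] := cl.
have p0 := step_packed N.
have ug := path_of_up_right p0.
have hlow i : i <= 0 -> path_of step_config i = i.
  by move=> i0; apply: (path_of_low (step_packed 0)).
have hhigh i : 0 <= i -> path_of step_config i = 0.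
  by move=> i0; apply: (path_of_high (step_packed 0)).
rewrite /ind; case: asboolP => [<-|nl].
  rewrite /HL_prod big1// => j _; rewrite /HL_factor /gap !subrr.
  by rewrite mul0r subr0.
have gb : 0 <= gap l (path_of step_config) (A - 1).
  by rewrite /gap lA ?hlow ?subrr// /A; lia.
have [//|[_ _ H]] := HL_prod_bounds t_gt0 t_lt1 n.+1 ul ug gb.
exfalso; apply: nl; apply/funext => i.
have le_i (j : nat) : l (A - 1 + j%:Z) <= A - 1 + j%:Z.
  elim: j => [|j IH]; first by rewrite addr0 lA//; lia.
  have := ul (A - 1 + j.+1%:Z).
  have -> : A - 1 + j.+1%:Z - 1 = A - 1 + j%:Z by lia.
  by case=> ->; lia.
have le_0 (j : nat) : l (A + n%:Z - j%:Z) <= 0.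
  elim: j => [|j IH]; first by rewrite subr0 lB.
  have := ul (A + n%:Z - j%:Z).
  have -> : A + n%:Z - j%:Z - 1 = A + n%:Z - j.+1%:Z by lia.
  by lia.
case: (ltP i A) => iA; first by rewrite lA// hlow// -/A; lia.
case: (leP (A + n%:Z) i) => iB.
  by rewrite lB// hhigh//; move: iB; rewrite /A; lia.
have := H `|(i - (A - 1))%R|%N; have := le_i `|(i - (A - 1))%R|%N.
have -> : A - 1 + `|(i - (A - 1))%R|%N%:Z = i by lia.
have := le_0 `|(A + n%:Z - i)%R|%N.
have -> : A + n%:Z - `|(A + n%:Z - i)%R|%N%:Z = i by lia.
rewrite /gap => h1 h2; rewrite subr_ge0.
have [i0|i0] := leP 0 i; [rewrite hhigh//|rewrite hlow ?(ltW i0)//] => /(_ _) h3.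
  by apply/eqP; rewrite eq_le h1 h3//; lia.
by apply/eqP; rewrite eq_le h2 h3//; lia.
Qed.

Lemma gap_base l w : conf A n l -> all (fun c => (c.1 < N)%N) w ->
  0 <= gap l (g w) (A - 1).
Proof.
move=> [_ lA _] aw; rewrite /gap lA; last by lia.
by rewrite /g (path_of_low (run_packed aw)) ?subrr//; rewrite /A; lia.
Qed.

Lemma HL_word_ge0 l w : conf A n l -> all (fun c => (c.1 < N)%N) w ->
  0 <= HL_prod t A n.+1 l (g w).
Proof.
move=> cl aw; have [ul _ _] := cl.
have [->|[]] // := HL_prod_bounds t_gt0 t_lt1 n.+1 ul
  (path_of_up_right (run_packed aw)) (gap_base cl aw).
by move/ltW.
Qed.

Lemma HL_words_ge0 k l : conf A n l ->
  0 <= wsum N k (fun w => HL_prod t A n.+1 l (g w)).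
Proof.
move=> cl; rewrite /wsum big_seq; apply: sumr_ge0 => w.
rewrite mem_words => /andP[_ aw]; rewrite mulr_ge0 ?wt_ge0//.
exact: HL_word_ge0.
Qed.

Lemma HL_words_rec k l : (k + N <= n)%N -> conf A n l ->
  wsum N k.+1 (fun w => HL_prod t A n.+1 l (g w)) =
  fw_gen t A n r (fun l' => wsum N k (fun w => HL_prod t A n.+1 l' (g w))) l +
  (1 - t) * ((l A - l (A - 1)) - (l (A + n%:Z) - l (A + n%:Z - 1)))%:~R
   * wsum N k (fun w => HL_prod t A n.+1 l (g w)).
Proof.
move=> kn cl; apply: (wsum_kernel (Phi := fun l g => HL_prod t A n.+1 l g)
  (c := fun l => (1 - t) *
   ((l A - l (A - 1)) - (l (A + n%:Z) - l (A + n%:Z - 1)))%:~R)) => //.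
by move=> l' g' [ul' _ _] ug'; apply: HL_prod_sum.
Qed.

Lemma ind_words_rec k l : (k + N <= n)%N -> conf A n l ->
  wsum N k.+1 (fun w => ind l (g w)) =
  fw_gen t A n r (fun l' => wsum N k (fun w => ind l' (g w))) l.
Proof.
move=> kn cl; rewrite (wsum_kernel (Phi := ind) (c := fun=> 0))//.
  by rewrite mul0r addr0.
move=> l' g' [ul' _ _] ug'; rewrite mul0r addr0.
by apply: eq_bigr => j _; rewrite ind_flip.
Qed.

Let t0 : 0 <= 1 - t. Proof. by rewrite subr_ge0 ltW. Qed.

Let rA : - A%:~R * (1 + t) + (1 + t) <= r :> R.
Proof.
have -> : A%:~R = 1 - N%:R :> R by rewrite rmorphB /= -pmulrn.
by rewrite le_eqVlt; apply/orP; left; apply/eqP; rewrite /r; ring.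
Qed.

Lemma wsum_HL_upper K l : (K + N <= n)%N -> conf A n l ->
  forall k, (k <= K)%N -> wsum N k (fun w => HL_prod t A n.+1 l (g w)) <=
    binconv (1 - t) (fun k => wsum N k (fun w => ind l (g w))) k.
Proof.
move=> Kn cl k kK.
pose f k (l : int -> int) := wsum N k (fun w => HL_prod t A n.+1 l (g w)).
pose V k (l : int -> int) := wsum N k (fun w => ind l (g w)).
apply: (@fw_gen_upper _ t t_gt0 t_lt1 A n r (1 - t) t0 rA f V K) => //.
- by move=> l' cl'; rewrite /f /V /wsum /= !big_seq1 HL_step//; lia.
- move=> j l' jK cl'; rewrite /f HL_words_rec//; last by lia.
  (* The first boundary increment exceeds the last one by at most 1. *)
  rewrite lerD2l ler_wpM2r ?HL_words_ge0// ler_piMr//.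
  rewrite -[leRHS]/(1%:~R) ler_int; have [ul' _ _] := cl'.
  by have := ul' A; have := ul' (A + n%:Z); lia.
- by move=> j l' jK cl'; rewrite /V ind_words_rec//; lia.
Qed.

(** The factor [miss] makes the boundary coefficient exact: if some [q < N] is silent, particle
    [N - 1] is still at site [A], so the first increment is 1, and the front has not come far enough
    for the last one to be 1. A silent particle remains silent when the last letter is deleted,
    whence the inequality for [V]. *)
Lemma wsum_HL_lower K l : (K + N <= n)%N -> conf A n l ->
  forall k, (k <= K)%N ->
    binconv (1 - t) (fun k => wsum N k (fun w => (miss N w)%:R * ind l (g w))) k
    <= wsum N k (fun w => HL_prod t A n.+1 l (g w)).
Proof.
move=> Kn cl k kK.
pose f k (l : int -> int) := wsum N k (fun w => HL_prod t A n.+1 l (g w)).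
pose V k (l : int -> int) := wsum N k (fun w => (miss N w)%:R * ind l (g w)).
pose good (l : int -> int) := l A - l (A - 1) = 1 /\ l (A + n%:Z) - l (A + n%:Z - 1) = 0.
apply: (@fw_gen_lower _ t t_gt0 t_lt1 A n r (1 - t) t0 rA f V good K) => //.
- move=> l' cl'; rewrite /f /V /wsum /= !big_seq1 HL_step//; last by lia.
  by rewrite ler_wpM2l ?wt_ge0// ler_piMl ?ler0n// lern1 leq_b1.
- move=> j l' jK cl' [g1 g2]; rewrite /f HL_words_rec//; last by lia.
  by rewrite g1 g2 subr0 mulr1.
- move=> j l' jK cl'; rewrite /V.
  pose U j (l : int -> int) (w : seq (nat * bool)) := ind l (g w).
  rewrite {2}/wsum fw_gen_sum wsumS big_seq [leRHS]big_seq; apply: ler_sum => w.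
  rewrite mem_words => /andP[/eqP sw aw]; rewrite ler_wpM2l ?wt_ge0//.
  have pw := run_packed aw.
  apply: (@le_trans _ _ ((miss N w)%:R * \sum_(c <- clocks N) rate t c * ind l' (g (rcons w c)))).
    rewrite mulr_sumr; apply: ler_sum => -[p b] _.
    rewrite mulrCA; apply: ler_wpM2r.
      by rewrite mulr_ge0 ?ler0n//; case: (b); rewrite /rate /= ?ltW.
    rewrite ler_nat; case: (boolP (miss N (rcons _ _))) => // /hasP[q qN].
    rewrite all_rcons => /andP[_ aq]; rewrite lt0b.
    by apply/hasP; exists q.
  under eq_bigr do rewrite /g run_rcons.
  rewrite (@move_generator _ _ _ n)//; last by have := run_front w; rewrite sw; lia.
  rewrite -/r -/A -/(g w) /fw_gen /fw_sum /bw_sum.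
  rewrite (eq_bigr (fun j => flip_fw t (ind ^~ (g w)) l' (A + j%:Z))); last first.
    by move=> i _; rewrite ind_flip//; [case: cl'|exact: path_of_up_right pw].
  rewrite mulrDr mulrCA lerD2l mulr_sumr le_eqVlt; apply/orP; left; apply/eqP.
  by apply: eq_bigr => i _; rewrite /flip_fw; ring.
- by move=> j l' jK cl'; exact: HL_words_ge0.
- move=> j l' jK cl' ng; rewrite /V /wsum big_seq big1// => w.
  rewrite mem_words => /andP[/eqP sw aw]; have pw := run_packed aw.
  rewrite /ind; case: asboolP => [e|_]; last by rewrite !mulr0.
  case: (boolP (miss N w)) => [/hasP[q]|]; last by rewrite mul0r mulr0.
  rewrite mem_iota add0n => /= qN /run_miss[_ Q]; exfalso; apply: ng.
  rewrite /good -e /g (path_of_occ pw A) (path_of_occ pw (A + n%:Z)).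
  rewrite asboolT; last by exists N.-1; rewrite Q; [rewrite /A|]; lia.
  rewrite asboolF /=; first by lia.
  move=> [p]; have := run_front w; have := packed_le pw p.
  by rewrite sw /A; lia.
Qed.

End Recursion.

End WordSums.

(** * From the number of rings to the time [T]: Poisson sums *)

Section PoissonSums.
Context {R : realType}.
Implicit Types (x T s : R).

Definition expsum x (K : nat) : R := \sum_(0 <= k < K) x ^+ k / k`!%:R.

Lemma expsum_cvg x : expsum x @ \oo --> expR x.
Proof. exact: is_cvg_series_exp_coeff. Qed.

Lemma expsum_le x K : 0 <= x -> expsum x K <= expR x.
Proof.
move=> x0; apply: (@nondecreasing_cvgn_le _ (series (exp_coeff x))).
  apply: nondecreasing_series => k _ _.
  by rewrite /exp_coeff/= divr_ge0// exprn_ge0.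
exact: is_cvg_series_exp_coeff.
Qed.

Lemma expsum_ge0 x K : 0 <= x -> 0 <= expsum x K.
Proof. by move=> x0; apply: sumr_ge0 => k _; rewrite divr_ge0// exprn_ge0. Qed.

Lemma expsum_homo x K K' : 0 <= x -> (K <= K')%N -> expsum x K <= expsum x K'.
Proof.
move=> x0 KK'; rewrite /expsum (big_cat_nat (n := K) (p := K'))//= lerDl.
by apply: sumr_ge0 => k _; rewrite divr_ge0// exprn_ge0.
Qed.

(** A truncated Cauchy product: divided by [k!], [binconv] is the convolution of [v j / j!] and
    [s ^ i / i!], so its exponential generating function factors. Cutting at [K] leaves [K - j]
    terms of the second factor. *)
Lemma binconv_expsum s T (v : nat -> R) K :
  \sum_(0 <= k < K) T ^+ k / k`!%:R * binconv s v k =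
  \sum_(0 <= j < K) T ^+ j / j`!%:R * v j * expsum (s * T) (K - j).
Proof.
elim: K => [|K IH]; first by rewrite !big_geq.
rewrite !big_nat_recr//= IH subSnn /expsum big_nat1 expr0 fact0 divr1 mulr1.
rewrite [in RHS](eq_big_nat _ _ (F2 := fun j => T ^+ j / j`!%:R * v j *
   \sum_(0 <= k < K - j) (s * T) ^+ k / k`!%:R +
   T ^+ K / K`!%:R * ('C(K, j)%:R * s ^+ (K - j) * v j))).
  rewrite big_split /= -!addrA; congr (_ + _).
  rewrite /binconv big_ord_recr /= binn subnn expr0 !mul1r mulrDr; congr (_ + _).
  by rewrite mulr_sumr big_mkord.
move=> j /= jK; rewrite subSn ?(ltnW jK)// big_nat_recr//= mulrDr; congr (_ + _).
have F0 m : m`!%:R != 0 :> R by rewrite pnatr_eq0 -lt0n fact_gt0.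
have -> : T ^+ K = T ^+ j * T ^+ (K - j) by rewrite -exprD subnKC// ltnW.
rewrite -(bin_fact (ltnW jK)) !natrM exprMn.
have B0 : 'C(K, j)%:R != 0 :> R by rewrite pnatr_eq0 -lt0n bin_gt0 ltnW.
field.
by rewrite !F0 B0.
Qed.

Lemma binconv_expsum_upper s T v K : 0 <= s -> 0 <= T -> (forall j, 0 <= v j) ->
  \sum_(0 <= k < K) T ^+ k / k`!%:R * binconv s v k <=
  expR (s * T) * \sum_(0 <= j < K) T ^+ j / j`!%:R * v j.
Proof.
move=> s0 T0 v0; rewrite binconv_expsum mulr_sumr; apply: ler_sum => j _.
rewrite mulrC ler_wpM2r ?expsum_le ?mulr_ge0 ?divr_ge0 ?exprn_ge0//.
Qed.

(** The range is doubled so that for every [j < K] the second factor still has at least [K]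
    terms. *)
Lemma binconv_expsum_lower s T v K : 0 <= s -> 0 <= T -> (forall j, 0 <= v j) ->
  expsum (s * T) K * \sum_(0 <= j < K) T ^+ j / j`!%:R * v j <=
  \sum_(0 <= k < K + K) T ^+ k / k`!%:R * binconv s v k.
Proof.
move=> s0 T0 v0; rewrite binconv_expsum (big_cat_nat (n := K) (p := (K + K)%N))//=; last by lia.
rewrite mulr_sumr -[leLHS]addr0 lerD//; last first.
  by apply: sumr_ge0 => j _; rewrite !mulr_ge0 ?expsum_ge0 ?mulr_ge0 ?invr_ge0 ?exprn_ge0.
rewrite [leLHS]big_nat [leRHS]big_nat; apply: ler_sum => j /= jK.
rewrite mulrC ler_wpM2l ?mulr_ge0 ?divr_ge0 ?exprn_ge0// expsum_homo ?mulr_ge0//.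
by lia.
Qed.

Context (t T : R).
Hypotheses (t_gt0 : 0 < t) (t_lt1 : t < 1) (T_gt0 : 0 < T).

(** The rings of the particles [p < N] up to time [T] form a Poisson number, of mean
    [N%:R * (1 + t) * T], of letters drawn with weights [rate]. This is the resulting mean of [phi],
    restricted to fewer than [K] rings. *)
Definition rho_sum (N K : nat) (phi : seq (nat * bool) -> R) : R :=
  expR (- (N%:R * (1 + t) * T)) *
  \sum_(0 <= k < K) T ^+ k / k`!%:R * wsum t N k phi.

Lemma rho_sumD N K phi psi :
  rho_sum N K (fun w => phi w + psi w) = rho_sum N K phi + rho_sum N K psi.
Proof.
rewrite /rho_sum -mulrDr -big_split; congr (_ * _); apply: eq_bigr => k _ /=.
rewrite -mulrDr /wsum -big_split; congr (_ * _); apply: eq_bigr => w _ /=.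
by rewrite mulrDr.
Qed.

Lemma rho_sum1 N K :
  rho_sum N K (fun=> 1) = expR (- (N%:R * (1 + t) * T)) * expsum (N%:R * (1 + t) * T) K.
Proof.
congr (_ * _); apply: eq_bigr => k _.
by rewrite wsum1 [in RHS]exprMn mulrC mulrA.
Qed.

Lemma rho_sum1_cvg N : rho_sum N K (fun=> 1) @[K --> \oo] --> (1 : R).
Proof.
under eq_fun do rewrite rho_sum1.
set a := N%:R * (1 + t) * T.
have -> : (1 : R) = expR (- a) * expR a by rewrite mulrC expRxMexpNx_1.
by apply: cvgMr; exact: expsum_cvg.
Qed.

Section HLBounds.
Variables (N K n : nat) (l : int -> int).
Hypotheses (N_gt0 : (0 < N)%N) (Kn : (K + K + N <= n)%N).
Hypothesis cl : conf (1 - N%:Z) n l.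

Lemma rho_sum_HL_upper :
  rho_sum N K (fun w => HL_prod t (1 - N%:Z) n.+1 l (path_of (run w))) <=
  expR ((1 - t) * T) * rho_sum N K (fun w => `[< path_of (run w) = l >]%:R).
Proof.
rewrite /rho_sum mulrCA ler_wpM2l ?expR_ge0//.
apply: le_trans; last apply: binconv_expsum_upper.
- rewrite big_nat [leRHS]big_nat; apply: ler_sum => k /= kK.
  rewrite ler_wpM2l ?divr_ge0 ?exprn_ge0 ?(ltW T_gt0)//.
  by apply: (wsum_HL_upper t_gt0 t_lt1 N_gt0 (K := K)) => //; lia.
- by rewrite subr_ge0 ltW.
- exact: ltW.
- by move=> j; apply: sumr_ge0 => w _; rewrite mulr_ge0// wt_ge0.
Qed.

Lemma rho_sum_HL_lower :
  expsum ((1 - t) * T) K *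
    rho_sum N K (fun w => (miss N w)%:R * `[< path_of (run w) = l >]%:R) <=
  rho_sum N (K + K) (fun w => HL_prod t (1 - N%:Z) n.+1 l (path_of (run w))).
Proof.
rewrite /rho_sum mulrCA ler_wpM2l ?expR_ge0//.
apply: le_trans; first apply: binconv_expsum_lower.
- by rewrite subr_ge0 ltW.
- exact: ltW.
- by move=> j; apply: sumr_ge0 => w _; rewrite !mulr_ge0// wt_ge0.
rewrite big_nat [leRHS]big_nat; apply: ler_sum => k /= kK.
rewrite ler_wpM2l ?divr_ge0 ?exprn_ge0 ?(ltW T_gt0)//.
by apply: (wsum_HL_lower t_gt0 t_lt1 N_gt0 (K := K + K)) => //; lia.
Qed.

End HLBounds.

End PoissonSums.

(** * Probability of a given order of rings *)

Section RealProbability.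
Context d (Om : measurableType d) (R : realType) (P : probability Om R).
Implicit Types A B : set Om.

Definition Pr A : R := fine (P A).

Lemma PrE A : measurable A -> P A = (Pr A)%:E.
Proof. by move=> mA; rewrite /Pr fineK// fin_num_measure. Qed.

Lemma Pr_ge0 A : 0 <= Pr A.
Proof. by rewrite /Pr fine_ge0. Qed.

Lemma Pr_setT : Pr setT = 1.
Proof. by rewrite /Pr probability_setT. Qed.

Lemma Pr_le A B : measurable A -> measurable B -> A `<=` B -> Pr A <= Pr B.
Proof.
by move=> mA mB AB; rewrite -lee_fin -!PrE// le_measure// inE.
Qed.

Lemma Pr_le1 A : measurable A -> Pr A <= 1.
Proof. by move=> mA; rewrite -Pr_setT Pr_le. Qed.

Lemma Pr_DI A B : measurable A -> measurable B ->
  Pr A = Pr (A `\` B) + Pr (A `&` B).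
Proof.
move=> mA mB; apply: EFin_inj; rewrite EFinD -!PrE; first exact: measureDI.
all: by [exact: measurableI|exact: measurableD|].
Qed.

Lemma Pr_setC A : measurable A -> Pr (~` A) = 1 - Pr A.
Proof.
move=> mA; have := Pr_DI measurableT mA.
by rewrite Pr_setT setTI setTD => ->; rewrite addrK.
Qed.

Lemma Pr_setU0 A B : measurable A -> measurable B -> Pr B = 0 ->
  Pr (A `|` B) = Pr A.
Proof.
move=> mA mB B0; have PB : P B = 0%E by rewrite PrE// B0.
by rewrite /Pr measureU0.
Qed.

Lemma Pr_disjoint (I : eqType) (s : seq I) (B : I -> set Om) A :
  measurable A -> uniq s -> (forall i, i \in s -> measurable (B i)) ->
  (forall i, i \in s -> B i `<=` A) ->
  (forall i j, i \in s -> j \in s -> i != j -> B i `&` B j = set0) ->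
  \sum_(i <- s) Pr (B i) <= Pr A.
Proof.
elim: s A => [|i s IH] A mA; first by rewrite big_nil Pr_ge0.
move=> /= /andP[is_ us] mB BA dB; rewrite big_cons.
have mi : measurable (B i) by apply: mB; rewrite mem_head.
rewrite (Pr_DI mA mi) addrC lerD//.
  apply: IH => //; first exact: measurableD.
  - by move=> j js; apply: mB; rewrite inE js orbT.
  - move=> j js w Bw; split; first by apply: (BA j) => //; rewrite inE js orbT.
    move=> Biw; have : (B i `&` B j) w by [].
    rewrite dB ?mem_head ?inE ?js ?orbT//.
    by apply: contraNneq is_ => ->.
  - by move=> j k js ks; apply: dB; rewrite inE ?js ?ks orbT.
apply: Pr_le => //; first exact: measurableI.
by move=> w Bw; split=> //; apply: (BA i) => //; rewrite mem_head.
Qed.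

End RealProbability.

Section Clocks.
Context {R : realType} d (Om : measurableType d) (P : probability Om R).
Variables (t : R) (xi : nat * bool * nat -> {RV P >-> R}).
Hypotheses (t_gt0 : 0 < t) (t_lt1 : t < 1).
Hypothesis xi_indep : mutually_independent xi.
Hypothesis xi_law : forall (p : nat) (dir : bool) (k : nat) (A : set R),
  measurable A ->
  P (xi (p, dir, k) @^-1` A) = exponential_prob (if dir then 1 else t) A.

Lemma rate_gt0 c : 0 < rate t c.
Proof. by rewrite /rate; case: c.2. Qed.

Lemma measurable_xi i (A : set R) : measurable A -> measurable (xi i @^-1` A).
Proof. by move=> mA; rewrite -[X in measurable X]setTI; exact: measurable_funPT. Qed.

Lemma Pr_xi_gt c k a : 0 <= a ->
  Pr P (xi (c, k) @^-1` `]a, +oo[) = expR (- (rate t c * a)).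
Proof.
case: c => p dir; set r := rate t (p, dir) => a0.
have law A : measurable A -> P (xi (p, dir, k) @^-1` A) = exponential_prob r A.
  exact: xi_law.
have neg : Pr P (xi (p, dir, k) @^-1` `]-oo, 0[) = 0.
  rewrite /Pr law// /exponential_prob integral0_eq// => x /=.
  rewrite in_itv /= => x0; rewrite /exponential_pdf patchE ifF//.
  by apply/negbTE; rewrite notin_setE /= in_itv /= andbT; apply/negP; rewrite -ltNge.
have pos b : 0 < b -> Pr P (xi (p, dir, k) @^-1` `]b, +oo[) = expR (- (r * b)).
  move=> b0.
  have -> : xi (p, dir, k) @^-1` `]b, +oo[ =
     ~` ((xi (p, dir, k) @^-1` `[0, b]) `|` (xi (p, dir, k) @^-1` `]-oo, 0[)).
    apply/seteqP; split => w /=; rewrite !in_itv /= ?andbT.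
      by move=> bw [/andP[_]|]; rewrite ?leNgt ?bw//; move: bw b0; lra.
    move=> /not_orP[]; case: (ltP (xi (p, dir, k) w) 0) => //= _.
    by rewrite ltNge => /negP.
  rewrite Pr_setC; last first.
    by apply: measurableU; apply: measurable_xi.
  rewrite Pr_setU0 ?neg//; [|exact: measurable_xi..].
  by rewrite /Pr law// exponential_prob_itv0c//= mulNr; lra.
have [a1|a1] := ltP 0 a; first exact: pos.
have {a0 a1} -> : a = 0 by apply/eqP; rewrite eq_le a1 a0.
rewrite mulr0 oppr0 expR0; apply/eqP; rewrite eq_le Pr_le1; last exact: measurable_xi.
rewrite leNgt; apply/negP => lt1.
(* The threshold 0 is reached from positive ones: if [q < 1], then [b = (1 - q) / (2 * r)] is
   exceeded with probability at least [1 - r * b = (1 + q) / 2 > q], although exceeding [b] implies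
   exceeding 0. *)
pose q := Pr P (xi (p, dir, k) @^-1` `]0, +oo[).
have r0 : 0 < r by exact: rate_gt0.
have b0 : 0 < (1 - q) / (2 * r) by rewrite divr_gt0 ?subr_gt0// mulr_gt0.
have : expR (- (r * ((1 - q) / (2 * r)))) <= q.
  rewrite -pos//; apply: Pr_le; [exact: measurable_xi..|].
  by move=> w /=; rewrite !in_itv /= !andbT; apply: lt_trans.
rewrite leNgt => /negP; apply; apply: lt_le_trans (expR_ge1Dx _).
have -> : r * ((1 - q) / (2 * r)) = (1 - q) / 2 by field; rewrite gt_eqF.
by move: lt1; rewrite -/q; lra.
Qed.

Lemma Pr_xi_itv c k a b : 0 <= a -> a <= b ->
  Pr P (xi (c, k) @^-1` `]a, b]) = expR (- (rate t c * a)) - expR (- (rate t c * b)).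
Proof.
move=> a0 ab; rewrite -(Pr_xi_gt c k a0) -(Pr_xi_gt c k (le_trans a0 ab)).
rewrite (@Pr_DI _ _ _ P (xi (c, k) @^-1` `]a, +oo[) (xi (c, k) @^-1` `]b, +oo[));
  [|exact: measurable_xi..].
rewrite [X in _ + Pr P X](_ : _ = xi (c, k) @^-1` `]b, +oo[); last first.
  apply/seteqP; split => w /=; rewrite !in_itv/= ?andbT; first by case.
  by move=> bw; split=> //; exact: le_lt_trans bw.
rewrite addrK; congr Pr; apply/seteqP; split => w /=; rewrite !in_itv/= ?andbT.
  by move=> /andP[aw wb]; split=> //; apply/negP; rewrite -leNgt.
by move=> [aw /negP]; rewrite -leNgt aw.
Qed.

Fixpoint constr_event (cs : seq (nat * bool * nat * set R)) : set Om :=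
  if cs is (i, A) :: cs' then (xi i @^-1` A) `&` constr_event cs' else setT.

Lemma measurable_constr_event cs : (forall iA, List.In iA cs -> measurable iA.2) ->
  measurable (constr_event cs).
Proof.
elim: cs => [_|[i A] cs IH H] //=.
apply: measurableI; first by apply: measurable_xi; apply: (H (i, A)); left.
by apply: IH => iA ?; apply: H; right.
Qed.

Lemma Pr_constr_event cs : uniq [seq iA.1 | iA <- cs] ->
  (forall iA, List.In iA cs -> measurable iA.2) ->
  Pr P (constr_event cs) = \prod_(iA <- cs) Pr P (xi iA.1 @^-1` iA.2).
Proof.
(* Independence is stated for a family of sets indexed by all waiting times, so the list is extended
   to such a family by [setT]. *)
pose look := fix look (cs : seq (nat * bool * nat * set R)) j : set R :=
  if cs is (i, A) :: cs' then if j == i then A else look cs' j else setT.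
move=> u m; set J := [seq iA.1 | iA <- cs].
have mlook j : measurable (look cs j).
  elim: cs m {u J} => [|[i A] cs IH] m //=.
  case: eqP => _; first by apply: (m (i, A)); left.
  by apply: IH => iA ?; apply: m; right.
have prodE : \prod_(iA <- cs) Pr P (xi iA.1 @^-1` iA.2) =
    \prod_(j <- J) Pr P (xi j @^-1` look cs j).
  rewrite /J; elim: cs u {m J mlook} => [|[i A] cs IH] /=; first by rewrite !big_nil.
  move=> /andP[ni u]; rewrite !big_cons /= eqxx IH//; congr (_ * _).
  apply: eq_big_seq => j ji /=; case: eqP => // e.
  by move: ni; rewrite -e ji.
rewrite prodE; apply: EFin_inj; rewrite -PrE; last exact: measurable_constr_event.
have -> : constr_event cs = \bigcap_(j in [set` J]) (xi j @^-1` look cs j).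
  apply/seteqP; split => w.
    rewrite /J; elim: cs u {m J mlook prodE} => [|[i A] cs IH] //=.
    move=> /andP[ni u] [Aw cw] j /=; rewrite inE => /orP[/eqP->|jc]; rewrite ?eqxx//.
    case: eqP => [e|_]; first by move: ni; rewrite -e jc.
    exact: (IH u cw j jc).
  rewrite /J; elim: cs u {m J mlook prodE} => [|[i A] cs IH] //=.
  move=> /andP[ni u] H; split.
    by have := H i; rewrite /= mem_head eqxx => /(_ isT).
  apply: IH => // j /= jc; have := H j; rewrite /= inE jc orbT => /(_ isT).
  by case: eqP => // e; move: ni; rewrite -e jc.
rewrite xi_indep//.
elim: J {u prodE} => [|j J IH]; first by rewrite !big_nil.
by rewrite !big_cons EFinM IH -PrE//; exact: measurable_xi.
Qed.

End Clocks.

(** * Grid events and their exact probability *)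

Definition upd (f : nat * bool -> nat) (c : nat * bool) (v : nat) :=
  fun c' => if c' == c then v else f c'.

(* A list of pairs [(d, c)] stands for successive rings: the waiting time of
   clock [c] since its previous entry [(d', c)] is to lie in the [(d - d')]-th
   cell of the grid of mesh [T / n].  Constraining waiting times rather than
   ring times makes the probability an explicit product.  A ring then occurs at
   most [gp] cells after [d], where [gp] bounds the number of rings, and the
   gaps imposed here keep the rings in the prescribed order. *)
Fixpoint grid_ok (gp n lo : nat) (ps : seq (nat * (nat * bool))) : bool :=
  if ps is (d, _) :: ps' then
    [&& (lo <= d)%N, (d + gp <= n)%N & grid_ok gp n (d + gp).+1 ps']
  else true.

Section GridConstraints.
Context {R : realType}.
Variables (T delta : R) (N : nat).

(** [cnt c] is the number of earlier rings of [c] and [prev c] the grid position of the last one.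
    The closing constraints exclude further rings up to [T], since the true last ring is never
    earlier than its grid position. *)
Fixpoint grid_constr (cnt prev : nat * bool -> nat)
    (ps : seq (nat * (nat * bool))) : seq (nat * bool * nat * set R) :=
  if ps is (d, c) :: ps' then
    ((c, cnt c), [set` `](d%:R - (prev c)%:R) * delta,
                         (d%:R - (prev c)%:R + 1) * delta]]) ::
    grid_constr (upd cnt c (cnt c).+1) (upd prev c d) ps'
  else [seq ((c, cnt c), [set` `]T - (prev c)%:R * delta, +oo[]) | c <- clocks N].

Lemma grid_constr_measurable cnt prev ps iA :
  List.In iA (grid_constr cnt prev ps) -> measurable iA.2.
Proof.
elim: ps cnt prev => [|[d c] ps IH] cnt prev /=.
  elim: (clocks N) => [//|c s IHs] /= [<-|]//; exact: measurable_itv.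
by case=> [<-|/IH//]; exact: measurable_itv.
Qed.

Lemma grid_constr_key cnt prev ps c k :
  (c, k) \in [seq iA.1 | iA <- grid_constr cnt prev ps] -> (cnt c <= k)%N.
Proof.
elim: ps cnt prev => [|[d c'] ps IH] cnt prev /=.
  by rewrite -map_comp => /mapP[c' _ /= [-> ->]].
rewrite inE => /orP[/eqP[-> ->]//|/IH]; rewrite /upd.
by case: eqP => [->|_]; [exact: ltnW|].
Qed.

Lemma grid_constr_uniq cnt prev ps :
  uniq [seq iA.1 | iA <- grid_constr cnt prev ps].
Proof.
elim: ps cnt prev => [|[d c] ps IH] cnt prev /=.
  by rewrite -map_comp map_inj_uniq ?clocks_uniq// => c c' /= [].
rewrite IH andbT; apply/negP => /grid_constr_key.
by rewrite /upd eqxx ltnn.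
Qed.

Lemma prod_upd (F : nat * bool -> nat -> R) prev c d :
  c \in clocks N ->
  F c (prev c) * \prod_(c' <- clocks N) F c' (upd prev c d c') =
  F c d * \prod_(c' <- clocks N) F c' (prev c').
Proof.
move=> cN; rewrite (bigD1_seq c) ?clocks_uniq//= [in RHS](bigD1_seq c) ?clocks_uniq//=.
have -> : upd prev c d c = d by rewrite /upd eqxx.
rewrite mulrCA; congr (_ * (_ * _)).
by apply: eq_bigr => c' /negbTE cc'; rewrite /upd cc'.
Qed.

End GridConstraints.

Section GridProbability.
Context {R : realType} d (Om : measurableType d) (P : probability Om R).
Variables (t T : R) (xi : nat * bool * nat -> {RV P >-> R}).
Hypotheses (t_gt0 : 0 < t) (t_lt1 : t < 1) (T_gt0 : 0 < T).
Hypothesis xi_indep : mutually_independent xi.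
Hypothesis xi_law : forall (p : nat) (dir : bool) (k : nat) (A : set R),
  measurable A ->
  P (xi (p, dir, k) @^-1` A) = exponential_prob (if dir then 1 else t) A.
Variables (N n : nat).
Hypothesis n_gt0 : (0 < n)%N.
Let delta := T / n%:R.

Definition grid_event cnt prev ps : set Om :=
  constr_event xi (grid_constr T delta N cnt prev ps).

Lemma measurable_grid_event cnt prev ps : measurable (grid_event cnt prev ps).
Proof. by apply: measurable_constr_event; exact: grid_constr_measurable. Qed.

Let delta_gt0 : 0 < delta.
Proof. by rewrite divr_gt0// ltr0n. Qed.

Let delta_le (k : nat) : (k <= n)%N -> k%:R * delta <= T.
Proof.
move=> kn; rewrite /delta mulrCA ler_piMr ?(ltW T_gt0)//.
by rewrite ler_pdivrMr ?ltr0n// mul1r ler_nat.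
Qed.

(** The exponentials telescope along each clock, and every ring leaves one factor
    [1 - expR (- (rate t c * delta))]. So the probability depends on the letters and not on the grid
    positions, and it remains to count positions. *)
Lemma Pr_grid_event gp lo cnt prev ps :
  grid_ok gp n lo ps -> (forall c, (prev c <= lo)%N) -> (forall c, (prev c <= n)%N) ->
  all (fun dc => dc.2.1 < N)%N ps ->
  Pr P (grid_event cnt prev ps) =
  \prod_(c <- clocks N) expR (- (rate t c * (T - (prev c)%:R * delta))) *
  \prod_(dc <- ps) (1 - expR (- (rate t dc.2 * delta))).
Proof.
move=> + + + psN; rewrite /grid_event Pr_constr_event//; last 2 first.
- exact: grid_constr_uniq.
- exact: grid_constr_measurable.
elim: ps lo cnt prev psN => [|[d' c] ps IH] lo cnt prev /=.
  move=> _ _ pl pn; rewrite big_map big_nil mulr1; apply: eq_bigr => c _ /=.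
  by rewrite (Pr_xi_gt t_gt0 xi_law)// subr_ge0 delta_le.
move=> /andP[cN psN] /and3P[lod dn ok] pl pn; rewrite !big_cons /=.
rewrite (IH (d' + gp).+1)//; last 2 first.
- move=> c'; rewrite /upd; case: eqP => _; first by lia.
  by have := pl c'; lia.
- move=> c'; rewrite /upd; case: eqP => _; first by lia.
  exact: pn.
have pd : 0 <= d'%:R - (prev c)%:R :> R.
  by rewrite subr_ge0 ler_nat; have := pl c; lia.
rewrite (Pr_xi_itv t_gt0 xi_law); last 2 first.
- by rewrite mulr_ge0// ltW.
- by rewrite ler_wpM2r ?lerDl// ltW.
have := @prod_upd R N (fun c k => expR (- (rate t c * (T - k%:R * delta)))) prev c d'.
rewrite mem_clocks => /(_ cN) /=.
set X := \prod_(_ <- _) expR (- (_ * (T - (upd _ _ _ _)%:R * _))).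
set Y := \prod_(_ <- clocks N) _; set Z := \prod_(_ <- ps) _ => E.
have -> : expR (- (rate t c * ((d'%:R - (prev c)%:R) * delta))) =
   expR (- (rate t c * (T - (prev c)%:R * delta))) /
   expR (- (rate t c * (T - d'%:R * delta))).
  by rewrite -expRB; congr expR; ring.
have -> : expR (- (rate t c * ((d'%:R - (prev c)%:R + 1) * delta))) =
   expR (- (rate t c * (T - (prev c)%:R * delta))) /
   expR (- (rate t c * (T - d'%:R * delta))) * expR (- (rate t c * delta)).
  by rewrite -expRB -expRD; congr expR; ring.
have e0 := expR_gt0 (- (rate t c * (T - d'%:R * delta))).
set b := expR (- (rate t c * (T - d'%:R * delta))) in E e0 *.
set a := expR (- (rate t c * (T - (prev c)%:R * delta))) in E *.
have -> : Y = a * X / b by rewrite E mulrAC mulfV ?gt_eqF// mul1r.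
by field; rewrite gt_eqF.
Qed.

End GridProbability.

(** * Chronological lists of rings *)

Fixpoint ring_list {R : realType} (x : nat * bool * nat -> R)
    (cnt : nat * bool -> nat) (w : seq (nat * bool)) : seq (R * (nat * bool)) :=
  if w is c :: w' then
    (\sum_(j < (cnt c).+1) x (c, j : nat), c) ::
    ring_list x (upd cnt c (cnt c).+1) w'
  else [::].

Definition before {R : realType} : rel (R * (nat * bool)) := fun a b => a.1 < b.1.

(** The existence of such an [H] encodes both that the rings are finitely many and that their times
    are distinct, the order [before] being strict. *)
Definition history {R : realType} (T : R) (x : nat * bool * nat -> R) (N : nat)
    (H : seq (R * (nat * bool))) : Prop :=
  sorted before H /\
  forall s c, (s, c) \in H <->
    [/\ (c.1 < N)%N, 0 < s, s <= T & rings_at x c.1 c.2 s].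

Section Histories.
Context {R : realType}.
Implicit Types (T : R) (x : nat * bool * nat -> R).

Lemma ring_list_letters x cnt w : [seq sc.2 | sc <- ring_list x cnt w] = w.
Proof. by elim: w cnt => //= c w IH cnt; rewrite IH. Qed.

Lemma ring_list_mem x cnt w s c : (s, c) \in ring_list x cnt w <->
  exists j, [/\ (cnt c <= j)%N, (j < cnt c + count_mem c w)%N &
    s = \sum_(i < j.+1) x (c, i : nat)].
Proof.
elim: w cnt => [|c' w IH] cnt /=.
  by split=> // -[j []]; rewrite addn0; lia.
rewrite inE; split=> [/orP[/eqP[-> ->]|/IH[j]]|[j]].
- by exists (cnt c'); rewrite eqxx; split => //; lia.
- rewrite /upd; case: eqP => [->|cc'] [h1 h2 h3]; exists j; split => //.
  + exact: ltnW.
  + by rewrite eqxx addnA addn1.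
  + by case: eqP => [e|_]; [by move: cc'; rewrite e|rewrite add0n].
rewrite eq_sym; case: (eqVneq c' c) => [->|cc'] [h1 h2 h3]; last first.
  apply/orP; right; apply/IH; exists j; rewrite /upd.
  by rewrite eq_sym (negbTE cc'); split=> //; lia.
case: (eqVneq j (cnt c)) => [e|je]; first by rewrite h3 e eqxx.
apply/orP; right; apply/IH; exists j; rewrite /upd eqxx; split => //.
  by rewrite ltn_neqAle eq_sym je.
by move: h2; rewrite addnA addn1.
Qed.

Lemma history_uniq T x N H H' : history T x N H -> history T x N H' -> H = H'.
Proof.
move=> [s1 m1] [s2 m2]; apply: (@irr_sorted_eq _ before) => //.
- by move=> a b c; exact: lt_trans.
- by move=> a; rewrite /before ltxx.
- by move=> [s c]; apply/idP/idP => [/m1/m2|/m2/m1].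
Qed.

Lemma history_filter T x N M H : (M <= N)%N -> history T x N H ->
  history T x M [seq sc <- H | (sc.2.1 < M)%N].
Proof.
move=> MN [sH mH]; split.
  by apply: sorted_filter sH => a b c; exact: lt_trans.
move=> s c; rewrite mem_filter /=; split=> [/andP[cM /mH[]]|[cM h1 h2 h3]] //.
by rewrite cM /=; apply/mH; split=> //; exact: leq_trans MN.
Qed.

End Histories.

(** Taking or skipping a position costs one of the [m] units of room in either case, although taking
    it advances the position by [gp + 1]. Spaced lists are thus counted like plain subsets. *)
Fixpoint grids (gp k lo m : nat) {struct m} : seq (seq nat) :=
  match m, k with
  | _, 0%N => [:: [::]]
  | 0%N, _.+1 => [::]
  | m'.+1, k'.+1 =>
      [seq lo :: s | s <- grids gp k' (lo + gp).+1 m'] ++ grids gp k lo.+1 m'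
  end.

Lemma size_grids gp k lo m : size (grids gp k lo m) = 'C(m, k).
Proof.
elim: m k lo => [|m IH] [|k] lo //=.
by rewrite size_cat size_map !IH binS addnC.
Qed.

Lemma mem_grids_lo gp k lo m s : s \in grids gp k lo m ->
  if s is d :: _ then (lo <= d)%N else true.
Proof.
elim: m s k lo => [|m IH] s [|k] lo //=; rewrite ?inE; [by move/eqP->..|].
rewrite mem_cat => /orP[/mapP[s' _ ->]//|/IH].
by case: s => // d _; exact: ltnW.
Qed.

Lemma grids_uniq gp k lo m : uniq (grids gp k lo m).
Proof.
elim: m k lo => [|m IH] [|k] lo //=.
rewrite cat_uniq map_inj_uniq ?IH//= ?andbT; last by move=> ? ? [].
apply/hasPn => s /mem_grids_lo h; apply/negP => /mapP[s' _ e].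
by move: h; rewrite e ltnn.
Qed.

Lemma mem_grids gp k lo m n s (w : seq (nat * bool)) :
  (lo + m + k * gp <= n)%N -> s \in grids gp k lo m -> size w = k ->
  size s = k /\ grid_ok gp n lo (zip s w).
Proof.
elim: m k lo s w => [|m IH] [|k] lo s w h //=; rewrite ?inE.
- by move/eqP => -> /size0nil ->.
- by move/eqP => {IH h} -> /size0nil ->.
rewrite mem_cat => /orP[/mapP[s' s's ->]|sg] sw; last first.
  have [] := IH k.+1 lo.+1 s w _ sg sw; first by rewrite -[X in (X <= _)%N]/(_ + _)%N; lia.
  move=> ss ok; split => //; move: ss ok; case: s sg => // d s _ _.
  by case: w {sw} => // c w /= /and3P[h1 -> ->]; rewrite !andbT ltnW.
case: w sw => // c w /= [sw].
have [] := IH k (lo + gp).+1 s' w _ s's sw; first by move: h; rewrite mulSn; lia.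
by move=> -> ->; rewrite leqnn andbT; split=> //; move: h; rewrite mulSn; lia.
Qed.

Lemma expn_ffact m k : ((m - k) ^ k <= m ^_ k)%N.
Proof.
elim: k => // k IH; rewrite expnSr ffactnSr; apply: leq_mul; last by lia.
apply: leq_trans IH; case: k => [|k]; first by rewrite !expn0.
by rewrite leq_exp2r//; lia.
Qed.

Section GridHistory.
Context {R : realType} d (Om : measurableType d) (P : probability Om R).
Variables (t T : R) (xi : nat * bool * nat -> {RV P >-> R}).
Hypotheses (T_gt0 : 0 < T).
Variables (N n : nat).
Hypothesis n_gt0 : (0 < n)%N.
Let delta := T / n%:R.
Variable om : Om.
Let x i := xi i om.
Hypothesis x_gt0 : forall i, 0 < x i.

Let delta_gt0 : 0 < delta.
Proof. by rewrite divr_gt0// ltr0n. Qed.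

Let delta_le (k : nat) : (k <= n)%N -> k%:R * delta <= T.
Proof.
move=> kn; rewrite /delta mulrCA ler_piMr ?(ltW T_gt0)//.
by rewrite ler_pdivrMr ?ltr0n// mul1r ler_nat.
Qed.

Lemma grid_event_in_clocks T' delta' (cnt prev : nat * bool -> nat) c :
  constr_event xi (grid_constr T' delta' N cnt prev [::]) om -> (c.1 < N)%N ->
  T' - (prev c)%:R * delta' < x (c, cnt c).
Proof.
rewrite -mem_clocks /=; elim: (clocks N) => //= c' s IH [h1 h2].
rewrite inE => /orP[/eqP->|]; last exact: IH.
by move: h1; rewrite /= in_itv /= andbT.
Qed.

(** Each waiting time is known up to one cell, so the errors add up: the last ring of [c] lies
    between [prev c] and [prev c + cnt c] cells. Since [cnt c] never exceeds [gp], the imposed gaps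
    preserve the order. *)
Lemma grid_rings gp lo cnt prev ps :
  grid_ok gp n lo ps -> (forall c, (prev c <= lo)%N) ->
  (forall c, (cnt c + size ps <= gp)%N) ->
  (forall c, (prev c)%:R * delta <= \sum_(j < cnt c) x (c, j : nat) /\
     \sum_(j < cnt c) x (c, j : nat) <= (prev c + cnt c)%:R * delta) ->
  grid_event T xi N n cnt prev ps om ->
  let H := ring_list x cnt [seq dc.2 | dc <- ps] in
  [/\ sorted before H,
      forall s c, (s, c) \in H -> lo%:R * delta < s /\ s <= T &
      forall c, (c.1 < N)%N -> T <
        \sum_(j < (cnt c + count_mem c [seq dc.2 | dc <- ps]).+1) x (c, j : nat)].
Proof.
elim: ps lo cnt prev => [|[d' c] ps IH] lo cnt prev /=.
  move=> _ _ _ hS hG; split=> // c cN; rewrite addn0 big_ord_recr /=.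
  have := grid_event_in_clocks hG cN; have [+ _] := hS c.
  by rewrite -/delta; lra.
move=> /and3P[lod dn ok] pl cgp hS [hx hG].
move: hx; rewrite /= in_itv /= -/(x _) -/delta => /andP[x1 x2].
have [S1 S2] := hS c.
set s := \sum_(j < (cnt c).+1) x (c, j : nat).
have sE : s = \sum_(j < cnt c) x (c, j : nat) + x (c, cnt c).
  by rewrite /s big_ord_recr.
have s1 : d'%:R * delta < s.
  have -> : d'%:R * delta = (prev c)%:R * delta + (d'%:R - (prev c)%:R) * delta by ring.
  by rewrite sE; lra.
have s2 : s <= (d' + (cnt c).+1)%:R * delta.
  have -> : (d' + (cnt c).+1)%:R * delta =
    (prev c + cnt c)%:R * delta + (d'%:R - (prev c)%:R + 1) * delta.
    by rewrite !natrD -addn1 natrD; ring.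
  by rewrite sE; lra.
have cg : ((cnt c).+1 <= gp)%N by move: (cgp c); clear; lia.
have s3 : s <= (d' + gp)%:R * delta.
  by apply: le_trans s2 _; rewrite ler_wpM2r ?(ltW delta_gt0)// ler_nat leq_add2l.
have [||||IH1 IH2 IH3] := IH (d' + gp).+1 (upd cnt c (cnt c).+1) (upd prev c d') ok.
- by move=> c'; rewrite /upd; move: (pl c') lod; clear; case: eqP; lia.
- by move=> c'; rewrite /upd; move: (cgp c'); clear; case: eqP => [->|_]; lia.
- move=> c'; rewrite /upd; case: eqP => [->|_]; last exact: hS.
  by split; [exact: ltW|].
- exact: hG.
have lt_lo : s < (d' + gp).+1%:R * delta.
  by apply: le_lt_trans s3 _; rewrite ltr_pM2r// ltr_nat.
split.
- rewrite path_sortedE; last by move=> a b e; exact: lt_trans.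
  rewrite IH1 andbT; apply/allP => -[s' c'] /IH2[h _].
  by rewrite /before /=; exact: lt_trans h.
- move=> s' c'; rewrite inE => /orP[/eqP[-> _]|/IH2[h1 h2]].
    split; last by apply: le_trans s3 _; exact: delta_le.
    by apply: le_lt_trans s1; rewrite ler_wpM2r ?(ltW delta_gt0)// ler_nat.
  split=> //; apply: le_lt_trans h1; rewrite ler_wpM2r ?(ltW delta_gt0)//.
  by rewrite ler_nat; move: lod; clear; lia.
- move=> c' /IH3; rewrite /upd.
  case: (eqVneq c' c) => [->|cc']; first by rewrite addnA addn1.
  by rewrite add0n.
Qed.

Lemma sum_x_lt (c : nat * bool) k m : (k < m)%N ->
  \sum_(j < k) x (c, j : nat) < \sum_(j < m) x (c, j : nat).
Proof.
elim: m => // m IH; rewrite ltnS leq_eqVlt => /orP[/eqP->|/IH]; rewrite big_ord_recr /=.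
  by rewrite ltrDl.
by move=> /lt_trans; apply; rewrite ltrDl.
Qed.

Lemma grid_event_history ps : grid_ok (size ps) n 0 ps ->
  all (fun dc => (dc.2.1 < N)%N) ps ->
  grid_event T xi N n (fun=> 0%N) (fun=> 0%N) ps om ->
  history T x N (ring_list x (fun=> 0%N) [seq dc.2 | dc <- ps]).
Proof.
move=> ok psN hG.
have [||||H1 H2 H3] := @grid_rings (size ps) 0%N (fun=> 0%N) (fun=> 0%N) ps ok => //.
  by move=> c; rewrite big_ord0 mul0r.
split=> // s [p b]; split.
  move=> /[dup] /H2[h1 h2] /ring_list_mem[j [_ jc sE]]; split=> //.
  - have /allP : all (fun c => (c.1 < N)%N) [seq dc.2 | dc <- ps] by rewrite all_map.
    by move/(_ (p, b)); apply; rewrite -has_pred1 has_count; exact: leq_ltn_trans jc.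
  - by rewrite (le_lt_trans _ h1)// mul0r.
  - by exists j.
move=> [/= pN s0 sT [k sE]]; apply/ring_list_mem; exists k; split=> //.
rewrite ltnNge; apply/negP => ck; have := H3 (p, b) pN; rewrite ltNge => /negP; apply.
apply: le_trans sT; rewrite sE; move: ck; rewrite leq_eqVlt => /orP[/eqP->//|ck].
by rewrite ltW// sum_x_lt.
Qed.

Lemma grid_event_inj cnt prev ps ps' :
  [seq dc.2 | dc <- ps] = [seq dc.2 | dc <- ps'] ->
  grid_event T xi N n cnt prev ps om -> grid_event T xi N n cnt prev ps' om ->
  ps = ps'.
Proof.
elim: ps ps' cnt prev => [|[d1 c] ps IH] [|[d2 c'] ps'] cnt prev //= [<- e].
move=> [+ h1] [+ h2]; rewrite /= !in_itv /= -/(x _) -/delta.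
move=> /andP[a1 a2] /andP[b1 b2].
have lt12 (u v : nat) y : (u%:R - (prev c)%:R) * delta < y ->
    y <= (v%:R - (prev c)%:R + 1) * delta -> (u <= v)%N.
  move=> /lt_le_trans h /h; rewrite ltr_pM2r// => {}h.
  by rewrite -ltnS -(ltr_nat R) -addn1 natrD; move: h; lra.
have d12 : d1 = d2.
  by apply/eqP; rewrite eqn_leq (lt12 _ _ _ a1 b2) (lt12 _ _ _ b1 a2).
rewrite d12 in h1 *; congr (_ :: _).
exact: IH e h1 h2.
Qed.

End GridHistory.

Section GridLimit.
Context {R : realType}.

(** Squeezed by [z / (1 + z) <= 1 - expR (- z) <= z] with [z = y / n.+1%:R]; both bounds come from
    [1 + u <= expR u]. *)
Lemma cvg_one_expR (a : nat) (y : R) : 0 < y ->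
  (n.+1 - a)%:R * (1 - expR (- (y / n.+1%:R))) @[n --> \oo] --> y.
Proof.
move=> y0.
apply: (@squeeze_cvgr _ _ _ _ (fun n => y * (1 - (a%:R + y) * harmonic n)) (fun=> y)).
- near=> n.
  have an : (a <= n)%N by near: n; exact: nbhs_infty_ge.
  have n0 : 0 < n.+1%:R :> R by rewrite ltr0n.
  set z := y / n.+1%:R; have z0 : 0 < z by rewrite divr_gt0.
  have -> : (n.+1 - a)%:R = n.+1%:R - a%:R :> R by rewrite natrB// ltnW.
  have na : 0 <= n.+1%:R - a%:R :> R by rewrite subr_ge0 ler_nat ltnW.
  apply/andP; split; last first.
    apply: (@le_trans _ _ (n.+1%:R * z)); last by rewrite /z mulrCA mulfV ?mulr1 ?gt_eqF.
    apply: ler_pM => //; first by rewrite subr_ge0 expR_le1 oppr_le0 ltW.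
      by rewrite gerBl.
    by have := expR_ge1Dx (- z); lra.
  apply: (@le_trans _ _ ((n.+1%:R - a%:R) * (z / (1 + z)))).
    rewrite /= /z -subr_ge0.
    have E (q : R) : 0 < q -> (q - a%:R) * (y / q / (1 + y / q)) -
        y * (1 - (a%:R + y) * q^-1) = y * (a%:R * y + y * y) / (q * (q + y)).
      by move=> q0; field; rewrite !gt_eqF ?addr_gt0.
    by rewrite E// !(mulr_ge0, addr_ge0, invr_ge0)// ltW// addr_gt0.
  rewrite ler_wpM2l// lerBrDr.
  have z1 : 0 < 1 + z by rewrite addr_gt0.
  have -> : z / (1 + z) = 1 - (1 + z)^-1 by field; rewrite gt_eqF.
  by rewrite -addrA gerDl addrC subr_le0 expRN lef_pV2 ?posrE ?expR_gt0 ?expR_ge1Dx.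
- rewrite -[X in _ --> X]mulr1; apply: cvgMr.
  rewrite -[X in _ --> X]subr0; apply: cvgB; first exact: cvg_cst.
  by rewrite -[X in _ --> X](mulr0 (a%:R + y)); apply: cvgMr; exact: cvg_harmonic.
- exact: cvg_cst.
Unshelve. all: by end_near. Qed.

Lemma cvg_prod_one_expR (a : nat) (I : Type) (w : seq I) (y : I -> R) :
  (forall i, 0 < y i) ->
  \prod_(i <- w) ((n.+1 - a)%:R * (1 - expR (- (y i / n.+1%:R)))) @[n --> \oo]
    --> \prod_(i <- w) y i.
Proof.
move=> y0; elim: w => [|i w IH].
  under eq_fun do rewrite big_nil; rewrite big_nil; exact: cvg_cst.
under eq_fun do rewrite big_cons; rewrite big_cons; apply: cvgM => //.
exact: cvg_one_expR.
Qed.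

End GridLimit.

Section LowerBound.
Context {R : realType} d (Om : measurableType d) (P : probability Om R).
Variables (t T : R) (xi : nat * bool * nat -> {RV P >-> R}).
Hypotheses (t_gt0 : 0 < t) (t_lt1 : t < 1) (T_gt0 : 0 < T).
Hypothesis xi_indep : mutually_independent xi.
Hypothesis xi_law : forall (p : nat) (dir : bool) (k : nat) (A : set R),
  measurable A ->
  P (xi (p, dir, k) @^-1` A) = exponential_prob (if dir then 1 else t) A.

Definition word_prob (N : nat) (w : seq (nat * bool)) : R :=
  expR (- (N%:R * (1 + t) * T)) * (T ^+ size w / (size w)`!%:R * wt t w).

Definition zero_clock : nat * bool -> nat := fun=> 0%N.

(** The number of grids times their common probability, for a word of size [k]. The [k] gaps of
    length [k] leave room [m = n.+1 - k * k], and the binomial coefficient is bounded below by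
    [(m - k) ^ k / k!]. *)
Let approx (n : nat) (w : seq (nat * bool)) : R :=
  \prod_(c <- w) ((n.+1 - (size w * size w + size w))%:R *
     (1 - expR (- (rate t c * T / n.+1%:R)))) / (size w)`!%:R.

Let approx_le n w : approx n w <=
  (size (grids (size w) (size w) 0 (n.+1 - size w * size w)))%:R *
  \prod_(c <- w) (1 - expR (- (rate t c * (T / n.+1%:R)))).
Proof.
rewrite size_grids /approx big_split /= big_const_seq count_predT iter_mulr_1.
rewrite mulrAC; set k := size w; set m := (n.+1 - k * k)%N.
have -> : \prod_(c <- w) (1 - expR (- (rate t c * T / n.+1%:R))) =
  \prod_(c <- w) (1 - expR (- (rate t c * (T / n.+1%:R)))).
  by apply: eq_bigr => c _; rewrite mulrA.
rewrite ler_wpM2r//.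
  apply: prodr_ge0 => c _; rewrite subr_ge0 expR_le1 oppr_le0.
  by rewrite mulr_ge0 ?divr_ge0 ?ltW ?rate_gt0.
rewrite ler_pdivrMr ?ltr0n ?fact_gt0// -natrM bin_ffact subnDA -natrX ler_nat.
exact: expn_ffact.
Qed.

(** Outside [Z] the grid events are disjoint: two words are separated by uniqueness of the history,
    two position lists for the same word by [grid_event_inj]. As the mesh tends to 0, their total
    probability is at least the left-hand side in the limit. *)
Lemma Pr_lower (N : nat) (W : seq (seq (nat * bool))) (E Z : set Om) :
  measurable E -> measurable Z -> Pr P Z = 0 ->
  (forall om, ~ Z om -> forall i, 0 < xi i om) ->
  uniq W -> (forall w, w \in W -> all (fun c => (c.1 < N)%N) w) ->
  (forall om n ps, ~ Z om -> (0 < n)%N -> grid_ok (size ps) n 0 ps ->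
     [seq dc.2 | dc <- ps] \in W ->
     grid_event T xi N n zero_clock zero_clock ps om -> E om) ->
  \sum_(w <- W) word_prob N w <= Pr P E.
Proof.
move=> mE mZ Z0 xi0 uW WN HE.
pose C := expR (- (N%:R * (1 + t) * T)).
have step n : C * \sum_(w <- W) approx n w <= Pr P E.
  pose idx := [seq zip s w | w <- W,
     s <- grids (size w) (size w) 0 (n.+1 - size w * size w)].
  have idxP ps : ps \in idx -> [/\ grid_ok (size ps) n.+1 0 ps,
      [seq dc.2 | dc <- ps] \in W &
      exists2 s, s \in grids (size ps) (size ps) 0 (n.+1 - size ps * size ps) &
        ps = zip s [seq dc.2 | dc <- ps]].
    move=> /allpairsPdep[w [s [wW sg ->]]].
    have kn : (0 + (n.+1 - size w * size w) + size w * size w <= n.+1)%N.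
      have [kn|kn] := leqP (size w * size w) n.+1; first by rewrite add0n subnK.
      move: sg; have -> : (n.+1 - size w * size w = 0)%N.
        by apply/eqP; rewrite subn_eq0 ltnW.
      by move: kn; case: (size w).
    have [ss ok] := mem_grids kn sg (erefl (size w)).
    have sz : size (zip s w) = size w by rewrite size_zip ss minnn.
    have l2 : [seq dc.2 | dc <- zip s w] = w by exact: (@unzip2_zip _ _ s w (eq_leq (esym ss))).
    by rewrite sz l2; split=> //; exists s.
  have letN ps : ps \in idx -> all (fun dc => (dc.2.1 < N)%N) ps.
    by move=> /idxP[_ /WN + _]; rewrite all_map.
  pose B ps : set Om := grid_event T xi N n.+1 zero_clock zero_clock ps `\` Z.
  have mG ps : measurable (grid_event T xi N n.+1 zero_clock zero_clock ps).
    exact: measurable_grid_event.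
  have PB ps : ps \in idx -> Pr P (B ps) =
      C * \prod_(dc <- ps) (1 - expR (- (rate t dc.2 * (T / n.+1%:R)))).
    move=> psi; have [ok _ _] := idxP _ psi.
    have -> : Pr P (B ps) = Pr P (grid_event T xi N n.+1 zero_clock zero_clock ps).
      rewrite (Pr_DI P (mG ps) mZ) [X in _ = _ + X](_ : _ = 0) ?addr0//.
      apply/eqP; rewrite eq_le Pr_ge0 andbT -Z0.
      by apply: Pr_le => //; exact: measurableI.
    rewrite (@Pr_grid_event _ _ _ P t T xi t_gt0 t_lt1 T_gt0 xi_indep xi_law N n.+1 _
      (size ps) 0)//; last exact: letN.
    congr (_ * _); rewrite -expR_sum sum_clocks /C; congr expR.
    under eq_bigr do rewrite /rate /zero_clock /= mul0r !subr0.
    by rewrite sumr_const_nat subn0 -mulr_natl; ring.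
  have idx_uniq : uniq idx.
    apply: allpairs_uniq_dep => //; first by move=> w _; exact: grids_uniq.
    move=> p q /allpairsPdep[w1 [s1 [w1W s1g ->]]] /allpairsPdep[w2 [s2 [w2W s2g ->]]] /=.
    have [sz1 _] := mem_grids (n := (0 + (n.+1 - size w1 * size w1) + size w1 * size w1)%N)
      (leqnn _) s1g (erefl (size w1)).
    have [sz2 _] := mem_grids (n := (0 + (n.+1 - size w2 * size w2) + size w2 * size w2)%N)
      (leqnn _) s2g (erefl (size w2)).
    move=> e; have e2 := congr1 unzip2 e; have e1 := congr1 unzip1 e.
    move: e1 e2; rewrite !unzip1_zip ?sz1 ?sz2// !unzip2_zip ?sz1 ?sz2//.
    by move=> -> ->.
  rewrite mulr_sumr.
  apply: (@le_trans _ _ (\sum_(ps <- idx) Pr P (B ps))); last first.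
    apply: Pr_disjoint => //.
    - by move=> ps _; exact: measurableD.
    - move=> ps psi om [gom zom]; have [ok pW _] := idxP _ psi.
      exact: (HE om n.+1 ps).
    - move=> ps ps' psi psi' pp; apply/seteqP; split => // om [[g1 z1] [g2 z2]].
      have [ok1 _ _] := idxP _ psi; have [ok2 _ _] := idxP _ psi'.
      have h1 := grid_event_history T_gt0 (ltn0Sn n) (xi0 _ z1) ok1 (letN _ psi) g1.
      have h2 := grid_event_history T_gt0 (ltn0Sn n) (xi0 _ z1) ok2 (letN _ psi') g2.
      have := congr1 (map snd) (history_uniq h1 h2).
      rewrite !ring_list_letters => e.
      by move: pp; rewrite (grid_event_inj T_gt0 (ltn0Sn n) e g1 g2) eqxx.
  rewrite (eq_big_seq _ PB) big_allpairs_dep big_seq [leRHS]big_seq.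
  apply: ler_sum => w wW; rewrite -mulr_sumr ler_wpM2l ?expR_ge0//.
  apply: le_trans (approx_le n w) _; rewrite mulr_natl -[leLHS]addr0 -iter_addr.
  rewrite -count_predT -big_const_seq.
  rewrite big_seq [leRHS]big_seq; apply: ler_sum => s sg.
  have [sz _] := mem_grids (n := (0 + (n.+1 - size w * size w) + size w * size w)%N)
    (leqnn _) sg (erefl (size w)).
  rewrite -(big_map snd xpredT (fun c => 1 - expR (- (rate t c * (T / n.+1%:R))))).
  by rewrite -/(unzip2 _) unzip2_zip ?sz.
have lim : C * (\sum_(w <- W) approx n w) @[n --> \oo] -->
    C * \sum_(w <- W) (\prod_(c <- w) (rate t c * T)) / (size w)`!%:R.
  apply: cvgMr; elim: (W) => [|w W' IH].
    by under eq_fun do rewrite big_nil; rewrite big_nil; exact: cvg_cst.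
  under eq_fun do rewrite big_cons; rewrite big_cons; apply: cvgD => //.
  apply: cvgMl; apply: cvg_prod_one_expR => c.
  by rewrite mulr_gt0 ?rate_gt0.
have -> : \sum_(w <- W) word_prob N w =
    C * \sum_(w <- W) (\prod_(c <- w) (rate t c * T)) / (size w)`!%:R.
  rewrite mulr_sumr; apply: eq_bigr => w _; congr (_ * _).
  rewrite big_split /= big_const_seq count_predT iter_mulr_1 /wt.
  by rewrite mulrC mulrA.
by apply: (cvgr_to_le lim); near=> n; exact: step.
Unshelve. all: by end_near. Qed.

End LowerBound.

(** * Particles that do not move *)

Section AlmostSure.
Context {R : realType} d (Om : measurableType d) (P : probability Om R).
Variables (t T : R) (xi : nat * bool * nat -> {RV P >-> R}).
Hypotheses (t_gt0 : 0 < t) (t_lt1 : t < 1) (T_gt0 : 0 < T).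
Hypothesis xi_indep : mutually_independent xi.
Hypothesis xi_law : forall (p : nat) (dir : bool) (k : nat) (A : set R),
  measurable A ->
  P (xi (p, dir, k) @^-1` A) = exponential_prob (if dir then 1 else t) A.

Definition all_words (N K : nat) : seq (seq (nat * bool)) :=
  [seq w | k <- iota 0 K, w <- words N k].

Lemma mem_all_words N K w :
  (w \in all_words N K) = (size w < K)%N && all (fun c => (c.1 < N)%N) w.
Proof.
apply/allpairsPdep/idP => [[k [w' [+ + ->]]]|/andP[wK aw]].
  by rewrite mem_iota mem_words => /andP[_ kK] /andP[/eqP-> ->]; rewrite andbT.
by exists (size w), w; rewrite mem_iota mem_words eqxx aw wK.
Qed.

Lemma all_words_uniq N K : uniq (all_words N K).
Proof.
apply: allpairs_uniq_dep; first exact: iota_uniq.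
  by move=> k _; exact: words_uniq.
move=> p q /allpairsPdep[k1 [w1 [_ + ->]]] /allpairsPdep[k2 [w2 [_ + ->]]] /=.
by rewrite !mem_words => /andP[/eqP<- _] /andP[/eqP<- _] ->.
Qed.

Lemma rho_sumE N K phi :
  rho_sum t T N K phi = \sum_(w <- all_words N K) word_prob t T N w * phi w.
Proof.
rewrite /rho_sum /all_words big_allpairs_dep mulr_sumr /index_iota subn0.
apply: eq_bigr => k _; rewrite /wsum mulrA mulr_sumr big_seq [RHS]big_seq.
apply: eq_bigr => w; rewrite mem_words => /andP[/eqP sw _].
by rewrite /word_prob sw !mulrA.
Qed.

Definition frozen (q : nat) : set Om :=
  constr_event xi [:: ((q, true, 0%N), [set` `]T, +oo[]);
                      ((q, false, 0%N), [set` `]T, +oo[])].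

Lemma frozenP q om : frozen q om <-> T < xi (q, true, 0%N) om /\ T < xi (q, false, 0%N) om.
Proof. by rewrite /frozen /= !in_itv /= !andbT; split=> [[? []]|[]]. Qed.

Definition all_moving (Q : seq nat) : set Om := [set om | forall q, q \in Q -> ~ frozen q om].

Lemma measurable_frozen q : measurable (frozen q).
Proof.
by apply: measurable_constr_event => iA /= [<-|[<-|//]]; exact: measurable_itv.
Qed.

Lemma measurable_all_moving Q : measurable (all_moving Q).
Proof.
rewrite [X in measurable X](_ : _ = \bigcap_(q in [set` Q]) ~` frozen q).
  apply: bigcap_measurableType.
  by move=> q _; apply: measurableC; exact: measurable_frozen.
by apply/seteqP; split => om H q /=; exact: H.
Qed.

Let u : R := expR (- ((1 + t) * T)).

(** Moving is a complement and not a constraint on single waiting times, so the induction carries a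
    list [cs] about other particles: the event for [q :: Q] is the one for [Q] minus the one for [Q]
    with [frozen q] added to [cs]. *)
Lemma Pr_all_moving_constr cs Q : uniq Q -> uniq [seq iA.1 | iA <- cs] ->
  (forall iA, List.In iA cs -> measurable iA.2) ->
  (forall q, q \in Q -> q \notin [seq iA.1.1.1 | iA <- cs]) ->
  Pr P (constr_event xi cs `&` all_moving Q) =
  Pr P (constr_event xi cs) * (1 - u) ^+ size Q.
Proof.
elim: Q cs => [|q Q IH] cs /=.
  move=> _ _ _ _; rewrite expr0 mulr1 [X in _ `&` X](_ : _ = setT) ?setIT//.
  by apply/seteqP; split => om.
move=> /andP[nq uQ] ucs mcs disj.
have mC : measurable (constr_event xi cs) by exact: measurable_constr_event.
have mM := measurable_all_moving Q.
pose cs' := [:: ((q, true, 0%N), [set` `]T, +oo[]);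
                ((q, false, 0%N), [set` `]T, +oo[])] ++ cs.
have E1 := Pr_DI P (measurableI _ _ mC mM) (measurable_frozen q).
have E2 : constr_event xi cs `&` all_moving Q `\` frozen q =
    constr_event xi cs `&` all_moving (q :: Q).
  apply/seteqP; split => om.
    move=> [[h1 h2] h3]; split => // q'; rewrite inE => /orP[/eqP->//|]; exact: h2.
  move=> [h1 h2]; split; first by split => // q' q'Q; apply: h2; rewrite inE q'Q orbT.
  by apply: h2; rewrite mem_head.
have E3 : constr_event xi cs `&` all_moving Q `&` frozen q =
    constr_event xi cs' `&` all_moving Q.
  by apply/seteqP; split => om /=; rewrite /frozen /=; tauto.
have mcs' iA : List.In iA cs' -> measurable iA.2.
  by rewrite /cs' /= => -[<-|[<-|/mcs//]]; exact: measurable_itv.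
have nqcs b : (q, b, 0%N) \notin [seq iA.1 | iA <- cs].
  apply: contra (disj q (mem_head _ _)) => /mapP[iA iAcs e].
  by apply/mapP; exists iA => //; rewrite -e.
have ucs' : uniq [seq iA.1 | iA <- cs'].
  by rewrite /cs' /= inE negb_or !nqcs ucs !andbT; apply/eqP; case.
have P' : Pr P (constr_event xi cs') = u * Pr P (constr_event xi cs).
  rewrite !Pr_constr_event// /cs' /= !big_cons mulrA; congr (_ * _).
  rewrite !(Pr_xi_gt t_gt0 xi_law) ?(ltW T_gt0)// /rate /= -expRD /u; congr expR.
  ring.
have d1 q' : q' \in Q -> q' \notin [seq iA.1.1.1 | iA <- cs].
  by move=> q'Q; apply: disj; rewrite inE q'Q orbT.
have d2 q' : q' \in Q -> q' \notin [seq iA.1.1.1 | iA <- cs'].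
  move=> q'Q; rewrite /cs' /= !inE !negb_or (d1 _ q'Q).
  by have -> : q' != q by apply: contraNneq nq => <-.
move: E1; rewrite E2 E3 (IH cs)// (IH cs')// P' exprS => E1.
apply: (addIr (u * Pr P (constr_event xi cs) * (1 - u) ^+ size Q)).
by rewrite -E1; ring.
Qed.

Lemma Pr_all_moving Q : uniq Q -> Pr P (all_moving Q) = (1 - u) ^+ size Q.
Proof.
move=> uQ; have := @Pr_all_moving_constr [::] Q uQ.
by rewrite /= setTI Pr_setT mul1r; exact.
Qed.

Definition no_freeze : R := 1 - u.

Lemma no_freeze_ge0 : 0 <= no_freeze.
Proof. by rewrite subr_ge0 expR_le1 oppr_le0 !mulr_ge0 ?addr_ge0// ltW. Qed.

Lemma no_freeze_lt1 : no_freeze < 1.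
Proof. by rewrite /no_freeze gtrBl expR_gt0. Qed.

Lemma no_freeze_cvg : no_freeze ^+ N @[N --> \oo] --> (0 : R).
Proof. by apply: cvg_expr; rewrite ger0_norm ?no_freeze_ge0// no_freeze_lt1. Qed.

End AlmostSure.

(** * The trajectory is determined by the order of the rings *)

Section Pathwise.
Context {R : realType}.
Variables (T : R) (x : nat * bool * nat -> R).
Hypothesis T_gt0 : 0 < T.

Let rings (c : nat * bool) (s : R) := rings_at x c.1 c.2 s.

(** Induction over the rings with time carried along. The jump case supplies a whole interval
    [[lo, s)] before the ring because a trajectory prescribes the state at a ring through a left
    limit. *)
Lemma history_ind M H (Q : seq (nat * bool) -> R -> Prop) :
  history T x M H ->
  Q [::] 0 ->
  (forall w s s', 0 <= s -> s <= s' -> s' <= T -> Q w s ->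
     (forall c v, (c.1 < M)%N -> s < v -> v <= s' -> ~ rings c v) -> Q w s') ->
  (forall w c s lo, 0 <= lo -> lo < s -> s <= T -> (c.1 < M)%N -> rings c s ->
     (forall v, lo <= v -> v < s -> Q w v) ->
     (forall c' v, (c'.1 < M)%N -> lo < v -> v <= s -> rings c' v -> c' = c) ->
     Q (rcons w c) s) ->
  forall H1 H2, H = H1 ++ H2 -> forall s, 0 <= s -> s <= T ->
    (forall e, e \in H1 -> e.1 <= s) -> (forall e, e \in H2 -> s < e.1) ->
    Q [seq e.2 | e <- H1] s.
Proof.
move=> [sH mH] Q0 Qflow Qjump; elim/last_ind => [|H1 [s1 c1] IH] H2 HE s s0 sT h1 h2.
  apply: (Qflow _ 0) => // c v cM v0 vs rv.
  have /h2 /= : (v, c) \in H2.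
    by rewrite -[H2]/([::] ++ H2) -HE; apply/mH; split=> //; exact: le_trans sT.
  by rewrite ltNge vs.
rewrite map_rcons /=.
have s1s : s1 <= s by apply: (h1 (s1, c1)); rewrite mem_rcons mem_head.
have inH : (s1, c1) \in H by rewrite HE mem_cat mem_rcons mem_head.
have [cM s10 s1T r1] := (mH s1 c1).1 inH.
have sorted1 : sorted before (H1 ++ (s1, c1) :: H2) by rewrite -cat_rcons -HE.
have tr : transitive (@before R) by move=> a b e; exact: lt_trans.
have lt1 e : e \in H1 -> e.1 < s1.
  move=> eH1; have := sorted1; rewrite (sorted_pairwise tr) pairwise_cat.
  by move=> /and3P[/allrelP/(_ e (s1, c1) eH1 (mem_head _ _))].
have lt2 e : e \in H2 -> s1 < e.1.
  move=> eH2; have := sorted1; rewrite (sorted_pairwise tr) pairwise_cat /=.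
  by move=> /and4P[_ _ /allP/(_ _ eH2)].
(* [lo] is the last ring time before [s1], or 0. *)
have [lo [lo0 los1 loH]] : exists lo, [/\ 0 <= lo, lo < s1 &
    forall e, e \in H1 -> e.1 <= lo].
  elim: (H1) lt1 => [|e H' IH'] lt1; first by exists 0.
  have [|lo [h3 h4 h5]] := IH'; first by move=> e' e'H; apply: lt1; rewrite inE e'H orbT.
  exists (Num.max lo e.1); split; first by rewrite le_max h3.
    by rewrite gt_max h4 lt1// mem_head.
  move=> e'; rewrite inE => /orP[/eqP->|/h5]; first by rewrite le_max lexx orbT.
  by rewrite le_max => ->.
apply: (Qflow _ s1) => //; first exact: ltW.
  apply: (Qjump _ _ _ lo) => //.
    move=> v lov vs1; apply: (IH ((s1, c1) :: H2)) => //.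
    - by rewrite HE cat_rcons.
    - exact: le_trans lov.
    - by apply: le_trans s1T; exact: ltW.
    - by move=> e /loH h; exact: le_trans lov.
    - by move=> e; rewrite inE => /orP[/eqP->//|/lt2]; exact: lt_trans.
  move=> c' v c'M lov vs1 rv.
  have : (v, c') \in H.
    apply/mH; split=> //; first exact: le_lt_trans lov.
    exact: le_trans s1T.
  rewrite HE mem_cat mem_rcons inE => /orP[/orP[/eqP[]//|/loH/=]|/lt2/=].
    by rewrite leNgt lov.
  by rewrite ltNge vs1.
move=> c v cM' s1v vs rv.
have : (v, c) \in H.
  apply/mH; split=> //; first exact: lt_trans s1v.
  exact: le_trans sT.
rewrite HE mem_cat mem_rcons inE => /orP[/orP[/eqP[e _]|/lt1/=]|/h2/=].
- by move: s1v; rewrite e ltxx.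
- by rewrite ltNge (ltW s1v).
- by rewrite ltNge vs.
Qed.

Variable X : nat -> R -> int.
Hypothesis trajX : asep_trajectory x X.

Let X_flow p s s' : 0 <= s -> s <= s' ->
  (forall b v, s < v -> v <= s' -> ~ rings (p, b) v) -> X p s' = X p s.
Proof. by move=> s0 ss' h; case: trajX => _ _; apply. Qed.

(* A left limit is evaluated at some time in [lo, s). *)
Let X_jump c s lo : 0 <= lo -> lo < s -> rings c s ->
  exists v, [/\ lo < v, v < s & X c.1 s =
    if `[< vacant (X ^~ v) (X c.1 v + dir_step c.2) >]
    then X c.1 v + dir_step c.2 else X c.1 v].
Proof.
move=> lo0 los rs; have s0 : 0 < s by exact: le_lt_trans los.
have [_ /(_ c.1 c.2 s s0 rs) h _] := trajX.
have : \forall u \near s^'-, [/\ lo < u, u < s & X c.1 s =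
    if `[< vacant (X ^~ u) (X c.1 u + dir_step c.2) >]
    then X c.1 u + dir_step c.2 else X c.1 u].
  near=> u; split.
  - near: u; exact: nbhs_left_gt.
  - near: u; exact: nbhs_left_lt.
  - by near: u; exact: h.
by move=> /filter_ex[v]; exists v.
Unshelve. all: by end_near. Qed.

Variable N : nat.
Hypothesis frozenN : forall b v, 0 < v -> v <= T -> ~ rings (N, b) v.

Let X_frozen v : 0 <= v -> v <= T -> X N v = - N%:Z.
Proof.
move=> v0 vT; case: (trajX) => X0 _ _; rewrite -X0; apply: X_flow => // b u u0 uv.
by apply: frozenN => //; exact: le_trans vT.
Qed.

Let X_blocked q H : (N < q)%N -> history T x q.+1 H ->
  forall v, 0 <= v -> v <= T -> X q v < - N%:Z.
Proof.
move=> Nq hH v v0 vT.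
have [sH mH] := hH.
have tr : transitive (@before R) by move=> a b e; exact: lt_trans.
suff [H1 [H2 [HE h1 h2]]] : exists H1 H2, [/\ H = H1 ++ H2,
    forall e, e \in H1 -> e.1 <= v & forall e, e \in H2 -> v < e.1].
  apply: (history_ind (Q := fun _ s => X q s < - N%:Z) hH _ _ _ HE) => //.
  - by case: trajX => -> _ _; rewrite ltrN2 ltz_nat.
  - move=> w s s' s0 ss' s'T Xs h; rewrite (X_flow s0 ss')// => b u su us'.
    by apply: h.
  - move=> w [p b] s lo lo0 los sT pM rs IHs only.
    have [epq|npq] := eqVneq p q; last first.
      rewrite (X_flow lo0 (ltW los)); first exact: IHs.
      move=> b' u lou us ru; have [] := only (q, b') u (ltnSn q) lou us ru.
      by move=> e; move: npq; rewrite e eqxx.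
    have [u [lou us]] := X_jump lo0 los rs; rewrite /= epq => ->.
    have Xu : X q u < - N%:Z by apply: IHs => //; exact: ltW.
    have uT : u <= T by apply: le_trans sT; exact: ltW.
    have u0 : 0 <= u by apply: le_trans lo0 _; exact: ltW.
    case: asboolP => // /(_ N); rewrite /= X_frozen//.
    by move: Xu; clear; case: b => /=; rewrite /dir_step; lia.
exists [seq e <- H | e.1 <= v], [seq e <- H | ~~ (e.1 <= v)]; split.
- clear -sH tr; elim: H sH => //= e H IH; rewrite path_sortedE// => /andP[aH sH].
  case: leP => ev /=; first by rewrite -IH.
  have E : forall e', e' \in H -> (e'.1 <= v) = false.
    by move=> e' /(allP aH) h; apply/negbTE; rewrite -ltNge; exact: lt_trans h.
  rewrite [X in X ++ _](_ : _ = [::]) /=.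
    congr (_ :: _); symmetry; apply/all_filterP/allP => e' /E ->; by [].
  by apply/eqP; rewrite -size_eq0 size_filter -leqn0 leqNgt -has_count; apply/hasPn => e' /E ->.
- by move=> e; rewrite mem_filter => /andP[].
- by move=> e; rewrite mem_filter -ltNge => /andP[].
Qed.

Lemma trajectory_run H : history T x N H -> (forall M, exists H', history T x M H') ->
  forall p, (p < N)%N -> X p T = run [seq e.2 | e <- H] p.
Proof.
move=> hH allH.
pose Q (w : seq (nat * bool)) s := all (fun c => (c.1 < N)%N) w /\
  forall p, (p < N)%N -> X p s = run w p.
suff [] : Q [seq e.2 | e <- H] T by [].
apply: (history_ind (Q := Q) hH _ _ _ (esym (cats0 H))) => //.
- by split=> // p pN; case: trajX => ->.
- move=> w s s' s0 ss' s'T [wN Qs] h; split=> // p pN; rewrite (X_flow s0 ss').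
    exact: Qs.
  by move=> b v sv vs'; apply: h.
- move=> w [p b] s lo lo0 los sT pN rs IHs only; split.
    rewrite all_rcons pN /=; by have [] := IHs lo (lexx _) los.
  have [u [lou us Xs]] := X_jump lo0 los rs.
  have [wN Xu] := IHs u (ltW lou) us.
  have u0 : 0 <= u by apply: le_trans lo0 _; exact: ltW.
  have uT : u <= T by apply: le_trans sT; exact: ltW.
  have pw := run_packed wN.
  have vac z : - N%:Z <= z -> vacant (X ^~ u) z <-> vacant (run w) z.
    move=> zN; split=> v q.
      have [qN|Nq] := ltnP q N; first by rewrite -Xu.
      have [_ ->] := pw => //; have := v N; rewrite /= X_frozen//.
      by move: zN Nq; clear; lia.
    have [qN|Nq] := ltnP q N; first by rewrite Xu.
    have := v N; have [_ ->] := pw => //; move: Nq; rewrite leq_eqVlt.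
    move=> /orP[/eqP<-|Nq]; first by rewrite X_frozen.
    have [H' hH'] := allH q.+1; have := X_blocked Nq hH' u0 uT.
    by move: zN Nq; clear; lia.
  have zN : - N%:Z <= run w p + dir_step b.
    by have := packed_ge pw p; move: pN; clear; case: (b); rewrite /dir_step /=; lia.
  move=> p' p'N; rewrite run_rcons /move /=.
  have [ep|np] := eqVneq p' p.
    rewrite ep Xs /= Xu//.
    have -> : `[< vacant (X ^~ u) (run w p + dir_step b) >] =
              `[< vacant (run w) (run w p + dir_step b) >].
      by apply: asbool_equiv_eq; exact: vac.
    by case: asboolP => _ //; rewrite eqxx.
  have -> : X p' s = run w p'.
    rewrite -Xu//; apply: X_flow => //; first exact: ltW.
    move=> b' v uv vs rv; have [] := only (p', b') v p'N (lt_trans lou uv) vs rv.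
    by move=> e; move: np; rewrite e eqxx.
  by case: asboolP => _ //; rewrite (negbTE np).
- exact: ltW.
- by move=> e eH; have [] := hH => _ /(_ e.1 e.2); case: e eH => s c eH [/(_ eH)[]].
Qed.

End Pathwise.

(** * Measurability and almost sure properties of the ASEP path *)

Lemma measurable_bigcup_count d (Om : measurableType d) (U : countType)
    (F : U -> set Om) : (forall i, measurable (F i)) -> measurable (\bigcup_i F i).
Proof. by apply: countable_bigcupT_measurable; exact: countableP. Qed.

Lemma measurable_bigcap_count d (Om : measurableType d) (U : countType)
    (F : U -> set Om) : (forall i, measurable (F i)) -> measurable (\bigcap_i F i).
Proof.
move=> mF; rewrite -[X in measurable X]setCK setC_bigcap; apply: measurableC.
by apply: measurable_bigcup_count => i; exact: measurableC.
Qed.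

Lemma Pr0_negligible d (Om : measurableType d) (R : realType)
    (P : probability Om R) (A : set Om) :
  measurable A -> Pr P A = 0 -> P.-negligible A.
Proof. by move=> mA PA; exists A; split => //; rewrite PrE// PA. Qed.

Section Height.
Context d (Om : measurableType d) (X : nat -> Om -> int).
Hypothesis mX : forall p z, measurable [set w | X p w = z].

(** Finite sets of labels are countably many, and an infinite set counts as empty; so the event is a
    countable union over finite sets, together with the event of infinitely many particles if
    [k = 0]. *)
Lemma measurable_height z k : measurable [set w | height (X ^~ w) z = k].
Proof.
have mle p : measurable [set w | z <= X p w].
  rewrite [X in measurable X](_ : _ = \bigcup_(n : nat) [set w | X p w = z + n%:Z]).
    by apply: bigcup_measurable.
  apply/seteqP; split => w /=; last by move=> [n _ ->]; lia.
  by move=> h; exists `|(X p w - z)%R|%N => //=; lia.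
pose F (B : {fset nat}) := [set w | [set p : nat | z <= X p w] = [set` B]].
have mF B : measurable (F B).
  rewrite [X in measurable X](_ : _ = \bigcap_(p : nat)
     (if p \in B then [set w | z <= X p w] else ~` [set w | z <= X p w])).
    by apply: measurable_bigcap_count => p; case: ifP => _ //; exact: measurableC.
  apply/seteqP; split => w.
    rewrite /F /= => e p _; have : [set p : nat | z <= X p w] p = (p \in B) by rewrite e.
    by case: ifP => pB /= ->.
  move=> h; rewrite /F /=; apply/seteqP; split => p /=; have := h p I.
    by case: ifP.
  by case: ifP.
pose K := [set w | finite_set [set p : nat | z <= X p w]].
have KE : K = \bigcup_B F B.
  apply/seteqP; split => w.
    by move=> fw; exists (fset_set [set p : nat | z <= X p w]) => //; rewrite /F /= fset_setK.
  by move=> [B _]; rewrite /F /K /= => ->; exact: finite_fset.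
have mK : measurable K by rewrite KE; exact: measurable_bigcup_count.
have hF B w : F B w -> height (X ^~ w) z = #|` B|%:Z.
  by rewrite /F /height /= => ->; rewrite set_fsetK.
have hK w : ~ K w -> height (X ^~ w) z = 0.
  by move=> nK; rewrite /height /fset_set; case: pselect => // fK.
rewrite [X in measurable X](_ : _ =
  (\bigcup_(B : {fset nat}) (if #|` B|%:Z == k then F B else set0)) `|`
  (if k == 0 then ~` K else set0)).
  apply: measurableU.
    by apply: measurable_bigcup_count => B; case: ifP.
  by case: ifP => _ //; exact: measurableC.
apply/seteqP; split => w /=.
  move=> hk; have [|nK] := pselect (K w).
    rewrite {1}KE => -[B _ FB]; left; exists B => //.
    by rewrite -(hF _ _ FB) hk eqxx.
  by right; rewrite -hk hK// eqxx.
move=> [[B _]|]; last by case: eqP => // -> /hK.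
by case: eqP => // <- /hF.
Qed.

Lemma measurable_path_of l : measurable [set w | path_of (X ^~ w) = l].
Proof.
rewrite [X in measurable X](_ : _ =
  \bigcap_(i : int) [set w | height (X ^~ w) (i + 1) = - l i]).
  by apply: measurable_bigcap_count => i; exact: measurable_height.
apply/seteqP; split => w /=; first by move=> <- i _; rewrite /= /path_of opprK.
by move=> h; apply/funext => i; rewrite /path_of (h i I) opprK.
Qed.

End Height.

Section StepASEP.
Context {R : realType} d (Om : measurableType d) (P : probability Om R).
Variables (t T : R) (xi : nat * bool * nat -> {RV P >-> R}).
Variable X : nat -> R -> Om -> int.
Hypotheses (t_gt0 : 0 < t) (t_lt1 : t < 1) (T_gt0 : 0 < T).
Hypothesis asepX : is_step_asep t 1 xi X.

Let xi_indep : mutually_independent xi. Proof. by case: asepX. Qed.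

Let xi_law (p : nat) (dir : bool) (k : nat) (A : set R) : measurable A ->
  P (xi (p, dir, k) @^-1` A) = exponential_prob (if dir then 1 else t) A.
Proof. by case: asepX => _ + _ _; apply. Qed.

Let x om i := xi i om.

Lemma negligible_nonpos : P.-negligible [set om | ~ forall i, 0 < xi i om].
Proof.
pose F (n : nat) : set Om :=
  if choice.unpickle n is Some i then xi i @^-1` `]-oo, 0] else set0.
apply: (@negligibleS _ _ _ _ (\bigcup_n F n)).
  move=> om /existsNP[i /negP]; rewrite -leNgt => h; exists (choice.pickle i) => //.
  by rewrite /F choice.pickleK /= in_itv.
apply: negligible_bigcup => n; rewrite /F; case: choice.unpickle => [i|]; last first.
  exact: negligible_set0.
case: i => -[p b] k.
apply: Pr0_negligible; first exact: measurable_xi.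
have -> : xi (p, b, k) @^-1` `]-oo, 0] = ~` (xi (p, b, k) @^-1` `]0, +oo[).
  by apply/seteqP; split => om /=; rewrite !in_itv /= andbT leNgt => /negP.
rewrite Pr_setC; last exact: measurable_xi.
by rewrite (Pr_xi_gt t_gt0 xi_law)// mulr0 oppr0 expR0 subrr.
Qed.

Let Z0_ex : exists Z, [/\ measurable Z, Pr P Z = 0 &
  forall om, ~ Z om -> forall i, 0 < xi i om].
Proof.
have [Z [mZ PZ sZ]] := negligible_nonpos; exists Z; split=> //.
  by rewrite /Pr PZ.
by move=> om nZ; apply: contrapT => h; apply: nZ; exact: sZ.
Qed.

(** Finiteness and distinctness of the ring times come for free: by [Pr_lower] the union of the grid
    events has probability 1, and each grid event exhibits a history off a null set. *)
Lemma negligible_no_history M :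
  P.-negligible [set om | ~ exists H, history T (x om) M H].
Proof.
have [Z [mZ PZ Zpos]] := Z0_ex.
pose ok (q : nat * seq (nat * (nat * bool))) := [&& (0 < q.1)%N,
  grid_ok (size q.2) q.1 0 q.2 & all (fun dc => (dc.2.1 < M)%N) q.2].
pose E := \bigcup_(q : nat * seq (nat * (nat * bool)))
  (if ok q then grid_event T xi M q.1 zero_clock zero_clock q.2 else set0).
have mE : measurable E.
  apply: measurable_bigcup_count => q; case: ifP => _ //.
  exact: measurable_grid_event.
have PE1 : Pr P E = 1.
  apply/eqP; rewrite eq_le Pr_le1//=.
  apply: (cvgr_to_le (rho_sum1_cvg t T M)); apply: nearW => K.
  rewrite rho_sumE; under eq_bigr do rewrite mulr1.
  apply: (Pr_lower t_gt0 t_lt1 T_gt0 xi_indep xi_law mE mZ PZ Zpos).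
  - exact: all_words_uniq.
  - by move=> w; rewrite mem_all_words => /andP[].
  - move=> om n ps _ n0 okps; rewrite mem_all_words => /andP[_]; rewrite all_map => aps g.
    by exists (n, ps) => //; rewrite /ok /= n0 okps aps.
apply: (@negligibleS _ _ _ _ (~` E `|` Z)).
  move=> om nh; have [|nZ] := pselect (Z om); first by right.
  left=> -[[n ps] _]; case: ifP => // /and3P[/= n0 okps aps] g; apply: nh.
  have := grid_event_history T_gt0 n0 (Zpos _ nZ) okps aps g.
  by move=> h; exists (ring_list (x om) (fun=> 0%N) [seq dc.2 | dc <- ps]).
apply: negligibleU; apply: Pr0_negligible => //; first exact: measurableC.
by rewrite Pr_setC// PE1 subrr.
Qed.

(** That none of the [n] particles from [m] on is frozen has probability [no_freeze t T ^+ n], which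
    tends to 0. *)
Lemma negligible_all_moving m :
  P.-negligible [set om | ~ exists2 q, (m <= q)%N & frozen T xi q om].
Proof.
pose E := \bigcap_(n : nat) all_moving T xi (iota m n).
have mE : measurable E.
  by apply: bigcapT_measurable => n; exact: measurable_all_moving.
apply: (@negligibleS _ _ _ _ E).
  move=> om nf n _ q; rewrite mem_iota => /andP[mq _] fq; apply: nf.
  by exists q.
apply: Pr0_negligible => //; apply/eqP.
rewrite eq_le Pr_ge0 andbT; apply: (cvgr_to_ge (no_freeze_cvg t_gt0 T_gt0)).
apply: nearW => n; rewrite /no_freeze.
have <- : Pr P (all_moving T xi (iota m n)) = (1 - expR (- ((1 + t) * T))) ^+ n.
  by rewrite (Pr_all_moving t_gt0 T_gt0 xi_indep xi_law) ?iota_uniq// size_iota.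
by apply: Pr_le => //; [exact: measurable_all_moving|move=> om; apply].
Qed.

Definition typical (om : Om) : Prop :=
  [/\ asep_trajectory (x om) (fun p s => X p s om),
      forall i, 0 < xi i om,
      forall M, exists H, history T (x om) M H &
      forall m, exists2 q, (m <= q)%N & frozen T xi q om].

Lemma asep_null_set : exists Z, [/\ measurable Z, Pr P Z = 0 &
  forall om, ~ Z om -> typical om].
Proof.
have [_ _ _ aeX] := asepX.
have n1 : P.-negligible (~` [set om | asep_trajectory (x om) (fun p s => X p s om)]) by [].
have n2 := negligible_nonpos.
have n3 := negligible_bigcup negligible_no_history.
have n4 := negligible_bigcup negligible_all_moving.
have [Z [mZ PZ sZ]] := negligibleU (negligibleU n1 n2) (negligibleU n3 n4).
exists Z; split=> //; first by rewrite /Pr PZ.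
move=> om nZ; split.
- by apply: contrapT => h; apply/nZ/sZ; left; left.
- by apply: contrapT => h; apply/nZ/sZ; left; right.
- by move=> M; apply: contrapT => h; apply/nZ/sZ; right; left; exists M.
- by move=> m; apply: contrapT => h; apply/nZ/sZ; right; right; exists m.
Qed.

Lemma frozen_no_ring om q : (forall i, 0 < xi i om) -> frozen T xi q om ->
  forall b v, 0 < v -> v <= T -> ~ rings_at (x om) q b v.
Proof.
move=> xpos /frozenP[f1 f2] b v v0 vT [k vE].
have : xi (q, b, 0%N) om <= v.
  by rewrite vE big_ord_recl lerDl; apply: sumr_ge0 => j _; exact/ltW/xpos.
by move: f1 f2 vT; case: b {vE} => f1 f2 vT; lra.
Qed.

Definition asep_path (om : Om) : int -> int := path_of (fun p => X p T om).

Lemma measurable_asep_path l : measurable [set om | asep_path om = l].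
Proof.
apply: (@measurable_path_of _ _ (fun p om => X p T om)) => p z.
by case: asepX => _ _ + _; apply; exact: ltW.
Qed.

(** Two blockers are used: a frozen particle [N'] far behind makes [trajectory_run] applicable, and
    [q], silent in the words for [N] and for [N'], reduces both to the same letters with labels
    below [q]. *)
Lemma asep_path_run om N H : typical om ->
  history T (x om) N H -> miss N [seq e.2 | e <- H] ->
  asep_path om = path_of (run [seq e.2 | e <- H]).
Proof.
move=> [traj xpos allH frz] hH /hasP[q].
rewrite mem_iota add0n => /= qN mq.
congr path_of; apply/funext => p.
have [N' NN' fN'] := frz (maxn N p.+1).
have [NN pN] : (N <= N')%N /\ (p < N')%N by move: NN'; clear; lia.
have [H' hH'] := allH N'.
rewrite (trajectory_run T_gt0 traj (frozen_no_ring xpos fN') hH' allH pN).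
have HE : H = [seq e <- H' | (e.2.1 < N)%N].
  exact: history_uniq hH (history_filter NN hH').
have wE : [seq e.2 | e <- H] = [seq c <- [seq e.2 | e <- H'] | (c.1 < N)%N].
  by rewrite HE filter_map.
have mq' : all (fun c => c.1 != q) [seq e.2 | e <- H'].
  apply/allP => c cH'; apply/eqP => cq.
  have : c \in [seq e.2 | e <- H] by rewrite wE mem_filter cq qN.
  by move=> /(allP mq); rewrite cq eqxx.
have [-> _] := run_miss mq'; have [-> _] := run_miss mq.
rewrite wE -filter_predI; congr (run _ p).
apply: eq_filter => c /=; case: ltnP => //= cq.
by rewrite (ltn_trans cq qN).
Qed.

End StepASEP.

(** * The eigenvector relation *)

Definition fin_path (l : int -> int) : Prop :=
  exists N n, [/\ (0 < N)%N, (N <= n)%N & conf (1 - N%:Z) n l].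

Lemma conf_widen N N' n n' l : (N <= N')%N -> (n + (N' - N) <= n')%N ->
  conf (1 - N%:Z) n l -> conf (1 - N'%:Z) n' l.
Proof.
move=> NN nn [ul lA lB]; split=> // i h; first by apply: lA; move: h NN; clear; lia.
by apply: lB; move: h NN nn; clear; lia.
Qed.

Lemma fin_path_run w : fin_path (path_of (run w)).
Proof.
pose N := (\max_(c <- w) c.1).+1.
have aw : all (fun c => (c.1 < N)%N) w.
  by apply/allP => c cw; rewrite ltnS; exact: leq_bigmax_seq.
exists N, (N + size w)%N; split; [by []|exact: leq_addr|].
by apply: conf_path_of (run_packed aw) _ _; have := run_front w; clear; lia.
Qed.

Section FullLineWeight.
Context {R : realType} (t : R).

(* The ordering [g <= l] is not required: it is enforced by the factor
   [1 - t ^ 0 = 0] at the first place where it fails. *)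
Definition HL_line (l g : int -> int) : R :=
  if `[< fin_path l /\ fin_path g >] then
    \big[*%R/1]_(i \in [set: int]) HL_factor t (gap l g) i
  else 0.

Lemma HL_factor_conf N n l g i : conf (1 - N%:Z) n l -> conf (1 - N%:Z) n g ->
  (i < 1 - N%:Z) || (1 - N%:Z + n%:Z < i) -> HL_factor t (gap l g) i = 1.
Proof.
move=> [_ lA lB] [_ gA gB] h; rewrite /HL_factor.
suff -> : (gap l g (i - 1) - gap l g i == 1) = false by rewrite mul0r subr0.
apply/negbTE; case/orP: h => h; first by rewrite /gap !lA ?gA//; lia.
by rewrite /gap !lB ?gB//; lia.
Qed.

Lemma HL_line_conf N n l g : (0 < N)%N -> (N <= n)%N ->
  conf (1 - N%:Z) n l -> conf (1 - N%:Z) n g ->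
  HL_line l g = HL_prod t (1 - N%:Z) n.+1 l g.
Proof.
move=> N0 Nn cl cg; rewrite /HL_line asboolT; last by split; exists N, n.
pose r := [seq (1 - N%:Z) + j%:Z | j <- iota 0 n.+1].
have out (i : int) : i \notin r -> HL_factor t (gap l g) i = 1.
  move=> ni; apply: (HL_factor_conf cl cg); apply: contraNT ni.
  rewrite negb_or -!leNgt => /andP[i0 i1].
  apply/mapP; exists `|(i - (1 - N%:Z))%R|%N; last by lia.
  by rewrite mem_iota; lia.
rewrite (fsbigE r) //.
- rewrite big_map /HL_prod /index_iota subn0.
  by apply: eq_bigl => j; exact: mem_set.
- by rewrite map_inj_uniq ?iota_uniq// => a b /addrI [].
- by move=> i _; exact: out.
Qed.

Lemma HL_line_bounds (t_gt0 : 0 < t) (t_lt1 : t < 1) l g :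
  0 <= HL_line l g /\ HL_line l g <= 1.
Proof.
have [[fl fg]|nf] := pselect (fin_path l /\ fin_path g); last first.
  by rewrite /HL_line asboolF.
have [N1 [n1 [N10 Nn1 c1]]] := fl; have [N2 [n2 [N20 Nn2 c2]]] := fg.
have c1' : conf (1 - (N1 + N2)%:Z) (n1 + n2 + N1 + N2) l.
  by apply: conf_widen c1; lia.
have c2' : conf (1 - (N1 + N2)%:Z) (n1 + n2 + N1 + N2) g.
  by apply: conf_widen c2; lia.
rewrite (HL_line_conf _ _ c1' c2'); [|lia..].
have [ul lA _] := c1'; have [ug gA _] := c2'.
have [] := HL_prod_bounds t_gt0 t_lt1 (n1 + n2 + N1 + N2).+1 ul ug
  (A := 1 - (N1 + N2)%:Z).
- by rewrite /gap lA ?gA ?subrr//; lia.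
- by move=> ->.
- by move=> [/ltW].
Qed.

Lemma HL_line_gap (t_gt0 : 0 < t) (t_lt1 : t < 1) c e :
  HL_line c e != 0 -> forall i, 0 <= gap c e i.
Proof.
move=> W0; have [[fc fe]|nf] := pselect (fin_path c /\ fin_path e); last first.
  by move: W0; rewrite /HL_line asboolF// eqxx.
have [N1 [n1 [N10 Nn1 c1]]] := fc; have [N2 [n2 [N20 Nn2 c2]]] := fe.
pose N := (N1 + N2)%N; pose n := (n1 + n2 + N1 + N2)%N.
have c1' : conf (1 - N%:Z) n c by apply: conf_widen c1; rewrite /N /n; lia.
have c2' : conf (1 - N%:Z) n e by apply: conf_widen c2; rewrite /N /n; lia.
move: W0; rewrite (HL_line_conf _ _ c1' c2'); [|rewrite /N /n; lia..].
have [uc cA cB] := c1'; have [ue eA eB] := c2'.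
have gb : 0 <= gap c e (1 - N%:Z - 1) by rewrite /gap cA ?eA ?subrr//; lia.
have [->|[_ _ H] _ i] := HL_prod_bounds t_gt0 t_lt1 n.+1 uc ue gb.
  by rewrite eqxx.
have [iA|iA] := ltP i (1 - N%:Z); first by rewrite /gap cA ?eA ?subrr.
have [iB|iB] := leP (1 - N%:Z + n%:Z) i; first by rewrite /gap cB ?eB ?subrr.
have := H `|(i - (1 - N%:Z - 1))%R|%N.
have -> : 1 - N%:Z - 1 + `|(i - (1 - N%:Z - 1))%R|%N%:Z = i by lia.
by apply; lia.
Qed.

End FullLineWeight.

Section PathLaw.
Context {R : realType} d (Om : measurableType d) (P : probability Om R).
Variables (t T : R) (xi : nat * bool * nat -> {RV P >-> R}).
Variable X : nat -> R -> Om -> int.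
Hypotheses (t_gt0 : 0 < t) (t_lt1 : t < 1) (T_gt0 : 0 < T).
Hypothesis asepX : is_step_asep t 1 xi X.

Let xi_indep : mutually_independent xi. Proof. by case: asepX. Qed.

Let xi_law (p : nat) (dir : bool) (k : nat) (A : set R) : measurable A ->
  P (xi (p, dir, k) @^-1` A) = exponential_prob (if dir then 1 else t) A.
Proof. by case: asepX => _ + _ _; apply. Qed.

Let L := asep_path T X.
Let mL l : measurable [set om | L om = l].
Proof. exact: measurable_asep_path T_gt0 asepX l. Qed.

Definition path_prob (l : int -> int) : R := Pr P [set om | L om = l].

Lemma path_prob_ge0 l : 0 <= path_prob l.
Proof. exact: Pr_ge0. Qed.

Let g w := path_of (run w).
Let wp := word_prob t T.

Let wp_ge0 N w : 0 <= wp N w.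
Proof.
rewrite /wp /word_prob mulr_ge0 ?expR_ge0 ?mulr_ge0 ?wt_ge0 ?exprn_ge0//.
exact: ltW.
Qed.

Lemma word_prob_le_path_prob N K l :
  \sum_(w <- all_words N K | miss N w && (g w == l)) wp N w <= path_prob l.
Proof.
have [Z [mZ PZ typ]] := asep_null_set t_gt0 t_lt1 T_gt0 asepX.
rewrite -big_filter; apply: (Pr_lower t_gt0 t_lt1 T_gt0 xi_indep xi_law (mL l) mZ PZ).
- by move=> om /typ[].
- by rewrite filter_uniq// all_words_uniq.
- by move=> w; rewrite mem_filter mem_all_words => /and3P[].
- move=> om n ps nZ n0 ok; rewrite mem_filter mem_all_words => /and3P[/andP[mi /eqP <-] _].
  rewrite all_map => aps gr; have ty := typ _ nZ; have [_ xpos _ _] := ty.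
  have hH := grid_event_history T_gt0 n0 xpos ok aps gr.
  have := asep_path_run T_gt0 ty hH.
  by rewrite ring_list_letters; exact.
Qed.

(** If every label below [N] occurs in the word, none of these particles is frozen. This probability
    is the error made by keeping only [N] particles. *)
Lemma word_prob_no_miss N K :
  \sum_(w <- all_words N K | ~~ miss N w) wp N w <= no_freeze t T ^+ N.
Proof.
have [Z [mZ PZ typ]] := asep_null_set t_gt0 t_lt1 T_gt0 asepX.
rewrite -big_filter /no_freeze -[X in _ ^+ X](size_iota 0).
rewrite -(Pr_all_moving t_gt0 T_gt0 xi_indep xi_law (iota_uniq 0 N)).
apply: (Pr_lower t_gt0 t_lt1 T_gt0 xi_indep xi_law _ mZ PZ).
- exact: measurable_all_moving.
- by move=> om /typ[].
- by rewrite filter_uniq// all_words_uniq.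
- by move=> w; rewrite mem_filter mem_all_words => /and3P[].
- move=> om n ps nZ n0 ok; rewrite mem_filter mem_all_words => /and3P[mi _].
  rewrite all_map => aps gr; have [_ xpos _ _] := typ _ nZ.
  have := grid_event_history T_gt0 n0 xpos ok aps gr.
  set H := ring_list _ _ _ => -[_ mH] q qN fq.
  move: mi; rewrite /miss -all_predC => /allP /(_ q qN) /=.
  rewrite -has_predC => /hasP[c].
  rewrite -{1}(ring_list_letters (xi^~ om) (fun=> 0%N) [seq _ | _ <- ps]) -/H.
  move=> /mapP[[s c'] /mH[_ s0 sT rs] /= ->] /negPn /eqP cq.
  by apply: (frozen_no_ring xpos fq s0 sT (b := c'.2)); rewrite -cq.
Qed.

(** A supremum of finite sums over an uncountable set of paths. That no mass is lost has to be
    proved ([path_prob_total]); at first only [E_path1_le1] is known. *)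
Definition E_path (phi : (int -> int) -> R) : \bar R :=
  \esum_(l in [set: int -> int]) (path_prob l * phi l)%:E.

Lemma E_path_lower N K phi : (forall l, 0 <= phi l) ->
  ((\sum_(w <- all_words N K | miss N w) wp N w * phi (g w))%:E <= E_path phi)%E.
Proof.
move=> phi0; pose G := undup [seq g w | w <- all_words N K].
apply: esum_ge; exists [set` G].
  by split => //; exact: finite_seq.
rewrite -fsbig_seq ?undup_uniq// sumEFin lee_fin.
apply: (@le_trans _ _ (\sum_(l <- G)
  \sum_(w <- all_words N K | miss N w && (g w == l)) wp N w * phi l)).
  rewrite le_eqVlt; apply/orP; left; apply/eqP.
  under [RHS]eq_bigr do rewrite big_mkcond /=.
  rewrite exchange_big /= big_mkcond big_seq [RHS]big_seq; apply: eq_bigr => w ww.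
  have gG : g w \in G by rewrite mem_undup; apply/mapP; exists w.
  rewrite (bigD1_seq (g w)) ?undup_uniq//= eqxx andbT big1 ?addr0// => l.
  by rewrite eq_sym => /negbTE->; rewrite andbF.
apply: ler_sum => l _; rewrite -mulr_suml ler_wpM2r//.
exact: word_prob_le_path_prob.
Qed.

Lemma esum_path_prob (A : set (int -> int)) (E : set Om) : measurable E ->
  (forall l, A l -> [set om | L om = l] `<=` E) ->
  (\esum_(l in A) (path_prob l)%:E <= (Pr P E)%:E)%E.
Proof.
move=> mE AE; apply: ub_ereal_sup => _ [F [finF FA] <-].
rewrite fsbig_finite//= sumEFin lee_fin; apply: Pr_disjoint => //.
- exact: fset_uniq.
- by move=> l; rewrite in_fset_set// inE => /FA; exact: AE.
- move=> l l' _ _ ll'; apply/seteqP; split => // om [/= e1 e2].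
  by move: ll'; rewrite -e1 -e2 eqxx.
Qed.

Lemma E_pathD phi psi : (forall l, 0 <= phi l) -> (forall l, 0 <= psi l) ->
  E_path (fun l => phi l + psi l) = (E_path phi + E_path psi)%E.
Proof.
move=> h1 h2; rewrite /E_path -esumD.
- by apply: eq_esum => l _; rewrite mulrDr EFinD.
- by move=> l _; rewrite lee_fin mulr_ge0// path_prob_ge0.
- by move=> l _; rewrite lee_fin mulr_ge0// path_prob_ge0.
Qed.

Lemma E_path1_le1 : (E_path (fun=> 1%R) <= 1)%E.
Proof.
have := esum_path_prob (A := setT) measurableT (fun l _ => @subsetT _ _).
by rewrite Pr_setT; apply: le_trans; apply: le_esum => l _; rewrite mulr1.
Qed.

Lemma E_path_fin phi : (forall l, 0 <= phi l) -> (forall l, phi l <= 1) ->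
  E_path phi = (fine (E_path phi))%:E.
Proof.
move=> h0 h1; rewrite fineK// ge0_fin_numE; last first.
  by apply: esum_ge0 => l _; rewrite lee_fin mulr_ge0// path_prob_ge0.
apply: le_lt_trans (le_lt_trans E_path1_le1 (ltry 1)).
by apply: le_esum => l _; rewrite lee_fin ler_wpM2l// path_prob_ge0.
Qed.

Section Bounds.
Variable phi : (int -> int) -> R.
Hypotheses (phi_ge0 : forall l, 0 <= phi l) (phi_le1 : forall l, phi l <= 1).

Lemma E_path_ge N K :
  rho_sum t T N K (fun w => phi (g w)) - no_freeze t T ^+ N <= fine (E_path phi).
Proof.
rewrite lerBlDr rho_sumE (bigID (miss N)) /= lerD//.
  by rewrite -lee_fin -E_path_fin//; exact: E_path_lower.
apply: le_trans (word_prob_no_miss N K); apply: ler_sum => w _.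
by rewrite ler_piMr.
Qed.

End Bounds.

(** Apply [E_path_ge] to [1 - phi] and use that the total mass is at most 1; the mass missing from
    the truncated sum becomes an error term. *)
Lemma E_path_le phi N K : (forall l, 0 <= phi l) -> (forall l, phi l <= 1) ->
  fine (E_path phi) <= 1 - rho_sum t T N K (fun=> 1) +
    rho_sum t T N K (fun w => phi (g w)) + no_freeze t T ^+ N.
Proof.
move=> h0 h1.
have h0' l : 0 <= 1 - phi l by rewrite subr_ge0.
have h1' l : 1 - phi l <= 1 by rewrite gerBl.
have := E_path_ge h0' h1' N K.
have := E_pathD h0 h0'.
have -> : (fun l => phi l + (1 - phi l)) = (fun=> 1) by apply/funext => l; rewrite addrC subrK.
move=> eD; have := E_path1_le1; rewrite eD (E_path_fin h0 h1) (E_path_fin h0' h1').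
rewrite -EFinD lee_fin.
have := rho_sumD t T N K (fun w => phi (g w)) (fun w => 1 - phi (g w)).
have -> : (fun w => phi (g w) + (1 - phi (g w))) = (fun=> 1).
  by apply/funext => w; rewrite addrC subrK.
by move=> ->; lra.
Qed.

Definition ind_path (l l' : int -> int) : R := `[< l' = l >]%:R.

Lemma E_path_ind l : fine (E_path (ind_path l)) = path_prob l.
Proof.
rewrite /E_path (_ : esum _ _ = (path_prob l)%:E)//.
rewrite -(esum_set1 (t := l) (a := fun l => (path_prob l)%:E)) ?lee_fin ?path_prob_ge0//.
rewrite [RHS]esum_mkcond; apply: eq_esum => l' _; rewrite /ind_path.
case: asboolP => [->|nl]; first by rewrite mem_set// mulr1.
by rewrite memNset// mulr0.
Qed.

Lemma path_prob_not_fin l : ~ fin_path l -> path_prob l = 0.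
Proof.
move=> nf; apply/eqP; rewrite eq_le path_prob_ge0 andbT -E_path_ind.
have i0 l' : 0 <= ind_path l l' by rewrite ler0n.
have i1 l' : ind_path l l' <= 1 by rewrite lern1 leq_b1.
apply: (cvgr_to_ge (no_freeze_cvg t_gt0 T_gt0)); apply: nearW => N.
have lim : 1 - rho_sum t T N K (fun=> 1) + no_freeze t T ^+ N @[K --> \oo] -->
    no_freeze t T ^+ N.
  rewrite -[X in _ --> X]add0r; apply: cvgD; last exact: cvg_cst.
  rewrite -(subrr (1 : R)); apply: cvgB; first exact: cvg_cst.
  exact: rho_sum1_cvg.
apply: (cvgr_to_ge lim); apply: nearW => K.
apply: le_trans (E_path_le N K i0 i1) _; rewrite lerD2r gerDl.
rewrite rho_sumE big1// => w _; rewrite /ind_path asboolF ?mulr0// => e.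
by apply: nf; rewrite -e; exact: fin_path_run.
Qed.

(** For fixed [N], the word comparisons bound the mean from both sides; [K] tends to infinity first,
    which removes the mass of long words, then [N], which removes [no_freeze t T ^+ N]. *)
Lemma HL_line_path_prob l :
  E_path (HL_line t l) = (expR ((1 - t) * T) * path_prob l)%:E.
Proof.
have w0 g' := (HL_line_bounds t_gt0 t_lt1 l g').1.
have w1 g' := (HL_line_bounds t_gt0 t_lt1 l g').2.
rewrite E_path_fin//; congr EFin.
have [[N0 [n0 [N00 Nn0 cl0]]]|nf] := pselect (fin_path l); last first.
  rewrite path_prob_not_fin// mulr0 (_ : HL_line t l = fun=> 0).
    by rewrite /E_path esum1// => l' _; rewrite mulr0.
  by apply/funext => l'; rewrite /HL_line asboolF// => -[].
have i0 l' : 0 <= ind_path l l' by rewrite ler0n.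
have i1 l' : ind_path l l' <= 1 by rewrite lern1 leq_b1.
set s := expR _; set a := fine _; set b := path_prob l.
have s0 : 0 < s by exact: expR_gt0.
pose eps N := no_freeze t T ^+ N; pose r N K := rho_sum t T N K (fun=> 1).
have eps0 N : 0 <= eps N by rewrite exprn_ge0// no_freeze_ge0.
have lim_eps : eps N @[N --> \oo] --> (0 : R) by exact: no_freeze_cvg.
(* Wide enough for [l] itself and for the front after fewer than [K + K] rings. *)
pose n N K := (n0 + N + (K + K + N))%N.
have HLw N K w : (N0 <= N)%N -> all (fun c => (c.1 < N)%N) w -> (size w < K + K)%N ->
    HL_line t l (g w) = HL_prod t (1 - N%:Z) (n N K).+1 l (g w).
  move=> NN aw sw; apply: HL_line_conf.
  - by move: NN N00; clear; lia.
  - by rewrite /n; clear; lia.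
  - by apply: conf_widen cl0; rewrite // /n; clear; lia.
  - apply: conf_path_of (run_packed aw) _ _; have := run_front w.
    by move: sw; rewrite /n; clear; lia.
have cl N K : (N0 <= N)%N -> conf (1 - N%:Z) (n N K) l.
  by move=> NN; apply: conf_widen cl0; rewrite // /n; clear; lia.
have rho_eq N K M : (N0 <= N)%N -> (M <= K + K)%N ->
    rho_sum t T N M (fun w => HL_line t l (g w)) =
    rho_sum t T N M (fun w => HL_prod t (1 - N%:Z) (n N K).+1 l (g w)).
  move=> NN MK; rewrite !rho_sumE big_seq [RHS]big_seq; apply: eq_bigr => w.
  rewrite mem_all_words => /andP[sw aw]; rewrite (HLw N K)//.
  exact: leq_trans MK.
have miss_ind N K : rho_sum t T N K (fun w => ind_path l (g w)) <=
    rho_sum t T N K (fun w => (miss N w)%:R * ind_path l (g w)) + eps N.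
  rewrite !rho_sumE (bigID (miss N)) /= lerD//.
    rewrite [leRHS](bigID (miss N)) /= -[leLHS]addr0 lerD//.
      by apply: ler_sum => w ->; rewrite mul1r.
    by apply: sumr_ge0 => w _; rewrite mulr_ge0 ?wp_ge0// mulr_ge0.
  apply: le_trans (word_prob_no_miss N K); apply: ler_sum => w _.
  by rewrite ler_piMr ?wp_ge0.
have miss_b N K : rho_sum t T N K (fun w => (miss N w)%:R * ind_path l (g w)) <= b.
  rewrite rho_sumE; apply: le_trans (word_prob_le_path_prob N K l).
  rewrite [leRHS]big_mkcond /=; apply: ler_sum => w _.
  rewrite /ind_path; case: (miss N w) => /=; last by rewrite mul0r mulr0.
  rewrite mul1r; case: asboolP => [->|_]; first by rewrite eqxx mulr1.
  by rewrite mulr0; case: ifP => // _; exact: wp_ge0.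
have upper N : (N0 <= N)%N -> a <= s * (b + eps N) + eps N.
  move=> NN.
  have lim : 1 - r N K + (s * (b + eps N) + eps N) @[K --> \oo] -->
      s * (b + eps N) + eps N.
    rewrite -[X in _ --> X]add0r; apply: cvgD; last exact: cvg_cst.
    rewrite -(subrr (1 : R)); apply: cvgB; first exact: cvg_cst.
    exact: rho_sum1_cvg.
  apply: (cvgr_to_ge lim); apply: nearW => K.
  apply: le_trans (E_path_le N K w0 w1) _; rewrite -/(r N K) -addrA lerD2l lerD2r.
  rewrite (rho_eq N K)//; last exact: leq_addr.
  apply: le_trans (rho_sum_HL_upper t_gt0 t_lt1 T_gt0 (K := K) _ _ (cl N K NN)) _.
  - by move: NN N00; clear; lia.
  - by rewrite /n; clear; lia.
  by rewrite ler_wpM2l ?(ltW s0)// (le_trans (miss_ind N K))// lerD2r.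
(* On the left, one [eps N] comes from [E_path_le] for the indicator, the other from discarding the
   words without a silent particle. *)
have lower N : (N0 <= N)%N -> s * (b - 2 * eps N) <= a + eps N.
  move=> NN.
  have lim : expsum ((1 - t) * T) K * (b - (1 - r N K) - 2 * eps N) @[K --> \oo] -->
      s * (b - 2 * eps N).
    apply: cvgM; first exact: expsum_cvg.
    apply: cvgB; last exact: cvg_cst.
    rewrite -[X in _ --> X]subr0; apply: cvgB; first exact: cvg_cst.
    rewrite -(subrr (1 : R)); apply: cvgB; first exact: cvg_cst.
    exact: rho_sum1_cvg.
  apply: (cvgr_to_le lim); apply: nearW => K.
  have := E_path_ge w0 w1 N (K + K); rewrite (rho_eq N K)// -/a lerBlDr.
  apply: le_trans.
  apply: le_trans (rho_sum_HL_lower t_gt0 t_lt1 T_gt0 (K := K) _ _ (cl N K NN)); first last.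
  - by rewrite /n; clear; lia.
  - by move: NN N00; clear; lia.
  rewrite ler_wpM2l ?expsum_ge0 ?mulr_ge0 ?(ltW T_gt0) ?subr_ge0 ?(ltW t_lt1)//.
  have := E_path_le N K i0 i1; rewrite E_path_ind -/b -/(r N K) -/(eps N).
  by have := miss_ind N K; lra.
apply/eqP; rewrite eq_le; apply/andP; split.
  have lim : s * (b + eps N) + eps N @[N --> \oo] --> s * b.
    rewrite -[X in _ --> X]addr0; apply: cvgD => //.
    apply: cvgMr; rewrite -[X in _ --> X]addr0; apply: cvgD => //; exact: cvg_cst.
  apply: (cvgr_to_ge lim); near=> N; apply: upper.
  by near: N; exact: nbhs_infty_ge.
have lim : s * (b - 2 * eps N) - eps N @[N --> \oo] --> s * b.
  rewrite -[X in _ --> X]subr0; apply: cvgB => //.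
  apply: cvgMr; rewrite -[X in _ --> X]subr0; apply: cvgB; first exact: cvg_cst.
  by rewrite -[X in _ --> X](mulr0 2); apply: cvgMr.
apply: (cvgr_to_le lim); near=> N; rewrite lerBlDr; apply: lower.
by near: N; exact: nbhs_infty_ge.
Unshelve. all: by end_near. Qed.

Lemma path_prob_total : \esum_(l in [set: int -> int]) (path_prob l)%:E = 1%E.
Proof.
have i0 (l : int -> int) : 0 <= (1 : R) by [].
have i1 (l : int -> int) : (1 : R) <= 1 by [].
transitivity (E_path (fun=> 1)).
  by apply: eq_esum => l _; rewrite mulr1.
apply/eqP; rewrite eq_le E_path1_le1 /= E_path_fin// lee_fin.
have lim : 1 - no_freeze t T ^+ N @[N --> \oo] --> (1 : R).
  rewrite -[X in _ --> X]subr0; apply: cvgB; first exact: cvg_cst.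
  exact: no_freeze_cvg.
apply: (cvgr_to_le lim); apply: nearW => N.
have lim' : rho_sum t T N K (fun=> 1) - no_freeze t T ^+ N @[K --> \oo] -->
    1 - no_freeze t T ^+ N.
  by apply: cvgB; [exact: rho_sum1_cvg|exact: cvg_cst].
apply: (cvgr_to_le lim'); apply: nearW => K.
exact: (E_path_ge i0 i1).
Qed.

End PathLaw.

(** * The ensemble of infinite curves *)

(** One inequality suffices: for positive [c], the other one is the same inequality for the factor
    [c^-1]. *)
Lemma esumZl (R : realType) (T : choiceType) (A : set T) (c : R) (a : T -> R) :
  0 <= c -> (forall i, A i -> 0 <= a i) ->
  \esum_(i in A) (c * a i)%:E = (c%:E * \esum_(i in A) (a i)%:E)%E.
Proof.
move=> c0 a0.
have le_esumZ (b : R) (f : T -> R) : 0 <= b -> (forall i, A i -> 0 <= f i) ->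
    (\esum_(i in A) (b * f i)%:E <= b%:E * \esum_(i in A) (f i)%:E)%E.
  move=> b0 f0; apply: ub_ereal_sup => _ [F [finF FA] <-].
  have -> : (\sum_(i \in F) (b * f i)%:E = b%:E * \sum_(i \in F) (f i)%:E)%E.
    by rewrite !fsbig_finite//= !sumEFin -mulr_sumr EFinM.
  apply: lee_wpmul2l; first by rewrite lee_fin.
  by apply: esum_ge; exists F.
apply/eqP; rewrite eq_le le_esumZ//=.
move: c0; rewrite [X in is_true X -> _]le_eqVlt => /orP[/eqP<-|c0].
  by rewrite mul0e esum_ge0// => i _; rewrite mul0r.
have := le_esumZ c^-1 (fun i => c * a i).
rewrite invr_ge0 ltW// => /(_ isT) h.
have {}h := h (fun i Ai => mulr_ge0 (ltW c0) (a0 i Ai)).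
rewrite -[leRHS]mul1e -(@mulfV _ c) ?gt_eqF// EFinM -muleA.
apply: lee_wpmul2l; first by rewrite lee_fin ltW.
apply: le_trans h; apply: le_esum => i _.
by rewrite mulrA mulVf ?gt_eqF// mul1r.
Qed.

(* Sequences of curves with the discrete sigma-algebra. *)
Definition path_seq : Type := seq (int -> int).

HB.instance Definition _ := Choice.on path_seq.
HB.instance Definition _ := isPointed.Build path_seq [::].
HB.instance Definition _ := @isMeasurable.Build default_measure_display path_seq
  [set: set path_seq] I (fun _ _ => I) (fun _ _ => I).

Section DiscreteProbability.
Context {R : realType} (w : path_seq -> \bar R).
Hypothesis w_ge0 : forall s, (0 <= w s)%E.
Hypothesis w_total : \esum_(s in [set: path_seq]) w s = 1%E.

Definition seq_prob (A : set path_seq) : \bar R := \esum_(s in A) w s.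

Let seq_prob0 : seq_prob set0 = 0%E. Proof. exact: esum_set0. Qed.

Let seq_prob_ge0 A : (0 <= seq_prob A)%E. Proof. exact: esum_ge0. Qed.

Let seq_prob_sigma : semi_sigma_additive seq_prob.
Proof.
move=> F _ tF _; rewrite /seq_prob (nneseries_sum_bigcup tF w_ge0).
by apply: is_cvg_nneseries => n _ _; exact: esum_ge0.
Qed.

HB.instance Definition _ := isMeasure.Build _ _ _ seq_prob
  seq_prob0 seq_prob_ge0 seq_prob_sigma.

HB.instance Definition _ := Measure_isProbability.Build _ _ _ seq_prob w_total.

Lemma discrete_probability : exists P' : probability path_seq R,
  forall A : set path_seq, P' A = \esum_(s in A) w s.
Proof. by exists seq_prob. Qed.

End DiscreteProbability.

Lemma esum_cons (R : realType) (B : set (int -> int)) (k : nat)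
    (f : path_seq -> \bar R) : (forall s, (0 <= f s)%E) ->
  \esum_(s in [set s : path_seq | size s = k.+1 /\ B (nth (fun=> 0) s 0)]) f s =
  \esum_(c in B) \esum_(s in [set s : path_seq | size s = k]) f (c :: s).
Proof.
move=> f0; rewrite esum_esum//.
apply: (reindex_esum _ _ (fun q : (int -> int) * path_seq => q.1 :: q.2 : path_seq)).
split.
- by move=> [c s] /= [Bc <-].
- by move=> [c s] [c' s'] _ _ /= [-> ->].
- by move=> [|c s] [//= [sk] Bc]; exists (c, s).
Qed.

Section EnsembleWeight.
Context {R : realType} (t T : R).
Hypotheses (t_gt0 : 0 < t) (t_lt1 : t < 1).
Variable p : (int -> int) -> R.
Hypothesis p_ge0 : forall l, 0 <= p l.
Hypothesis p_eigen : forall l,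
  \esum_(g in [set: int -> int]) (p g * HL_line t l g)%:E = (expR ((1 - t) * T) * p l)%:E.
Hypothesis p_total : \esum_(l in [set: int -> int]) (p l)%:E = 1%E.
Hypothesis p_fin : forall l, ~ fin_path l -> p l = 0.

Let nthp (s : path_seq) := nth (fun=> 0 : int) s.

Definition ens_weight (k : nat) (s : path_seq) : R :=
  if size s == k.+1 then
    expR (- ((1 - t) * T)) ^+ k *
    (\prod_(0 <= j < k) HL_line t (nthp s j) (nthp s j.+1)) * p (nthp s k)
  else 0.

Lemma ens_weight_ge0 k s : 0 <= ens_weight k s.
Proof.
rewrite /ens_weight; case: ifP => // _.
rewrite !mulr_ge0 ?exprn_ge0 ?expR_ge0//; apply: prodr_ge0 => j _.
by have [] := HL_line_bounds t_gt0 t_lt1 (nthp s j) (nthp s j.+1).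
Qed.

Lemma ens_weight_cons k c s : size s = k.+1 ->
  ens_weight k.+1 (c :: s) =
  expR (- ((1 - t) * T)) * HL_line t c (nthp s 0) * ens_weight k s.
Proof.
move=> sk; rewrite /ens_weight /= sk !eqxx big_nat_recl//= exprS.
by rewrite !mulrA; congr (_ * _); rewrite -!mulrA; congr (_ * _); rewrite mulrCA.
Qed.

(** Given the second curve [g], the remaining curves sum to [p g] by induction; the relation
    [p_eigen] then cancels one factor of the normalization. *)
Lemma ens_weight_marginal k c :
  \esum_(s in [set s : path_seq | size s = k]) (ens_weight k (c :: s))%:E = (p c)%:E.
Proof.
elim: k c => [|k IH] c.
  rewrite (_ : [set s : path_seq | size s = 0%N] = [set [::]]).
    rewrite esum_set1 ?lee_fin ?ens_weight_ge0//.
    by rewrite /ens_weight /= big_geq// expr0 !mul1r.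
  by apply/seteqP; split => s /=; [exact: size0nil|move=> ->].
have -> : [set s : path_seq | size s = k.+1] =
    [set s : path_seq | size s = k.+1 /\ [set: int -> int] (nth (fun=> 0) s 0)].
  by apply/seteqP; split => s /=; [|case].
rewrite esum_cons; last by move=> s; rewrite lee_fin ens_weight_ge0.
transitivity (\esum_(g in [set: int -> int])
    (expR (- ((1 - t) * T)) * (p g * HL_line t c g))%:E).
  apply: eq_esum => g _.
  transitivity (\esum_(s in [set s : path_seq | size s = k])
     (expR (- ((1 - t) * T)) * HL_line t c g * ens_weight k (g :: s))%:E).
    by apply: eq_esum => s /= sk; rewrite ens_weight_cons//= sk.
  rewrite esumZl.
  - by rewrite IH -EFinM -mulrA [p g * _]mulrC.
  - rewrite mulr_ge0 ?expR_ge0//.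
    by have [] := HL_line_bounds t_gt0 t_lt1 c g.
  - by move=> s _; exact: ens_weight_ge0.
rewrite esumZl ?expR_ge0//; last first.
  move=> g _; rewrite mulr_ge0//.
  by have [] := HL_line_bounds t_gt0 t_lt1 c g.
by rewrite p_eigen -EFinM mulrA [expR _ * expR _]mulrC expRxMexpNx_1 mul1r.
Qed.

Lemma ens_weight_head k (B : set (int -> int)) :
  \esum_(s in [set s : path_seq | B (nthp s 0)]) (ens_weight k s)%:E =
  \esum_(c in B) (p c)%:E.
Proof.
transitivity (\esum_(s in [set s : path_seq | size s = k.+1 /\ B (nthp s 0)])
    (ens_weight k s)%:E).
  rewrite esum_mkcond [RHS]esum_mkcond; apply: eq_esum => s _.
  have [sk|sk] := eqVneq (size s) k.+1; last first.
    by rewrite /ens_weight (negbTE sk); case: ifP; case: ifP.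
  congr (if _ then _ else _); apply/idP/idP; rewrite !inE; first by [].
  by case.
rewrite esum_cons; last by move=> s; rewrite lee_fin ens_weight_ge0.
by apply: eq_esum => c _; exact: ens_weight_marginal.
Qed.

Lemma ens_weight_total k :
  \esum_(s in [set: path_seq]) (ens_weight k s)%:E = 1%E.
Proof. by rewrite -p_total -(ens_weight_head k). Qed.

Lemma ens_weight_fin k s j : (j <= k)%N -> ens_weight k s != 0 -> fin_path (nthp s j).
Proof.
move=> jk; rewrite /ens_weight; case: ifP => _; last by rewrite eqxx.
move=> n0; apply: contrapT => nf; move/eqP: n0; apply.
move: jk; rewrite leq_eqVlt => /orP[/eqP jk|jk].
  by rewrite p_fin ?mulr0// -jk.
rewrite (bigD1_seq j) ?iota_uniq ?mem_index_iota//= {1}/HL_line asboolF.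
  by rewrite mul0r mulr0 mul0r.
by case.
Qed.

End EnsembleWeight.

(** * Restriction to a window and the Gibbs property *)

Section Window.
Variables (T0 T1 : int).
Hypothesis T01 : T0 <= T1.

Definition restr (c : int -> int) : zfun T0 T1 :=
  [ffun k : 'I_(`|T1 - T0|%N.+1) => c (T0 + (k : nat)%:Z)].

Lemma val_at_restr c i : T0 <= i -> i <= T1 -> val_at (restr c) i = c i.
Proof.
move=> i0 i1; rewrite /val_at /restr ffunE inordK; first by congr c; lia.
by lia.
Qed.

Lemma restr_up_right c : up_rightZ c -> up_right (restr c).
Proof.
move=> uc i i0 i1; rewrite !val_at_restr; [|lia..].
by have := uc (i + 1); rewrite addrK; lia.
Qed.

Lemma zfun_ext (l l' : zfun T0 T1) :
  (forall i, T0 <= i -> i <= T1 -> val_at l i = val_at l' i) -> l = l'.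
Proof.
move=> H; apply/ffunP => k; have kk := ltn_ord k.
have := H (T0 + (k : nat)%:Z); rewrite /val_at.
have -> : inord `|(T0 + (k : nat)%:Z - T0)%R|%N = k.
  by apply: val_inj; rewrite /= inordK; lia.
by apply; lia.
Qed.

Definition splice (c : int -> int) (l : zfun T0 T1) : int -> int :=
  fun i => if (T0 <= i) && (i <= T1) then val_at l i else c i.

Lemma restr_splice c l : restr (splice c l) = l.
Proof.
apply: zfun_ext => i i0 i1; rewrite val_at_restr// /splice i0 i1.
by [].
Qed.

Section SpliceEnds.
Variables (c : int -> int) (l : zfun T0 T1).
Hypotheses (l0 : val_at l T0 = c T0) (l1 : val_at l T1 = c T1).

Lemma splice_out i : (i <= T0) || (T1 <= i) -> splice c l i = c i.
Proof.
move=> h; rewrite /splice; case: ifP => // /andP[i0 i1].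
have [->|e] : i = T0 \/ i = T1 by lia.
  exact: l0.
by rewrite e.
Qed.

Lemma splice_up_right : up_rightZ c -> up_right l -> up_rightZ (splice c l).
Proof.
move=> uc ul i; have [iT0|iT0] := leP i T0.
  by rewrite !splice_out; [exact: uc|lia..].
have [iT1|iT1] := leP i T1; last by rewrite !splice_out; [exact: uc|lia..].
rewrite /splice !ifT; [|lia..].
by have := ul (i - 1); rewrite subrK; lia.
Qed.

Lemma splice_fin_path : fin_path c -> up_right l -> fin_path (splice c l).
Proof.
move=> [N [n [N0 Nn cc]]] ul.
pose m := (`|T0| + `|T1| + 2)%N.
have cc' : conf (1 - (N + m)%N%:Z) (n + m + m) c by apply: conf_widen cc; lia.
exists (N + m)%N, (n + m + m)%N; split; [lia|lia|].
have [uc cA cB] := cc'; split; first exact: splice_up_right.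
  by move=> i iA; rewrite splice_out ?cA//; rewrite /m in iA; lia.
by move=> i iB; rewrite splice_out ?cB//; rewrite /m in iB; lia.
Qed.

End SpliceEnds.

Section Weights.
Context {R : realType} (t : R).
Hypotheses (t_gt0 : 0 < t) (t_lt1 : t < 1).

Let S := zint (T0 + 1) T1.

Definition window_prod (l g : zfun T0 T1) : R :=
  \big[*%R/1]_(i \in S) HL_factor t (fun j => val_at l j - val_at g j) i.

(** The factor at [i] reads the sites [i - 1] and [i]. For [i] outside [zint (T0 + 1) T1] neither is
    interior to the window, so replacing the inside of a curve with its end values kept does not
    change this product. *)
Definition outer_prod (c e : int -> int) : R :=
  \big[*%R/1]_(i \in ~` S) HL_factor t (gap c e) i.

Lemma finite_zint lo hi : finite_set (zint lo hi).
Proof.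
apply: (@sub_finite_set _ _ [set` [seq lo + j%:Z | j <- iota 0 (`|hi - lo| + 1)]]).
  move=> i /andP[i0 i1]; have e : lo + `|(i - lo)%R|%N%:Z = i by lia.
  apply/mapP; exists `|(i - lo)%R|%N => //.
  by rewrite mem_iota; lia.
exact: finite_seq.
Qed.

Lemma HL_line_split c e : fin_path c -> fin_path e ->
  HL_line t c e = outer_prod c e * window_prod (restr c) (restr e).
Proof.
move=> fc fe; rewrite /HL_line asboolT//.
have [N1 [n1 [N10 Nn1 c1]]] := fc; have [N2 [n2 [N20 Nn2 c2]]] := fe.
pose m := (`|T0| + `|T1| + 2)%N.
pose N := (N1 + N2 + m)%N; pose n := (n1 + n2 + N1 + N2 + m + m)%N.
have c1' : conf (1 - N%:Z) n c by apply: conf_widen c1; rewrite /N /n; lia.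
have c2' : conf (1 - N%:Z) n e by apply: conf_widen c2; rewrite /N /n; lia.
pose D := zint (1 - N%:Z) (1 - N%:Z + n%:Z).
have out i : ~ D i -> HL_factor t (gap c e) i = 1.
  move=> nD; apply: (HL_factor_conf t c1' c2'); rewrite !ltNge -negb_and.
  by apply/negP => h; apply: nD; rewrite /D /zint /=.
have SD : S `<=` D.
  by move=> i; rewrite /S /D /zint /= /N /n /m; lia.
rewrite -(fsbig_widen D) //; last by move=> i [_ nD]; exact: out.
rewrite (fsbigID S); last exact: finite_zint.
rewrite [RHS]mulrC /=; congr (_ * _).
  have -> : D `&` S = S.
    by apply/seteqP; split => [i []//|i Si]; split => //; exact: SD.
  apply: eq_fsbigr => i.
  rewrite inE /S /zint /= => /andP[i0 i1].
  by rewrite /HL_factor /gap !val_at_restr//; lia.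
rewrite /outer_prod; apply: fsbig_widen; first exact: subIsetr.
move=> i [nS nDS]; apply: out => Di; apply: nDS; split => //.
Qed.

Lemma outer_prod_splicel c e l : val_at l T0 = c T0 -> val_at l T1 = c T1 ->
  outer_prod (splice c l) e = outer_prod c e.
Proof.
move=> l0 l1; apply: eq_fsbigr => i; rewrite inE /S /zint /= => /negP nS.
by rewrite /HL_factor /gap !splice_out//; lia.
Qed.

Lemma outer_prod_splicer c e l : val_at l T0 = e T0 -> val_at l T1 = e T1 ->
  outer_prod c (splice e l) = outer_prod c e.
Proof.
move=> l0 l1; apply: eq_fsbigr => i; rewrite inE /S /zint /= => /negP nS.
by rewrite /HL_factor /gap !splice_out//; lia.
Qed.

Lemma window_prod_ge0 l g : (forall i, S i -> val_at g i <= val_at l i) ->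
  0 <= window_prod l g.
Proof.
move=> H; rewrite /window_prod fsbig_finite; last exact: finite_zint.
rewrite big_seq; apply: prodr_ge0 => i; rewrite in_fset_set; last exact: finite_zint.
rewrite inE => Si; have := H i Si; rewrite /HL_factor.
case: eqP => [e gl|_ _]; last by rewrite mul0r subr0.
rewrite mul1r subr_ge0.
have : 0 <= val_at l (i - 1) - val_at g (i - 1) by lia.
case: (val_at l (i - 1) - val_at g (i - 1)) => // m _.
by rewrite -exprnP exprn_ile1// ltW.
Qed.

Lemma HL_weightE (l : zfun T0 T1) f g : HL_weight t l f g S =
  if `[< forall i, S i -> (if f is Some f' then val_at l i <= val_at f' i else true) /\
                      val_at g i <= val_at l i >]
  then (if f is Some f' then window_prod f' l else 1) * window_prod l g else 0.
Proof. by rewrite /HL_weight /window_prod; case: f. Qed.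

Lemma HL_weight_ge0 (l : zfun T0 T1) f g : 0 <= HL_weight t l f g S.
Proof.
rewrite HL_weightE; case: asboolP => // H; rewrite mulr_ge0//.
  case: f H => // f H; apply: window_prod_ge0 => i Si.
  by have [] := H i Si.
by apply: window_prod_ge0 => i Si; have [] := H i Si.
Qed.

End Weights.

Lemma up_right_bound (l : zfun T0 T1) : up_right l -> forall j : nat,
  T0 + j%:Z <= T1 -> val_at l T0 <= val_at l (T0 + j%:Z) /\
  val_at l (T0 + j%:Z) <= val_at l T0 + j%:Z.
Proof.
move=> ul; elim=> [|j IH] jT; first by rewrite !addr0.
have [|h1 h2] := IH; first by lia.
have := ul (T0 + j%:Z); have -> : T0 + j%:Z + 1 = T0 + j.+1%:Z by lia.
by move=> h; have := h ltac:(lia) ltac:(lia); move: h1 h2; clear; lia.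
Qed.

(** Heights relative to [a] lie between 0 and [T1 - T0], so bridges come from a finite type of
    functions. *)
Lemma finite_bridges a b : finite_set (@up_right_bridges T0 T1 a b).
Proof.
pose h (k : {ffun 'I_(`|T1 - T0|%N.+1) -> 'I_(`|T1 - T0|%N.+1)}) : zfun T0 T1 :=
  [ffun i => a + (k i : nat)%:Z].
apply: (@sub_finite_set _ _ (h @` setT)); last exact: finite_image.
move=> l [ul la lb]; exists [ffun i => inord `|(l i - a)%R|%N] => //.
apply/ffunP => i; rewrite !ffunE.
have ii := ltn_ord i.
have vi : val_at l (T0 + (i : nat)%:Z) = l i.
  rewrite /val_at; congr (l _); apply: val_inj.
  by rewrite /= inordK; lia.
have [|h1 h2] := up_right_bound ul (j := i); first by lia.
rewrite vi la in h1 h2.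
have la0 : 0 <= l i - a by rewrite subr_ge0.
have e := gez0_abs la0.
rewrite inordK; first by rewrite e [a + _]addrC subrK.
rewrite ltnS -lez_nat e lerBlDl (le_trans h2)//.
by rewrite lerD2l lez_nat -ltnS.
Qed.

End Window.

Section PairSwap.
Context {R : realType} (t : R).
Hypotheses (t_gt0 : 0 < t) (t_lt1 : t < 1).
Variables (T0 T1 : int).
Hypothesis T01 : T0 <= T1.

Let S := zint (T0 + 1) T1.

Definition upper_line (up : option (int -> int)) (c : int -> int) : R :=
  if up is Some u then HL_line t u c else 1.

Definition fin_path_opt (up : option (int -> int)) : Prop :=
  if up is Some u then fin_path u else True.

(** [HL_weight] contains the ordering as an indicator, the full-line weight only through vanishing
    factors; where the latter does not vanish, the ordering holds and the indicator is 1. *)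
Lemma HL_weight_nz up c e : fin_path c ->
  upper_line up c * HL_line t c e != 0 ->
  HL_weight t (restr T0 T1 c) (omap (restr T0 T1) up) (restr T0 T1 e) S =
  (if up is Some u then window_prod t (restr T0 T1 u) (restr T0 T1 c) else 1) *
  window_prod t (restr T0 T1 c) (restr T0 T1 e).
Proof.
rewrite mulf_eq0 negb_or => fc /andP[U0 D0].
rewrite HL_weightE asboolT; first by case: up {U0}.
move=> i; rewrite /S /zint /= => /andP[i0 i1].
have := HL_line_gap t_gt0 t_lt1 D0 i; rewrite /gap subr_ge0 => h1.
rewrite !val_at_restr; [|lia..]; split=> //.
case: up U0 => //= u U0; rewrite !val_at_restr; [|lia..].
by have := HL_line_gap t_gt0 t_lt1 U0 i; rewrite /gap subr_ge0.
Qed.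

Lemma window_prod_neq0 c e : HL_line t c e != 0 ->
  window_prod t (restr T0 T1 c) (restr T0 T1 e) != 0.
Proof.
have [[fc fe]|nf] := pselect (fin_path c /\ fin_path e); last first.
  by rewrite /HL_line asboolF// eqxx.
by rewrite (@HL_line_split T0 T1)// mulf_eq0 negb_or => /andP[].
Qed.

Lemma HL_weight_neq0 up c e : fin_path c ->
  upper_line up c * HL_line t c e != 0 ->
  HL_weight t (restr T0 T1 c) (omap (restr T0 T1) up) (restr T0 T1 e) S != 0.
Proof.
move=> fc nz; rewrite HL_weight_nz//; move: nz.
rewrite !mulf_eq0 !negb_or => /andP[U0 D0]; rewrite window_prod_neq0// andbT.
by case: up U0 => [u|_]; [exact: window_prod_neq0|exact: oner_neq0].
Qed.

(** A ratio identity, cross-multiplied so that no weight has to be nonzero. The full-line weights of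
    [c] and of its splice are a common outer factor [out] times the window part [In]. *)
Lemma pair_swap up c e (l : zfun T0 T1) : fin_path c -> up_right l ->
  val_at l T0 = c T0 -> val_at l T1 = c T1 ->
  upper_line up (splice c l) * HL_line t (splice c l) e *
    HL_weight t (restr T0 T1 c) (omap (restr T0 T1) up) (restr T0 T1 e) S =
  upper_line up c * HL_line t c e *
    HL_weight t l (omap (restr T0 T1) up) (restr T0 T1 e) S.
Proof.
move=> fc ul l0 l1; have fc' := splice_fin_path T01 l0 l1 fc ul.
have [fe|nfe] := pselect (fin_path e); last first.
  have Z c1 : HL_line t c1 e = 0 by rewrite /HL_line asboolF// => -[].
  by rewrite !Z !mulr0 !mul0r.
pose In (c1 : zfun T0 T1) : R :=
  (if up is Some u then window_prod t (restr T0 T1 u) c1 else 1) *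
  window_prod t c1 (restr T0 T1 e).
have [out Hout Hout'] : exists2 out : R,
    upper_line up c * HL_line t c e = out * In (restr T0 T1 c) &
    upper_line up (splice c l) * HL_line t (splice c l) e = out * In l.
  case: up @In => [u|] In /=; last first.
    exists (outer_prod T0 T1 t c e); rewrite /In !mul1r; first exact: HL_line_split.
    by rewrite (@HL_line_split T0 T1)// restr_splice// outer_prod_splicel.
  have [fu|nfu] := pselect (fin_path u); last first.
    have Z c1 : HL_line t u c1 = 0 by rewrite /HL_line asboolF// => -[].
    by exists 0; rewrite Z !mul0r.
  exists (outer_prod T0 T1 t u c * outer_prod T0 T1 t c e); rewrite /In.
    by rewrite !(@HL_line_split T0 T1)//; ring.
  rewrite !(@HL_line_split T0 T1)// !restr_splice//.
  by rewrite outer_prod_splicel// outer_prod_splicer//; ring.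
have W1 : upper_line up c * HL_line t c e != 0 ->
    HL_weight t (restr T0 T1 c) (omap (restr T0 T1) up) (restr T0 T1 e) S =
    In (restr T0 T1 c).
  exact: HL_weight_nz.
have W2 : upper_line up (splice c l) * HL_line t (splice c l) e != 0 ->
    HL_weight t l (omap (restr T0 T1) up) (restr T0 T1 e) S = In l.
  by move=> nz; have := HL_weight_nz fc' nz; rewrite restr_splice.
have Z (l2 : zfun T0 T1) :
    HL_weight t l2 (omap (restr T0 T1) up) (restr T0 T1 e) S = 0 \/
    HL_weight t l2 (omap (restr T0 T1) up) (restr T0 T1 e) S = In l2.
  rewrite HL_weightE; case: asboolP => _; [right|by left].
  by rewrite /In; case: (up).
(* When a full-line weight [out * In] is 0, the opposite side must vanish too: the [HL_weight]
   occurring there is 0 or the same [In], which multiplies [out]. *)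
have [e1|/W1 e1] := eqVneq (upper_line up c * HL_line t c e) 0.
  have [e2|/W2 e2] := eqVneq (upper_line up (splice c l) * HL_line t (splice c l) e) 0.
    by rewrite e1 e2 !mul0r.
  rewrite e1 mul0r Hout'; case: (Z (restr T0 T1 c)) => ->; first by rewrite mulr0.
  by rewrite mulrAC -Hout e1 mul0r.
have [e2|/W2 e2] := eqVneq (upper_line up (splice c l) * HL_line t (splice c l) e) 0.
  rewrite e2 mul0r Hout; case: (Z l) => ->; first by rewrite mulr0.
  by rewrite mulrAC -Hout' e2 mul0r.
by rewrite e1 e2 Hout Hout'; ring.
Qed.

End PairSwap.

Section GibbsProperty.
Context {R : realType} (t T : R).
Hypotheses (t_gt0 : 0 < t) (t_lt1 : t < 1).
Variable p : (int -> int) -> R.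
Hypothesis p_ge0 : forall l, 0 <= p l.
Hypothesis p_fin : forall l, ~ fin_path l -> p l = 0.
Variables (T0 T1 : int).
Hypothesis T01 : T0 <= T1.
Variable k : nat.

Let nthp (s : path_seq) := nth (fun=> 0 : int) s.

Let S := zint (T0 + 1) T1.

(** A line ensemble must be up-right at every sample point, while [path_seq] contains arbitrary
    functions. Entries that are not [fin_path] occur with weight 0 only and are replaced by a
    constant path. *)
Definition fin_part (c : int -> int) : int -> int :=
  if `[< fin_path c >] then c else fun=> 0.

Definition window_line (i : 'I_k.+1) (s : path_seq) : zfun T0 T1 :=
  restr T0 T1 (fin_part (nthp s i)).

Lemma window_line_up_right i s : up_right (window_line i s).
Proof.
apply: restr_up_right => // j; rewrite /fin_part; case: asboolP; last by left.
by move=> [N [n [_ _ [ul _ _]]]]; exact: ul.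
Qed.

Definition rest_weight (i : nat) (s : path_seq) : R :=
  expR (- ((1 - t) * T)) ^+ k *
  (\prod_(0 <= j < i.-1) HL_line t (nthp s j) (nthp s j.+1)) *
  (\prod_(i.+1 <= j < k) HL_line t (nthp s j) (nthp s j.+1)) * p (nthp s k).

Definition above (i : nat) (s : path_seq) : option (int -> int) :=
  if i is i'.+1 then Some (nthp s i') else None.

Lemma ens_weight_split i s : (i < k)%N -> size s = k.+1 ->
  ens_weight t T p k s = rest_weight i s *
    (upper_line t (above i s) (nthp s i) * HL_line t (nthp s i) (nthp s i.+1)).
Proof.
move=> ik sk; rewrite /ens_weight sk eqxx /rest_weight.
rewrite (big_cat_nat (n := i) (p := k)) ?(ltnW ik)//= (big_ltn ik).
case: i ik => [|i] ik /=; first by rewrite !(@big_geq _ _ _ 0 0)//; ring.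
by rewrite big_nat_recr//=; ring.
Qed.

Lemma nthp_set_nth i s c j : (j == i) = false ->
  nthp (set_nth (fun=> 0) s i c) j = nthp s j.
Proof. by move=> ji; rewrite /nthp nth_set_nth [LHS]/= ji. Qed.

Lemma rest_weight_set_nth i s c : (i < k)%N ->
  rest_weight i (set_nth (fun=> 0) s i c) = rest_weight i s.
Proof.
move=> ik; rewrite /rest_weight; congr (_ * _ * _ * _).
- apply: eq_big_nat => j ji.
  by rewrite !nthp_set_nth//; move: ji; clear; lia.
- apply: eq_big_nat => j ji.
  by rewrite !nthp_set_nth//; move: ji; clear; lia.
- by rewrite nthp_set_nth//; move: ik; clear; lia.
Qed.

Lemma window_line_set_nth i s c (j : 'I_k.+1) : (j : nat) != i ->
  window_line j (set_nth (fun=> 0) s i c) = window_line j s.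
Proof.
by move=> /negbTE ji; rewrite /window_line nthp_set_nth.
Qed.

Lemma window_line_fin (i : 'I_k.+1) s : fin_path (nthp s i) ->
  window_line i s = restr T0 T1 (nthp s i).
Proof. by move=> fi; rewrite /window_line /fin_part asboolT. Qed.

Lemma val_ord_pred (i : 'I_k.+1) : (0 < i)%N -> (ord_pred i : nat) = i.-1.
Proof.
move=> i0; rewrite /=; have ii := ltn_ord i.
have -> : (i + k.+1).-1 = (i.-1 + k.+1)%N by lia.
by rewrite modnDr modn_small//; lia.
Qed.

Lemma val_ordS (i : 'I_k.+1) : (i < k)%N -> (ordS i : nat) = i.+1.
Proof. by move=> ik; rewrite /= modn_small. Qed.

Lemma above_set_nth i s c : above i (set_nth (fun=> 0) s i c) = above i s.
Proof. by case: i => //= i; rewrite nthp_set_nth//; clear; lia. Qed.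

Lemma curve_above_window (i : 'I_k.+1) s :
  fin_path_opt (above i s) ->
  curve_above window_line i s = omap (restr T0 T1) (above i s).
Proof.
rewrite /curve_above /window_line; case E : (nat_of_ord i) => [|m] fu //.
by rewrite val_ord_pred E// /fin_part asboolT.
Qed.

Variable P' : probability path_seq R.
Hypothesis P'E : forall A : set path_seq,
  P' A = \esum_(s in A) (ens_weight t T p k s)%:E.

(** Splicing [l1] into curve [i] is a bijection from the configurations in [E] with line [l0] to
    those with line [l1], and by [pair_swap] it multiplies weights in the ratio of [W l1] to [W l0].
    So the conditional law is proportional to [W]. *)
Lemma HL_Gibbs_window : HL_Gibbs P' t S window_line.
Proof.
move=> i ik f g a b E PE l bl.
(* The curves have indices 0 to [k]; the last one is exempt, and [ordS i] does not wrap around. *)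
have {}ik : (i < k)%N by rewrite -ltnS.
have w_ge0 s : 0 <= ens_weight t T p k s by exact: ens_weight_ge0.
pose Q (l0 : zfun T0 T1) := [set s : path_seq |
  [/\ size s = k.+1, fin_path (nthp s i), E s & window_line i s = l0]].
have QE l0 : P' (E `&` [set s | window_line i s = l0]) =
    \esum_(s in Q l0) (ens_weight t T p k s)%:E.
  rewrite P'E esum_mkcond [RHS]esum_mkcond; apply: eq_esum => s _.
  have [w0|wn0] := eqVneq (ens_weight t T p k s) 0.
    by rewrite w0; case: ifP; case: ifP.
  congr (if _ then _ else _); apply/idP/idP; rewrite !inE /Q /=.
    move=> [Es ls]; split=> //.
      by apply: contrapT => ns; move: wn0; rewrite /ens_weight ifN ?eqxx//; apply/eqP.
    by apply: (ens_weight_fin p_fin _ wn0); exact: ltnW.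
  by case.
pose W (l0 : zfun T0 T1) := HL_weight t l0 f g S.
have W_ge0 l0 : 0 <= W l0 by exact: HL_weight_ge0.
pose sw (l1 : zfun T0 T1) (s : path_seq) : path_seq :=
  set_nth (fun=> 0) s i (splice (nthp s i) l1).
have nth_sw l1 s : nthp (sw l1 s) i = splice (nthp s i) l1.
  by rewrite /nthp /sw nth_set_nth /= eqxx.
have ends l0 s : up_right_bridges a b l0 -> Q l0 s ->
    forall l1 : zfun T0 T1, up_right_bridges a b l1 ->
    val_at l1 T0 = nthp s i T0 /\ val_at l1 T1 = nthp s i T1.
  move=> [_ la lb] [_ fs _ ls] l1 [_ la1 lb1].
  rewrite la1 lb1 -la -lb -ls window_line_fin// !val_at_restr//.
have Q_sw l0 l1 s : up_right_bridges a b l0 -> up_right_bridges a b l1 ->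
    Q l0 s -> Q l1 (sw l1 s).
  move=> b0 b1 Qs; have [e0 e1] := ends _ _ b0 Qs _ b1.
  have [sk fs Es ls] := Qs; have [u1 la1 lb1] := b1.
  have fs' : fin_path (nthp (sw l1 s) i).
    by rewrite nth_sw; exact: splice_fin_path.
  have li : window_line i (sw l1 s) = l1.
    by rewrite window_line_fin// nth_sw restr_splice.
  have [_ _ Ef Eg] := Es.
  split=> //; first by rewrite /sw size_set_nth sk; apply/maxn_idPr.
  split; rewrite ?li//.
    rewrite -Ef /curve_above; case: eqP => // /eqP i0; congr Some.
    by apply: window_line_set_nth; rewrite val_ord_pred ?lt0n//; lia.
  rewrite -Eg; apply: window_line_set_nth; rewrite val_ordS//.
  by rewrite neq_ltn ltnSn orbT.
have sw_sw l0 l1 s : Q l0 s -> sw l0 (sw l1 s) = s.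
  move=> [sk fs _ ls]; apply: (@eq_from_nth _ (fun=> 0)).
    by rewrite /sw !size_set_nth sk; lia.
  move=> j jk; rewrite {1}/sw nth_set_nth /=; case: eqP => [->|/eqP ji].
    rewrite nth_sw -ls window_line_fin//; apply/funext => z.
    rewrite /splice; case: ifP => [/andP[z0 z1]|-> //].
    by rewrite val_at_restr.
  by rewrite /sw nth_set_nth /= (negbTE ji).
have W_sw l0 l1 s : up_right_bridges a b l0 -> up_right_bridges a b l1 -> Q l0 s ->
    ens_weight t T p k (sw l1 s) * W l0 = ens_weight t T p k s * W l1.
  move=> b0 b1 Qs; have [e0 e1] := ends _ _ b0 Qs _ b1.
  have [sk fs Es ls] := Qs; have [u1 la1 lb1] := b1; have [_ _ Ef Eg] := Es.
  have [sk' _ _ _] := Q_sw _ _ _ b0 b1 Qs.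
  rewrite !(ens_weight_split ik)// {1}/sw rest_weight_set_nth//.
  have a_sw : above i (sw l1 s) = above i s by exact: above_set_nth.
  have n_sw : nthp (sw l1 s) i.+1 = nthp s i.+1.
    by rewrite nthp_set_nth//; lia.
  rewrite a_sw n_sw nth_sw -![rest_weight _ _ * _ * _]mulrA; congr (_ * _).
  have [fe|nfe] := pselect (fin_path (nthp s i.+1)); last first.
    have Z c1 : HL_line t c1 (nthp s i.+1) = 0 by rewrite /HL_line asboolF// => -[].
    by rewrite !Z !mulr0 !mul0r.
  have Eg' : g = restr T0 T1 (nthp s i.+1).
    by rewrite -Eg /window_line val_ordS// /fin_part asboolT.
  have [fu|nfu] := pselect (fin_path_opt (above i s)); last first.
    have Z c1 : upper_line t (above i s) c1 = 0.
      case: (above i s) nfu => [u nfu|/(_ I)//].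
      by rewrite /upper_line /HL_line asboolF// => -[].
    by rewrite !Z !mul0r.
  have Ef' : f = omap (restr T0 T1) (above i s).
    by rewrite -Ef curve_above_window.
  rewrite /W Ef' Eg' -ls window_line_fin//.
  exact: pair_swap.
have key (l0 l1 : zfun T0 T1) : up_right_bridges a b l0 -> up_right_bridges a b l1 ->
    ((W l0)%:E * P' (E `&` [set s | window_line i s = l1]) =
     (W l1)%:E * P' (E `&` [set s | window_line i s = l0]))%E.
  move=> b0 b1; rewrite !QE -!esumZl//.
  rewrite (reindex_esum (Q l0) _ (sw l1)).
    apply: eq_esum => s Qs; rewrite mulrC W_sw// mulrC //.
  split.
  - by move=> s Qs; exact: Q_sw Qs.
  - move=> s s'; rewrite !inE => Qs Qs' e.
    by rewrite -(sw_sw _ l1 _ Qs) -(sw_sw _ l1 _ Qs') e.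
  - move=> s Qs; exists (sw l0 s); first exact: Q_sw Qs.
    exact: sw_sw Qs.
pose q (l0 : zfun T0 T1) := Pr P' (E `&` [set s | window_line i s = l0]).
have mE (A : set path_seq) : measurable A by [].
have keyq (l0 l1 : zfun T0 T1) : up_right_bridges a b l0 -> up_right_bridges a b l1 ->
    W l0 * q l1 = W l1 * q l0.
  by move=> b0 b1; have := key _ _ b0 b1; rewrite !PrE// -!EFinM => -[].
pose B := fset_set (@up_right_bridges T0 T1 a b).
have inB (l0 : zfun T0 T1) : l0 \in B <-> up_right_bridges a b l0.
  rewrite /B in_fset_set; last exact: finite_bridges.
  by rewrite inE.
have sumq : Pr P' E = \sum_(l0 <- B) q l0.
  apply: EFin_inj; rewrite -PrE// P'E.
  rewrite -sumEFin (eq_bigr (fun l0 =>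
    \esum_(s in E) ((window_line i s == l0)%:R * ens_weight t T p k s)%:E)); last first.
    move=> l0 _; rewrite -PrE// P'E esum_mkcond [RHS]esum_mkcond.
    apply: eq_esum => s _; case: eqP => [e|ne].
      rewrite mul1r; congr (if _ then _ else _); apply/idP/idP; rewrite !inE.
        by case.
      by [].
    rewrite mul0r [RHS]if_same; case: ifP => //; rewrite inE => -[_ /ne].
    by [].
  rewrite -esum_sum; last by move=> s l0 _ _; rewrite lee_fin mulr_ge0.
  apply: eq_esum => s Es; rewrite sumEFin -mulr_suml; congr EFin.
  have sB : window_line i s \in B.
    by apply/inB; have [Ea Eb _ _] := Es; split=> //; exact: window_line_up_right.
  rewrite (bigD1_seq (window_line i s)) ?fset_uniq//= eqxx big1 ?addr0 ?mul1r//.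
  by move=> l0; rewrite eq_sym => /negbTE->.
have PE0 : 0 < Pr P' E by rewrite -lte_fin -PrE.
(* A reference line of positive mass: its weight [W l0] is nonzero, so every other mass is expressed
   through it before normalizing. *)
have [l0 l0B q0] : exists2 l0, l0 \in B & 0 < q l0.
  apply: contrapT => nex; move: PE0; rewrite sumq ltNge => /negP; apply.
  rewrite big_seq; apply: sumr_le0 => l0 l0B; rewrite leNgt; apply/negP => q0.
  by apply: nex; exists l0.
have b0 := (inB l0).1 l0B.
have W0 : W l0 != 0.
  apply/eqP => w0.
  have : (0 < P' (E `&` [set s | window_line i s = l0]))%E by rewrite PrE// lte_fin.
  rewrite QE; apply/negP; rewrite -leNgt.
  suff H s : Q l0 s -> ens_weight t T p k s = 0.
    by rewrite esum1// => s /H->.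
  move=> Qs; apply/eqP; apply: contrapT => /negP wn0; move/eqP: w0; apply/negP.
  have [sk fs [_ _ Ef Eg] ls] := Qs.
  have fe : fin_path (nthp s i.+1) by exact: ens_weight_fin wn0.
  have fu : fin_path_opt (above i s).
    rewrite /above; case Ei : (nat_of_ord i) => [|m]//.
    by apply: (ens_weight_fin p_fin _ wn0); move: ik Ei; clear; lia.
  move: wn0; rewrite (ens_weight_split ik)// mulf_eq0 negb_or => /andP[_ nz].
  rewrite /W -ls -Ef curve_above_window// -Eg /window_line val_ordS//.
  by rewrite /fin_part !asboolT//; exact: HL_weight_neq0.
have qE (l1 : zfun T0 T1) : up_right_bridges a b l1 -> q l1 = q l0 / W l0 * W l1.
  by move=> b1; rewrite mulrAC -[_ * W l1]mulrC -keyq// mulrC mulKf.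
rewrite /cond_prob setIC -[fine (P' E)]/(Pr P' E) -[fine _]/(q l) sumq.
rewrite qE// (eq_big_seq (fun l1 => q l0 / W l0 * W l1)); last first.
  by move=> l1 /inB; exact: qE.
rewrite -mulr_sumr -mulf_div divff ?mul1r; last first.
  by rewrite mulf_neq0 ?invr_neq0// gt_eqF.
by rewrite fsbig_finite//; exact: finite_bridges.
Qed.

End GibbsProperty.

Lemma measurable_ffun_event d (Om : measurableType d) n (f : 'I_n -> Om -> int)
    (B : set {ffun 'I_n -> int}) :
  (forall j z, measurable [set om | f j om = z]) ->
  measurable [set om | B [ffun j => f j om]].
Proof.
move=> mf.
rewrite [X in measurable X](_ : _ = \bigcup_(v : {ffun 'I_n -> int})
    if `[< B v >] then \bigcap_(j : 'I_n) [set om | f j om = v j] else set0).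
  apply: measurable_bigcup_count => v; case: ifP => _ //.
  by apply: measurable_bigcap_count => j; exact: mf.
apply/seteqP; split => om /=.
  move=> Bf; exists [ffun j => f j om] => //; rewrite asboolT// => j _ /=.
  by rewrite ffunE.
move=> [v _]; case: asboolP => // Bv fv.
rewrite (_ : [ffun j => f j om] = v)//.
by apply/ffunP => j; rewrite ffunE; exact: fv.
Qed.

Section PathEvents.
Context {R : realType} d (Om : measurableType d) (P : probability Om R).
Variables (t T : R) (xi : nat * bool * nat -> {RV P >-> R}).
Variable X : nat -> R -> Om -> int.
Hypotheses (t_gt0 : 0 < t) (t_lt1 : t < 1) (T_gt0 : 0 < T).
Hypothesis asepX : is_step_asep t 1 xi X.

(** The sums over [A] and over its complement are at most the probabilities of the two events, and
    in both cases the total is 1; so both bounds are equalities. *)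
Lemma esum_path_probE (A : set (int -> int)) :
  measurable [set om | A (asep_path T X om)] ->
  \esum_(l in A) (path_prob P T X l)%:E = P [set om | A (asep_path T X om)].
Proof.
set E := [set om | _] => mE; have mC := measurableC mE.
have hA : (\esum_(l in A) (path_prob P T X l)%:E <= (Pr P E)%:E)%E.
  by apply: (esum_path_prob T_gt0 asepX) => // l Al om /= e; rewrite /E /= e.
have hC : (\esum_(l in ~` A) (path_prob P T X l)%:E <= (Pr P (~` E))%:E)%E.
  by apply: (esum_path_prob T_gt0 asepX) => // l Al om /= e; rewrite /E /= e.
have p0 l : (0 <= (path_prob P T X l)%:E)%E by rewrite lee_fin path_prob_ge0.
have := path_prob_total t_gt0 t_lt1 T_gt0 asepX.
rewrite (esumID A)//.
rewrite !setTI (PrE P mE) => tot; move: hA hC tot; rewrite (Pr_setC P mE).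
have : (0 <= \esum_(l in A) (path_prob P T X l)%:E)%E by exact: esum_ge0.
have : (0 <= \esum_(l in ~` A) (path_prob P T X l)%:E)%E by exact: esum_ge0.
case: (\esum_(l in A) _)%E => // u; case: (\esum_(l in ~` A) _)%E => // v.
rewrite !lee_fin => _ _ hu hv [uv]; congr EFin; lra.
Qed.

End PathEvents.

Theorem proposition3p12 (R : realType) (t : R) (K1 K2 : nat) (T : R)
    (t_gt0 : 0 < t) (t_lt1 : t < 1) (K1_gt0 : (0 < K1)%N) (K2_gt0 : (0 < K2)%N)
    (T_gt0 : 0 < T)
    (d : measure_display) (Om : measurableType d) (P : probability Om R)
    (xi : nat * bool * nat -> {RV P >-> R}) (X : nat -> R -> Om -> int)
    (asepX : is_step_asep t 1 xi X) :
  exists (d' : measure_display) (Om' : measurableType d')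
         (P' : probability Om' R)
         (L : 'I_K1 -> Om' -> zfun (- K2%:Z) K2%:Z),
    [/\ is_line_ensemble L,
        HL_Gibbs P' t (zint (- K2%:Z + 1) K2%:Z) L
      & same_law P' P
          (fun w => [tuple (val_at (L (Ordinal K1_gt0) w) (- K2%:Z + j%:Z))%:~R
                    | j < (2 * K2).+1])
          (fun w => [tuple (- height (fun p => X p T w) (- K2%:Z + j%:Z + 1))%:~R
                    | j < (2 * K2).+1])].
Proof.
case: K1 K1_gt0 => // k K1_gt0.
have T01 : - K2%:Z <= K2%:Z by lia.
pose p := path_prob P T X.
have p_ge0 l : 0 <= p l by exact: path_prob_ge0.
have p_eigen l : \esum_(g in [set: int -> int]) (p g * HL_line t l g)%:E =
    (expR ((1 - t) * T) * p l)%:E.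
  exact: (HL_line_path_prob t_gt0 t_lt1 T_gt0 asepX).
have p_total := path_prob_total t_gt0 t_lt1 T_gt0 asepX.
have p_fin l : ~ fin_path l -> p l = 0.
  exact: (path_prob_not_fin t_gt0 t_lt1 T_gt0 asepX).
have w_ge0 s : (0 <= (ens_weight t T p k s)%:E)%E by rewrite lee_fin ens_weight_ge0.
have [P' P'E] := discrete_probability w_ge0
  (ens_weight_total t_gt0 t_lt1 p_ge0 p_eigen p_total k).
exists _, path_seq, P', (@window_line (- K2%:Z) K2%:Z k); split.
- by split=> // i w; exact: window_line_up_right.
- exact: HL_Gibbs_window P'E.
move=> A mA; pose F (c : int -> int) : (2 * K2).+1.-tuple R :=
  [tuple (c (- K2%:Z + j%:Z))%:~R | j < (2 * K2).+1].
(* Both vectors are the image under [F] of a path of law [p]: the head of the sequence by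
   [ens_weight_head], the ASEP path by [esum_path_probE]. *)
transitivity (\esum_(c in F @^-1` A) (p c)%:E).
  rewrite -(ens_weight_head t_gt0 t_lt1 p_ge0 p_eigen k) /pushforward P'E.
  rewrite esum_mkcond [RHS]esum_mkcond; apply: eq_esum => s _.
  have [->|wn0] := eqVneq (ens_weight t T p k s) 0; first by case: ifP; case: ifP.
  have fs := ens_weight_fin p_fin (leq0n k) wn0.
  congr (if _ then _ else _).
  have e : [tuple (val_at (window_line (- K2%:Z) K2%:Z (Ordinal K1_gt0) s)
      (- K2%:Z + j%:Z))%:~R | j < (2 * K2).+1] = F (nth (fun=> 0) s 0).
    apply: eq_from_tnth => j; rewrite !tnth_mktuple; congr (_%:~R).
    have jj := ltn_ord j.
    by rewrite window_line_fin// val_at_restr//; move: jj; clear; lia.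
  by apply/idP/idP; rewrite !inE /= e.
rewrite /p (esum_path_probE t_gt0 t_lt1 T_gt0 asepX).
  by [].
pose B : set {ffun 'I_(2 * K2).+1 -> int} :=
  [set v | A [tuple (v j)%:~R | j < (2 * K2).+1]].
rewrite [X in measurable X](_ : _ = [set om |
    B [ffun j : 'I_(2 * K2).+1 => asep_path T X om (- K2%:Z + j%:Z)]]).
  apply: (@measurable_ffun_event _ _ _ (fun j om => asep_path T X om (- K2%:Z + j%:Z))).
  move=> j z; rewrite [X in measurable X](_ : _ =
      [set om | height ((fun q om => X q T om) ^~ om) (- K2%:Z + j%:Z + 1) = - z]).
    apply: measurable_height => q y.
    by case: asepX => _ _ + _; apply; exact: ltW.
  apply/seteqP; split => om /=; rewrite /asep_path /path_of => e; last by rewrite e opprK.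
  by rewrite -e opprK.
suff e om : F (asep_path T X om) = [tuple ([ffun j : 'I_(2 * K2).+1 =>
    asep_path T X om (- K2%:Z + j%:Z)] j)%:~R | j < (2 * K2).+1].
  by apply/seteqP; split => om /=; rewrite /B /= e.
by apply: eq_from_tnth => j; rewrite !tnth_mktuple ffunE.
Qed.
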